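(* Let $n\in\mathbb N$, let $\Omega\subset\mathbb R^n$ be a bounded open set and let $\varphi\in C^1_{\rm pw}(\overline\Omega;\mathbb R^n)$. Suppose that $\mathrm H:\Omega\times\mathbb R^n\times\mathbb R^{n^2}\to\mathbb R$ satisfies $$\mathrm H(x,X,\mathbf X)=h\big(x,X,\mathbf X^\top\mathbf X\big)$$ for some $h\in C\big(\Omega\times\mathbb R^n\times\mathbb R^{n^2}_s\big)$. Assume that for any $(x,X)\in\Omega\times\mathbb R^n$ the function $t\mapsto h(x,X,t\,\mathbb I_n)$ is strictly increasing on $\mathbb R$. Suppose further that there exists $\alpha_0>0$ such that $$\sup_{(x,X)\in\Omega\times\mathbb R^n}h(x,X,\alpha_0\mathbb I_n)<\infty,$$ and that $$\lim_{t\to\infty}\Big(\inf_{(x,X)\in\Omega\times\mathbb R^n}h(x,X,t\,\mathbb I_n)\Big)=\infty .$$ Set $$\Lambda_*:=\max\Big\{\operatorname*{ess\,sup}_{x\in\Omega}h\Big(x,\varphi(x),\|\mathrm D\varphi\|^2_{L^\infty(\Omega)}\mathbb I_n\Big)\,,\ \sup_{(x,X)\in\Omega\times\mathbb R^n}h(x,X,\alpha_0\mathbb I_n)\Big\}.$$ Then the eigenvalue Dirichlet problem $$\mathrm H(\cdot,u,\mathrm Du)=\Lambda\ \text{ a.e. on }\Omega,\qquad u=\varphi\ \text{ on }\partial\Omega,$$ has (infinitely many) strong solutions $(u,\Lambda)\in W^{1,\infty}_\varphi(\Omega;\mathbb R^n)\times(\Lambda_*,\infty)$. In fact, for any fixed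 $\Lambda>\Lambda_*$, it has infinitely many solutions $u\in W^{1,\infty}_\varphi(\Omega;\mathbb R^n)$. Finally, the same conclusions remain true if $h\ge0$ and, in place of strict monotonicity on $\mathbb R$, one only requires that for any $(x,X)\in\Omega\times\mathbb R^n$ the function $t\mapsto h(x,X,t\,\mathbb I_n)$ be strictly increasing on $[0,\infty)$ (all the other assumptions above being kept); in this case, additionally, $\Lambda_*\ge0$.
   Context: $\mathbb R^{n^2}$ denotes the space of real $n\times n$ matrices, $\mathbb R^{n^2}_s$ the subspace of symmetric matrices, and $\mathbb I_n$ the identity matrix. For $u:\Omega\to\mathbb R^n$, $\mathrm Du=(\mathrm D_iu_\alpha)$ is the $n\times n$ (weak) gradient matrix. $\|\mathrm D\varphi\|_{L^\infty(\Omega)}$ is the essential supremum over $\Omega$ of the Euclidean (Frobenius) norm of $\mathrm D\varphi$. $W^{1,\infty}_0(\Omega;\mathbb R^n)$ is the subspace of zero-trace maps of $W^{1,\infty}(\Omega;\mathbb R^n)$ (i.e. $W^{1,\infty}\cap W^{1,1}_0$), and $W^{1,\infty}_\varphi(\Omega;\mathbb R^n):=\varphi+W^{1,\infty}_0(\Omega;\mathbb R^n)$; the boundary condition $u=\varphi$ on $\partial\Omega$ means $u\in W^{1,\infty}_\varphi(\Omega;\mathbb R^n)$. Strong solutions are those satisfying the PDE a.e. on $\Omega$ for the weak gradient of $u$. A map $u\in W^{1,\infty}(\Omega;\mathbb R^n)$ is piecewise-$C^1$, written $u\in C^1_{\rm pw}(\overline\Omega;\mathbb R^n)$, if there exist countably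 many disjoint open sets $\Omega_i\subseteq\Omega$ ($i=1,2,\ldots$) such that $\Omega\setminus\bigcup_i\Omega_i$ is a Lebesgue nullset and $u|_{\Omega_i}\in C^1(\overline\Omega_i;\mathbb R^n)$ for every $i$, i.e. $u|_{\Omega_i}$ extends to a map which is $C^1$ up to the boundary of $\Omega_i$.
   Formalization: Ω is assumed nonempty, and the claim of infinitely many pairs (u,Λ) is made only when Λ_* < ∞, since the stated hypotheses allow Λ_* = ∞, in which case (Λ_*,∞) is empty and no pair exists. *)

(* Defs.v *)
From HB Require Import structures.
From mathcomp Require Import all_boot all_order all_algebra.
From mathcomp Require Import all_classical all_reals all_analysis.
From mathcomp Require Import measurable_realfun ess_sup_inf.
Set Implicit Arguments.
Unset Strict Implicit.
Unset Printing Implicit Defensive.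
Import Order.TTheory GRing.Theory Num.Theory.
Import numFieldNormedType.Exports.
Local Open Scope classical_set_scope.
Local Open Scope ring_scope.

Section borel.
Context (R : realType) (m n : nat).
Let borel0 : <<s @open 'M[R]_(m, n) >> set0. Proof. exact: sigma_algebra0. Qed.
Let borelC A : <<s @open 'M[R]_(m, n) >> A -> <<s @open 'M[R]_(m, n) >> (~` A).
Proof. exact: sigma_algebraC. Qed.
Let borelU (F : (set 'M[R]_(m, n))^nat) :
  (forall i, <<s @open 'M[R]_(m, n) >> (F i)) ->
  <<s @open 'M[R]_(m, n) >> (\bigcup_i F i).
Proof. exact: sigma_algebra_bigcup. Qed.
HB.instance Definition _ :=
  @isMeasurable.Build (sigma_display (@open 'M[R]_(m, n))) 'M[R]_(m, n) _
    borel0 borelC borelU.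
End borel.

Section measurable_row.
Context (R : realType) (n : nat).

Lemma measurable_row_coord (i : 'I_n) :
  measurable_fun [set: 'rV[R]_n] (fun v => v ord0 i : measurableTypeR R).
Proof.
apply: (measurability _ (RGenOpens.measurableE R)) => _ [_ [a [b ->] <-]].
rewrite setTI; apply: sub_sigma_algebra.
by apply: open_comp => [v _|]; [exact: coord_continuous|exact: interval_open].
Qed.

Lemma row_open_bigcup (U : set 'rV[R]_n) : open U ->
  U = \bigcup_(qk in [set qk : 'rV[rat]_n * nat |
        ball (map_mx ratr qk.1 : 'rV[R]_n) qk.2.+1%:R^-1 `<=` U])
      ball (map_mx ratr qk.1 : 'rV[R]_n) qk.2.+1%:R^-1.
Proof.
move=> oU; apply/seteqP; split=> [v Uv|v [qk /= sub qkv]]; last exact: sub.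
have /nbhs_ballP[e /= e0 eU] : nbhs v U by exact: open_nbhs_nbhs.
have [k _ /= ke] : \forall k \near \oo, k.+1%:R^-1 < e / 2.
  exact: (near_infty_natSinv_lt (PosNum (divr_gt0 e0 (ltr0Sn R 1)))).
have {}ke : k.+1%:R^-1 < e / 2 by exact: ke (leqnn k).
pose d : R := k.+1%:R^-1.
have d0 : 0 < d by rewrite invr_gt0.
have qP i : {q : rat | ratr q \in `]v ord0 i - d, v ord0 i + d[%R}.
  apply/cid; have [|q qP] := @rat_in_itvoo R (v ord0 i - d) (v ord0 i + d).
    by rewrite ltrBlDr -addrA ltrDl addr_gt0.
  by exists q.
pose q : 'rV[rat]_n := \row_i sval (qP i).
have qv : ball (map_mx ratr q : 'rV[R]_n) d v.
  split=> // i j; rewrite (ord1 i) !mxE /ball /=; case: (qP j) => r /=.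
  rewrite in_itv/= => /andP[h1 h2]; rewrite ltr_distl; apply/andP; split;
    rewrite // ltrBlDr.
exists (q, k) => //= w qw; apply: eU.
apply: (@le_ball _ _ _ (d + d)); last exact: ball_triangle (ball_sym qv) qw.
by rewrite (splitr e) lerD// ltW.
Qed.

Lemma measurable_fun_row d (T : measurableType d) (f : T -> 'rV[R]_n) :
  (forall i, measurable_fun [set: T] (fun x => f x ord0 i : measurableTypeR R)) ->
  measurable_fun [set: T] f.
Proof.
move=> mf; apply: (measurability (@open 'rV[R]_n)) => // _ [U oU <-].
rewrite setTI (row_open_bigcup oU) preimage_bigcup bigcup_mkcond.
apply: countable_bigcupT_measurable => // -[q k]; case: ifPn => // _.
rewrite (_ : _ @^-1` _ = \bigcap_i
    (fun x => f x ord0 i : R) @^-1` ball (ratr (q ord0 i) : R) k.+1%:R^-1).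
  apply: (@fin_bigcap_measurable _ _ _ [set: 'I_n]) => [|i _]; first exact: finite_finset.
  rewrite -[X in measurable X]setTI.
  by apply: mf => //; apply: open_measurable; apply: ball_open; rewrite invr_gt0.
apply/seteqP; split=> [x [_ h] i _|x h].
  by have := h ord0 i; rewrite mxE.
by split=> [|i j]; rewrite ?invr_gt0// (ord1 i) mxE; exact: h.
Qed.

End measurable_row.

Section lebesgue_measure_row_step.
Context (R : realType) (n : nat).

Definition row_cons (p : measurableTypeR R * 'rV[R]_n) : 'rV[R]_n.+1 :=
  row_mx p.1%:M p.2 : 'rV_(1 + n).

Lemma row_cons0 p : row_cons p ord0 ord0 = p.1.
Proof.
transitivity ((row_mx p.1%:M p.2 : 'rV[R]_(1 + n)) ord0 (lshift n ord0)).
  by congr (fun_of_matrix _ _ _); exact: val_inj.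
by rewrite row_mxEl mxE mulr1n.
Qed.

Lemma row_consS p i : row_cons p ord0 (lift ord0 i) = p.2 ord0 i.
Proof.
transitivity ((row_mx p.1%:M p.2 : 'rV[R]_(1 + n)) ord0 (rshift 1 i)).
  by congr (fun_of_matrix _ _ _); exact: val_inj.
by rewrite row_mxEr.
Qed.

Lemma measurable_row_cons : measurable_fun setT row_cons.
Proof.
apply: measurable_fun_row => i; have [j ->|->] := unliftP ord0 i.
  under eq_fun do rewrite row_consS.
  exact: (measurableT_comp (@measurable_row_coord R n j) measurable_snd).
under eq_fun do rewrite row_cons0.
exact: measurable_fst.
Qed.

Definition row_uncons (v : 'rV[R]_n.+1) : measurableTypeR R * 'rV[R]_n :=
  (v ord0 ord0, \row_i v ord0 (lift ord0 i)).

Lemma row_consK : cancel row_cons row_uncons.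
Proof.
move=> [x v]; rewrite /row_uncons row_cons0; congr pair.
by apply/rowP => i; rewrite mxE row_consS.
Qed.

Lemma measurable_row_uncons : measurable_fun setT row_uncons.
Proof.
apply/measurable_fun_pairP; split; first exact: measurable_row_coord.
apply: measurable_fun_row => i.
under eq_fun do rewrite mxE.
exact: measurable_row_coord.
Qed.

Variable mu : {sigma_finite_measure set 'rV[R]_n -> \bar R}.

Definition lebesgue_row_step : set 'rV[R]_n.+1 -> \bar R :=
  pushforward (@lebesgue_measure R \x mu)%E row_cons.

Let m0 : lebesgue_row_step set0 = 0%E.
Proof. by rewrite /lebesgue_row_step /pushforward preimage_set0 measure0. Qed.

Let m_ge0 A : (0 <= lebesgue_row_step A)%E.
Proof. by rewrite /lebesgue_row_step /pushforward. Qed.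

Let m_sigma_additive : semi_sigma_additive lebesgue_row_step.
Proof.
have mf := measurable_row_cons.
exact: (@measure_semi_sigma_additive _ _ _
  (measure_function_pushforward__canonical__measure_function_Measure _ mf)).
Qed.

HB.instance Definition _ := isMeasure.Build _ _ _ lebesgue_row_step
  m0 m_ge0 m_sigma_additive.

Let m_sigma_finite : sigma_finite setT lebesgue_row_step.
Proof.
have /sigma_finiteP[F [TF ndF Foo]] := sigma_finiteT (@lebesgue_measure R).
have /sigma_finiteP[G [TG ndG Goo]] := sigma_finiteT mu.
exists (fun i => row_uncons @^-1` (F i `*` G i)).
  apply/esym; rewrite -subTset => v _.
  have [i _ Fi] : (\bigcup_i F i) (row_uncons v).1 by rewrite -TF.
  have [j _ Gj] : (\bigcup_i G i) (row_uncons v).2 by rewrite -TG.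
  exists (maxn i j) => //; split.
    by have /subsetPset := ndF _ _ (leq_maxl i j); exact.
  by have /subsetPset := ndG _ _ (leq_maxr i j); exact.
move=> i; have [mFi Fioo] := Foo i; have [mGi Gioo] := Goo i; split.
  rewrite -[X in measurable X]setTI.
  by apply: measurable_row_uncons => //; exact: measurableX.
rewrite /lebesgue_row_step /pushforward -comp_preimage.
rewrite (_ : row_uncons \o row_cons = id); last by apply/funext => p; exact: row_consK.
by rewrite preimage_id product_measure1E// lte_mul_pinfty// ge0_fin_numE.
Qed.

HB.instance Definition _ := Measure_isSigmaFinite.Build _ _ _
  lebesgue_row_step m_sigma_finite.

End lebesgue_measure_row_step.

(* Lebesgue measure on the Borel sets of R^n, obtained by iterated products;
   [lebesgue_row_box] gives its value on products of measurable sets, which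
   characterizes it. *)
Fixpoint lebesgue_row (R : realType) (n : nat) :
    {sigma_finite_measure set 'rV[R]_n -> \bar R} :=
  match n with
  | 0 => [the {sigma_finite_measure set 'rV[R]_0 -> \bar R}
          of \d_ (0 : 'rV[R]_0)]
  | n'.+1 => [the {sigma_finite_measure set 'rV[R]_n'.+1 -> \bar R}
              of lebesgue_row_step (lebesgue_row R n')]
  end.

Lemma lebesgue_row_box (R : realType) n (A : 'I_n -> set R) :
  (forall i, measurable (A i)) ->
  lebesgue_row R n [set v | forall i, A i (v ord0 i)] =
  (\prod_(i < n) @lebesgue_measure R (A i))%E.
Proof.
elim: n A => [|n IH] A mA.
  by rewrite big_ord0 /= diracE mem_set// => -[].
rewrite big_ord_recl -IH; last by move=> i; exact: mA.
rewrite /= /lebesgue_row_step /pushforward.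
rewrite (_ : _ @^-1` _ = A ord0 `*`
    [set v : 'rV[R]_n | forall i, A (lift ord0 i) (v ord0 i)]).
  apply: product_measure1E; first exact: mA.
  rewrite (_ : [set _ | _] = \bigcap_(i in [set: 'I_n])
      (fun v : 'rV[R]_n => v ord0 i) @^-1` A (lift ord0 i)); last first.
    by apply/seteqP; split=> v h i; [move=> _; exact: h|exact: h].
  apply: fin_bigcap_measurable => [|i _]; first exact: finite_finset.
  rewrite -[X in measurable X]setTI.
  by apply: measurable_row_coord => //; exact: mA.
apply/seteqP; split=> [p /= h|p /= [h0 h] i].
  split; first by have := h ord0; rewrite row_cons0.
  by move=> i; have := h (lift ord0 i); rewrite row_consS.
by have [j ->|->] := unliftP ord0 i; rewrite ?row_cons0// row_consS; exact: h.
Qed.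

Section sobolev.
Context (R : realType) (n : nat).
Local Notation Rn := 'rV[R]_n.
Local Notation mu := (lebesgue_row R n).
Implicit Types (Omega : set Rn) (u phi : Rn -> Rn) (G : Rn -> 'M[R]_n).

Definition frobenius p q (A : 'M[R]_(p, q)) : R :=
  Num.sqrt (\sum_i \sum_j A i j ^+ 2).

(* Row [a], column [i] holds the [i]-th partial derivative of the [a]-th
   component; the library's [jacobian] acts on row vectors on the right, so it
   is the transpose of this matrix. *)
Definition gradient u (x : Rn) : 'M[R]_n := (jacobian u x)^T.

Definition pderiv (i : 'I_n) (f : Rn -> R) : Rn -> R :=
  'D_(delta_mx ord0 i) f.

Fixpoint continuously_derivable (k : nat) (f : Rn -> R) : Prop :=
  match k with
  | 0 => continuous f
  | k'.+1 => continuous f /\ forall i : 'I_n,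
      (forall x, derivable f x (delta_mx ord0 i)) /\
      continuously_derivable k' (pderiv i f)
  end.

Definition test_function Omega (f : Rn -> R) : Prop :=
  (forall k, continuously_derivable k f) /\
  exists K : set Rn, [/\ compact K, K `<=` Omega & forall x, ~ K x -> f x = 0].

Definition test_field Omega (psi : Rn -> Rn) : Prop :=
  forall a, test_function Omega (fun x => psi x ord0 a).

Definition loc_integrable Omega (f : Rn -> R) : Prop :=
  forall K : set Rn, compact K -> K `<=` Omega ->
    mu.-integrable K (EFin \o f).

Definition is_weak_gradient Omega u G : Prop :=
  [/\ forall a, loc_integrable Omega (fun x => u x ord0 a),
      forall a i, loc_integrable Omega (fun x => G x a i) &
      forall (a i : 'I_n) (f : Rn -> R), test_function Omega f ->
        (\int[mu]_(x in Omega) (u x ord0 a * pderiv i f x) =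
         - \int[mu]_(x in Omega) (G x a i * f x))%R].

(* A representative of the weak gradient, which is unique up to a null set when
   it exists; the zero field is a junk value otherwise. *)
Definition weak_gradient Omega u : Rn -> 'M[R]_n :=
  xget (fun=> 0) [set G | is_weak_gradient Omega u G].

Definition weakly_differentiable Omega u : Prop :=
  exists G, is_weak_gradient Omega u G.

(* Elements of Lebesgue and Sobolev spaces are represented by Borel functions;
   every class contains one. *)
Definition Linfty Omega p q (f : Rn -> 'M[R]_(p, q)) : Prop :=
  measurable_fun Omega f /\
  exists M : R, \forall x \ae mu, Omega x -> frobenius (f x) <= M.

Definition L1 Omega p q (f : Rn -> 'M[R]_(p, q)) : Prop :=
  measurable_fun Omega f /\
  (\int[mu]_(x in Omega) (frobenius (f x))%:E < +oo)%E.

Definition W1oo Omega u : Prop :=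
  [/\ Linfty Omega u, weakly_differentiable Omega u &
      Linfty Omega (weak_gradient Omega u)].

Definition W11 Omega u : Prop :=
  [/\ L1 Omega u, weakly_differentiable Omega u &
      L1 Omega (weak_gradient Omega u)].

(* The closure of the smooth compactly supported fields in W^{1,1}. *)
Definition W11_0 Omega u : Prop :=
  W11 Omega u /\
  exists psi : nat -> Rn -> Rn, (forall k, test_field Omega (psi k)) /\
    (fun k => \int[mu]_(x in Omega)
       (frobenius (u x - psi k x) +
        frobenius (weak_gradient Omega u x - gradient (psi k) x))%:E)%E
      @ \oo --> 0%E.

Definition W1oo_0 Omega u : Prop := W1oo Omega u /\ W11_0 Omega u.

Definition W1oo_bd Omega phi u : Prop := W1oo_0 Omega (fun x => u x - phi x).

Definition ess_sup_on Omega (f : Rn -> \bar R) : \bar R :=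
  ess_sup mu (fun x => if x \in Omega then f x else -oo%E).

Definition Linfty_norm Omega G : R :=
  fine (ess_sup_on Omega (fun x => (frobenius (G x))%:E)).

Definition C1_up_to_boundary (D : set Rn) (g : Rn -> Rn) : Prop :=
  [/\ {within closure D, continuous g},
      forall x, D x -> differentiable g x &
      exists Dg : Rn -> 'M[R]_n, {within closure D, continuous Dg} /\
        forall x, D x -> gradient g x = Dg x].

(* Some of the open sets [O i] may be empty, so that this covers finite families
   as well; the restriction of the class of [phi] to [O i] is required to have a
   representative that is C^1 up to the boundary. *)
Definition C1_pw Omega phi : Prop :=
  W1oo Omega phi /\
  exists O : nat -> set Rn,
    [/\ forall i, open (O i) /\ O i `<=` Omega,
        trivIset setT O,
        mu.-negligible (Omega `\` \bigcup_i O i) &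
        forall i, exists g : Rn -> Rn, C1_up_to_boundary (O i) g /\
          \forall x \ae mu, O i x -> phi x = g x].

Definition sup_scalar Omega (h : Rn -> Rn -> 'M[R]_n -> R) (t : R) : \bar R :=
  ereal_sup [set (h p.1 p.2 t%:M)%:E | p in Omega `*` [set: Rn]].

Definition inf_scalar Omega (h : Rn -> Rn -> 'M[R]_n -> R) (t : R) : \bar R :=
  ereal_inf [set (h p.1 p.2 t%:M)%:E | p in Omega `*` [set: Rn]].

Definition Lambda_star Omega phi (h : Rn -> Rn -> 'M[R]_n -> R) (alpha0 : R) :
    \bar R :=
  maxe (ess_sup_on Omega (fun x =>
          (h x (phi x) (Linfty_norm Omega (weak_gradient Omega phi) ^+ 2)%:M)%:E))
       (sup_scalar Omega h alpha0).

Definition strong_solution Omega phi (H : Rn -> Rn -> 'M[R]_n -> R)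
    u (Lambda : R) : Prop :=
  W1oo_bd Omega phi u /\
  \forall x \ae mu, Omega x -> H x (u x) (weak_gradient Omega u x) = Lambda.

Definition ae_eq_on Omega u v : Prop :=
  \forall x \ae mu, Omega x -> u x = v x.

Definition infinitely_many (T : Type) (eqv : T -> T -> Prop) (S : set T) : Prop :=
  exists s : nat -> T, (forall k, S (s k)) /\
    forall j k, j <> k -> ~ eqv (s j) (s k).

(* Solutions are counted up to almost everywhere equality. The bound [Lstar] may
   be infinite, in which case there is no admissible eigenvalue at all. *)
Definition infinitely_many_solutions Omega phi (H : Rn -> Rn -> 'M[R]_n -> R)
    (Lstar : \bar R) : Prop :=
  ((Lstar < +oo)%E ->
    infinitely_many
      (fun p q : (Rn -> Rn) * R => ae_eq_on Omega p.1 q.1 /\ p.2 = q.2)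
      [set p | (Lstar < p.2%:E)%E /\ strong_solution Omega phi H p.1 p.2]) /\
  forall Lambda : R, (Lstar < Lambda%:E)%E ->
    infinitely_many (ae_eq_on Omega)
      [set u | strong_solution Omega phi H u Lambda].

End sobolev.

(* Main.v *)
Require Import Defs.
From HB Require Import structures.
From mathcomp Require Import all_boot all_order all_algebra.
From mathcomp Require Import all_classical all_reals all_analysis.
From mathcomp Require Import measurable_realfun ess_sup_inf.
From mathcomp Require Import ring lra.
Set Implicit Arguments. Unset Strict Implicit. Unset Printing Implicit Defensive.
Import Order.TTheory GRing.Theory Num.Theory.
Import numFieldNormedType.Exports.
Local Open Scope classical_set_scope.
Local Open Scope ring_scope.

(** Let b(x, X) be the solution t of h(x, X, t I) = Lambda and write J = (Du)^T; the equation
    becomes J J^T = b(x, u) I, that is, all singular values of J equal sqrt b. Since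
    Lambda > Lambda_*, the datum phi is a strict subsolution: its singular values are < sqrt b,
    uniformly. The defect of a strict subsolution is d = n b(x, u) - |J|^2 > 0.

    On a small box the matrix J is almost constant. Adding tau eta(x) sin(N x.e) f / N, with e
    and f the left and right singular vectors of its least singular value, keeps the field a
    strict subsolution, is uniformly small for large N, and has energy comparable to the integral
    of d^2 over the box. Summing over boxes gives a correction w, smooth and compactly supported,
    as small as desired, with c * int d^2 <= int |Dw|^2.

    In the iteration, integration by parts makes the gradients of very small corrections almost
    orthogonal in L^2 to the gradients of the previous ones. As all gradients are bounded, the
    energies converge, hence the gradients converge in L^2 and int d^2 tends to 0. In the limit
    d = 0 while no singular value exceeds sqrt b, so they all equal sqrt b almost everywhere.

    The total correction is not 0, because phi itself is strict, and is as small as desired: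
    making each correction smaller than half the size of the previous one at a point where that
    one does not vanish yields infinitely many solutions. *)

(** * Singular values through the Frobenius inner product *)

(** The equation prescribes every singular value, a condition that weak limits do not preserve.
    Gradients must therefore converge strongly, so each correction has to carry an energy controlled
    below by the defect that remains. The square of d comes from the least singular value m: d <= n
    (b - m^2) <= 2 n sqrt b (sqrt b - m), so a wave of slope tau = (sqrt b - m) / 2 has tau^2 at
    least a multiple of d^2 / (n^2 T), where T bounds b.

    The datum is C^1 only on the pieces. Every correction is compactly supported in their union U,
    an open set of full measure, so neither interfaces nor boundary are touched, and the corrections
    themselves are the fields that witness the zero trace of the limit.

    Since b depends on u, corrections must be small in the sup norm to preserve strictness. This
    also makes the total correction continuous, which turns almost everywhere statements about it
    into pointwise ones. Strictness of the datum rests on two facts: a singular value is at most the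
    Frobenius norm, and t -> h(x, X, t I) is increasing. *)

Section matrix_inner_product.
Context {R : realType}.

(** On row vectors this is the dot product, so vectors and matrices share one calculus. The trace
    form makes the adjoint rule [mdot_mulmx] plain associativity. *)
Definition mdot p q (A B : 'M[R]_(p, q)) : R := \tr (A *m B^T).
Definition fsq p q (A : 'M[R]_(p, q)) : R := mdot A A.

Section general.
Context {p q : nat}.
Implicit Types A B C : 'M[R]_(p, q).

Lemma mdotE A B : mdot A B = \sum_i \sum_j A i j * B i j.
Proof.
apply: eq_bigr => i _; rewrite mxE; apply: eq_bigr => j _.
by rewrite mxE.
Qed.

Lemma mdotC A B : mdot A B = mdot B A.
Proof. by rewrite /mdot -mxtrace_tr trmx_mul trmxK. Qed.

Lemma mdotDl A B C : mdot (A + B) C = mdot A C + mdot B C.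
Proof. by rewrite /mdot mulmxDl mxtraceD. Qed.

Lemma mdotDr A B C : mdot A (B + C) = mdot A B + mdot A C.
Proof. by rewrite mdotC mdotDl !(mdotC A). Qed.

Lemma mdotZl a A B : mdot (a *: A) B = a * mdot A B.
Proof. by rewrite /mdot -scalemxAl mxtraceZ. Qed.

Lemma mdotZr a A B : mdot A (a *: B) = a * mdot A B.
Proof. by rewrite mdotC mdotZl mdotC. Qed.

Lemma mdot0l B : mdot 0 B = 0.
Proof. by rewrite /mdot mul0mx mxtrace0. Qed.

Lemma fsqE A : fsq A = \sum_i \sum_j A i j ^+ 2.
Proof. by rewrite /fsq mdotE; do 2!apply: eq_bigr => ? _. Qed.

Lemma fsq_ge0 A : 0 <= fsq A.
Proof. by rewrite fsqE; do 2!apply: sumr_ge0 => ? _; rewrite sqr_ge0. Qed.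

Lemma frobeniusE A : frobenius A = Num.sqrt (fsq A).
Proof. by rewrite fsqE. Qed.

Lemma entry_fsq_le A i j : A i j ^+ 2 <= fsq A.
Proof.
rewrite fsqE (bigD1 i)//= (bigD1 j)//= -addrA lerDl addr_ge0//.
  by apply: sumr_ge0 => ? _; rewrite sqr_ge0.
by do 2!apply: sumr_ge0 => ? _; rewrite sqr_ge0.
Qed.

Lemma fsq_eq0 A : fsq A = 0 -> A = 0.
Proof.
move=> A0; apply/matrixP => i j; rewrite mxE; apply/eqP.
by rewrite -sqrf_eq0 eq_le sqr_ge0 andbT -A0 entry_fsq_le.
Qed.

Lemma fsq0 : fsq (0 : 'M[R]_(p, q)) = 0.
Proof. exact: mdot0l. Qed.

Lemma fsqD A B : fsq (A + B) = fsq A + 2 * mdot A B + fsq B.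
Proof. by rewrite /fsq mdotDl !mdotDr (mdotC B A); ring. Qed.

Lemma fsqZ a A : fsq (a *: A) = a ^+ 2 * fsq A.
Proof. by rewrite /fsq mdotZl mdotZr mulrA expr2. Qed.

(** Expand the squared norm of s A - B and divide by s. *)
Lemma mdot_young s A B : 0 < s -> 2 * mdot A B <= s * fsq A + s^-1 * fsq B.
Proof.
move=> s0; have := fsq_ge0 (s *: A + (-1) *: B).
rewrite fsqD !fsqZ mdotZl mdotZr => h.
have {}h : 0 <= s^-1 * (s ^+ 2 * fsq A + 2 * (s * (-1 * mdot A B)) + (-1) ^+ 2 * fsq B).
  by rewrite mulr_ge0// invr_ge0 ltW.
rewrite -subr_ge0; apply: (le_trans h); rewrite le_eqVlt; apply/orP; left.
by apply/eqP; field; rewrite gt_eqF.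
Qed.

(** The weight s stays free so that the coefficient of A can be brought close to 1;
    [opsq_le_perturb] depends on it. *)
Lemma fsqD_le s A B : 0 < s ->
  fsq (A + B) <= (1 + s) * fsq A + (1 + s^-1) * fsq B.
Proof. by move=> s0; rewrite fsqD; have := mdot_young A B s0; lra. Qed.

Lemma fsqD_le2 A B : fsq (A + B) <= 2 * fsq A + 2 * fsq B.
Proof. by have := fsqD_le A B ltr01; rewrite invr1; lra. Qed.

(** Cauchy-Schwarz, from the squared norm of |A|^2 B - <A, B> A divided by |A|^2. *)
Lemma mdot_sqr_le A B : mdot A B ^+ 2 <= fsq A * fsq B.
Proof.
have [A0|A0] := eqVneq (fsq A) 0.
  by rewrite (fsq_eq0 A0) mdot0l fsq0 mul0r expr0n.
have {}A0 : 0 < fsq A by rewrite lt_neqAle eq_sym A0 fsq_ge0.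
have := fsq_ge0 ((- mdot A B) *: A + (fsq A) *: B).
rewrite fsqD !fsqZ mdotZl mdotZr => h.
have : 0 <= fsq A * (fsq A * fsq B - mdot A B ^+ 2) by nra.
by rewrite pmulr_rge0// subr_ge0.
Qed.

(** The library norm [|A|] is the largest absolute value of an entry, whence the dimensional
    factor. *)
Lemma fsq_le_norm A : fsq A <= (p * q)%:R * `|A| ^+ 2.
Proof.
apply: (@le_trans _ _ (\sum_(i < p) \sum_(j < q) `|A| ^+ 2)); last first.
  by rewrite !sumr_const !card_ord -mulrnA mulr_natl mulnC.
rewrite fsqE; apply: ler_sum => i _; apply: ler_sum => j _.
rewrite -real_normK ?num_real// lerXn2r ?nnegrE//.
rewrite [leRHS]/Num.Def.normr/= mx_normrE.
exact: (le_bigmax _ (fun ij => `|A ij.1 ij.2|) (i, j)).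
Qed.

Lemma entry_norm_le A i j : `|A i j| <= `|A|.
Proof.
rewrite [leRHS]/Num.Def.normr/= mx_normrE.
exact: (le_bigmax _ (fun ij => `|A ij.1 ij.2|) (i, j)).
Qed.

Lemma mx_norm_le A c : 0 <= c -> (forall i j, `|A i j| <= c) -> `|A| <= c.
Proof.
move=> c0 h; rewrite [leLHS]/Num.Def.normr/= mx_normrE.
by apply/bigmax_leP; split=> // -[i j] _; exact: h.
Qed.

End general.

Lemma fsq_tr p q (A : 'M[R]_(p, q)) : fsq A^T = fsq A.
Proof. by rewrite /fsq /mdot trmxK mxtrace_mulC. Qed.

Lemma mdot_mulmx n p (v : 'rV[R]_n) (M : 'M[R]_(n, p)) w :
  mdot (v *m M) w = mdot v (w *m M^T).
Proof. by rewrite /mdot trmx_mul trmxK mulmxA. Qed.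

Lemma fsq_row n p (M : 'M[R]_(n, p)) : fsq M = \sum_i fsq (row i M).
Proof.
rewrite fsqE; apply: eq_bigr => i _; rewrite fsqE big_ord1.
by apply: eq_bigr => j _; rewrite mxE.
Qed.

Lemma fsq_delta n (i : 'I_n) : fsq (delta_mx ord0 i : 'rV[R]_n) = 1.
Proof.
rewrite fsqE big_ord1 (bigD1 i)//= mxE !eqxx expr1n big1 ?addr0// => j ji.
by rewrite mxE (negbTE ji) andbF expr0n.
Qed.

Lemma mul_rank1 n p (v e : 'rV[R]_n) (f : 'rV[R]_p) :
  v *m (e^T *m f) = mdot v e *: f.
Proof.
rewrite mulmxA [v *m e^T]mx11_scalar mul_scalar_mx; congr (_ *: _).
by rewrite /mdot /mxtrace big_ord1.
Qed.

Lemma fsq_rank1 n p (e : 'rV[R]_n) (f : 'rV[R]_p) :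
  fsq (e^T *m f) = fsq e * fsq f.
Proof.
rewrite !fsqE !big_ord1 mulr_suml; apply: eq_bigr => i _.
rewrite mulr_sumr; apply: eq_bigr => j _.
by rewrite mxE big_ord1 mxE exprMn.
Qed.

(** Cauchy-Schwarz against each column of M. *)
Lemma fsq_mulmx n p (v : 'rV[R]_n) (M : 'M[R]_(n, p)) :
  fsq (v *m M) <= fsq v * fsq M.
Proof.
rewrite [leLHS]fsqE big_ord1 -(fsq_tr M) (fsq_row M^T) mulr_sumr.
apply: ler_sum => j _; apply: le_trans (mdot_sqr_le _ _).
suff -> : (v *m M) ord0 j = mdot v (row j M^T) by [].
by rewrite mdotE big_ord1 mxE; apply: eq_bigr => k _; rewrite !mxE.
Qed.

End matrix_inner_product.

(** * Bounds on all singular values and conformal matrices *)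

Section operator_norm.
Context {R : realType} {n : nat}.
Implicit Types (M E : 'M[R]_n) (u v e f : 'rV[R]_n) (c : R).

(* The singular values of M are at most sqrt c. *)
Definition opsq_le M c := forall v, fsq (v *m M) <= c * fsq v.

Lemma opsq_le_trans M c c' : c <= c' -> opsq_le M c -> opsq_le M c'.
Proof.
by move=> cc' Mc v; apply: le_trans (Mc v) _; rewrite ler_wpM2r ?fsq_ge0.
Qed.

Lemma opsq_le_fsq M c : fsq M <= c -> opsq_le M c.
Proof.
move=> Mc v; apply: le_trans (fsq_mulmx _ _) _.
by rewrite mulrC ler_wpM2r ?fsq_ge0.
Qed.

Lemma fsq_le_opsq M c : opsq_le M c -> fsq M <= n%:R * c.
Proof.
move=> Mc; rewrite fsq_row mulr_natl -[in leRHS](card_ord n) -sumr_const.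
by apply: ler_sum => i _; rewrite rowE; apply: le_trans (Mc _) _; rewrite fsq_delta mulr1.
Qed.

(** The tolerance k depends on c and c' alone, so one k serves every matrix that occurs over a
    box. *)
Lemma opsq_le_perturb c c' : 0 <= c -> c < c' -> exists2 k : R, 0 < k &
  forall M E, opsq_le M c -> fsq E <= k -> opsq_le (M + E) c'.
Proof.
(* With this s one has s c <= (c' - c) / 2: half of the gap pays for the factor 1 + s in front of M,
   the other half for E. The 1 in c + 1 covers c = 0. *)
move=> c0 cc'; pose s := (c' - c) / (2 * (c + 1)).
have s0 : 0 < s by rewrite /s divr_gt0//; lra.
have s1 : 0 < 1 + s^-1 by rewrite ltr_wpDr// invr_ge0 ltW.
exists ((c' - c) / 2 / (1 + s^-1)); first by rewrite !divr_gt0//; lra.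
move=> M E Mc Ek v; rewrite mulmxDr.
apply: le_trans (fsqD_le _ _ s0) _.
have h1 : (1 + s) * fsq (v *m M) <= (1 + s) * (c * fsq v).
  by rewrite ler_wpM2l//; lra.
have h2 : (1 + s^-1) * fsq (v *m E) <= (c' - c) / 2 * fsq v.
  rewrite -[_ * fsq v]mulrC -ler_pdivlMl// mulrCA.
  apply: le_trans (fsq_mulmx _ _) _; rewrite ler_wpM2l ?fsq_ge0//.
  by rewrite mulrC.
apply: (le_trans (lerD h1 h2)); rewrite mulrA -mulrDl ler_wpM2r ?fsq_ge0//.
suff : s * c <= (c' - c) / 2 by lra.
rewrite /s mulrAC ler_pdivrMr; last by lra.
by nra.
Qed.

(** Each row is the image of a unit vector, so its squared norm is at most c; the sum being n c,
    every row attains the bound. Testing the bound on e_i + s e_j with s = 1 and s = -1 then forces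
    distinct rows to be orthogonal. *)
Lemma conformal_of_opsq_le M c :
  opsq_le M c -> fsq M = n%:R * c -> M *m M^T = c%:M.
Proof.
move=> Mc Mn.
have rowc i : fsq (row i M) = c.
  apply/eqP; rewrite eq_le; apply/andP; split.
    by rewrite rowE; apply: le_trans (Mc _) _; rewrite fsq_delta mulr1.
  rewrite leNgt; apply/negP => ic.
  suff : fsq M < n%:R * c by rewrite Mn ltxx.
  rewrite fsq_row mulr_natl -[in ltRHS](card_ord n) -sumr_const.
  rewrite (bigD1 i)//= [ltRHS](bigD1 i)//= ltr_leD// ler_sum// => j _.
  by rewrite rowE; apply: le_trans (Mc _) _; rewrite fsq_delta mulr1.
have rowdot i j : i != j -> mdot (row i M) (row j M) = 0.
  move=> ij.
  have key s : 0 <= - s * mdot (row i M) (row j M).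
    have := Mc (delta_mx ord0 i + s *: delta_mx ord0 j).
    rewrite mulmxDl -scalemxAl -!rowE !fsqD !fsqZ !rowc !fsq_delta !mdotZr.
    have -> : mdot (delta_mx ord0 i : 'rV[R]_n) (delta_mx ord0 j) = 0.
      rewrite mdotE big_ord1 big1// => k _; rewrite !mxE !eqxx/=.
      by case: eqVneq => [->|]; rewrite ?mul0r// (negbTE ij) mulr0.
    by lra.
  by have := key 1; have := key (-1); lra.
apply/matrixP => i j; rewrite !mxE.
have -> : \sum_k M i k * M^T k j = mdot (row i M) (row j M).
  by rewrite mdotE big_ord1; apply: eq_bigr => k _; rewrite !mxE.
have [->|ij] := eqVneq i j; first by rewrite -/(fsq _) rowc mulr1n.
by rewrite rowdot ?mulr0n.
Qed.

(** Split v = s e + w with w orthogonal to e. The rank-one term kills w and sends s e to a multiple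
    of f, while w M is orthogonal to f; the two squared norms therefore add without a cross term. *)
Lemma opsq_le_rank1 M e f m t c c' :
  fsq e = 1 -> fsq f = 1 -> e *m M = m *: f ->
  (forall v, mdot v e = 0 -> mdot (v *m M) f = 0) ->
  (m + t) ^+ 2 <= c' -> c <= c' -> opsq_le M c ->
  opsq_le (M + t *: (e^T *m f)) c'.
Proof.
move=> e1 f1 eM Mf mt cc' Mc v.
pose s := mdot v e; pose w := v - s *: e.
have we : mdot w e = 0.
  by rewrite /w -scaleNr mdotDl mdotZl -/(fsq e) e1 mulr1 subrr.
have vE : v = s *: e + w by rewrite /w addrCA subrr addr0.
have -> : v *m (M + t *: (e^T *m f)) = (s * (m + t)) *: f + w *m M.
  rewrite mulmxDr -scalemxAr mul_rank1 -/s {1}vE mulmxDl -scalemxAl eM.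
  by rewrite !scalerA addrAC -scalerDl; congr (_ *: _ + _); ring.
rewrite fsqD mdotZl [mdot f _]mdotC Mf// !mulr0 addr0 fsqZ f1 mulr1.
have -> : fsq v = s ^+ 2 + fsq w.
  by rewrite vE fsqD fsqZ e1 mdotZl [mdot e w]mdotC we; ring.
rewrite [c' * _]mulrDr; apply: lerD.
  by rewrite exprMn mulrC ler_wpM2r ?sqr_ge0.
exact: opsq_le_trans Mc _.
Qed.

End operator_norm.

Section matrix_limits.
Context {R : realType}.

Lemma cvg_mx {T : Type} (F : set_system T) {FF : Filter F} p q
  (f : T -> 'M[R]_(p, q)) (A : 'M[R]_(p, q)) :
  (forall i j, f x i j @[x --> F] --> A i j) -> f x @[x --> F] --> A.
Proof.
move=> h; apply/cvgrPdist_lt => e e0.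
have e20 : 0 < e / 2 by rewrite divr_gt0.
have H i j : \forall x \near F, `|A i j - f x i j| < e / 2.
  by have /cvgrPdist_lt := h i j; exact.
have {}H : \forall x \near F, forall ij : 'I_p * 'I_q, `|A ij.1 ij.2 - f x ij.1 ij.2| < e / 2.
  by apply: filter_forall => -[i j]; exact: H.
apply: filterS H => x Hx; apply: (@le_lt_trans _ _ (e / 2)); last lra.
by apply: mx_norm_le => [|i j]; [exact: ltW|rewrite !mxE ltW// (Hx (i, j))].
Qed.

Lemma cvg_entry {T : Type} (F : set_system T) {FF : Filter F} p q
  (f : T -> 'M[R]_(p, q)) (A : 'M[R]_(p, q)) i j :
  f x @[x --> F] --> A -> f x i j @[x --> F] --> A i j.
Proof.
move=> fA; have := @coord_continuous _ p q i j A.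
exact: cvg_comp.
Qed.

Lemma cvg_sum {T : Type} (F : set_system T) {FF : Filter F} (I : Type)
  (r : seq I) (f : I -> T -> R) (a : I -> R) :
  (forall i, f i x @[x --> F] --> a i) ->
  (\sum_(i <- r) f i x) @[x --> F] --> \sum_(i <- r) a i.
Proof. by move=> fa; apply: cvg_big => //; exact: add_continuous. Qed.

Lemma cvg_mdot {T : Type} (F : set_system T) {FF : Filter F} p q
  (f g : T -> 'M[R]_(p, q)) (A B : 'M[R]_(p, q)) :
  f x @[x --> F] --> A -> g x @[x --> F] --> B ->
  mdot (f x) (g x) @[x --> F] --> mdot A B.
Proof.
move=> fA gB; rewrite mdotE.
under eq_cvg do rewrite mdotE.
apply: cvg_sum => i; apply: cvg_sum => j.
by apply: cvgM; exact: cvg_entry.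
Qed.

Lemma cvg_mulmx {T : Type} (F : set_system T) {FF : Filter F} p q r
  (f : T -> 'M[R]_(p, q)) (g : T -> 'M[R]_(q, r)) (A : 'M[R]_(p, q)) (B : 'M[R]_(q, r)) :
  f x @[x --> F] --> A -> g x @[x --> F] --> B ->
  f x *m g x @[x --> F] --> A *m B.
Proof.
move=> fA gB; apply: cvg_mx => i j; rewrite mxE.
under eq_cvg do rewrite mxE.
by apply: cvg_sum => k; apply: cvgM; exact: cvg_entry.
Qed.

Lemma cvg_trmx {T : Type} (F : set_system T) {FF : Filter F} p q
  (f : T -> 'M[R]_(p, q)) (A : 'M[R]_(p, q)) :
  f x @[x --> F] --> A -> (f x)^T @[x --> F] --> A^T.
Proof.
move=> fA; apply: cvg_mx => i j; rewrite mxE.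
by under eq_cvg do rewrite mxE; exact: cvg_entry.
Qed.

Lemma continuous_mdotr p q (B : 'M[R]_(p, q)) : continuous (fun A => mdot A B).
Proof. by move=> A; apply: (@cvg_mdot _ (nbhs A) _ p q id (cst B)); [exact: cvg_id|exact: cvg_cst]. Qed.

Lemma continuous_fsq p q : continuous (@fsq R p q).
Proof. by move=> A; apply: (@cvg_mdot _ (nbhs A) _ p q id id); exact: cvg_id. Qed.

End matrix_limits.

Section singular_vector.
Context {R : realType} {n : nat}.

(** The vector e minimises |v M|^2 on the compact unit sphere, and m is the square root of the
    minimum. Minimality to first order says that vectors orthogonal to e have images orthogonal to e
    M. *)
Lemma least_singular_vector (M : 'M[R]_n) : (0 < n)%N ->
  exists (e f : 'rV[R]_n) (m : R), [/\ fsq e = 1 /\ fsq f = 1, 0 <= m,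
    e *m M = m *: f, (forall v, mdot v e = 0 -> mdot (v *m M) f = 0) &
    forall v : 'rV[R]_n, m ^+ 2 * fsq v <= fsq (v *m M)].
Proof.
move=> n0.
pose S := [set v : 'rV[R]_n | fsq v = 1].
have S0 : S !=set0 by exists (delta_mx ord0 (Ordinal n0)); exact: fsq_delta.
have Sc : compact S.
  apply: bounded_closed_compact.
    exists 1; split=> // x x1 v Sv; apply: mx_norm_le => [|i j]; first lra.
    apply: le_trans (ltW x1); rewrite -(@ler_pXn2r _ 2) ?nnegrE// expr1n.
    by rewrite real_normK ?num_real// -Sv entry_fsq_le.
  have -> : S = (fun v => fsq v) @^-1` [set 1] by [].
  apply: closed_comp => [v _|]; first exact: continuous_fsq.
  exact: closed_eq.
have [|e /set_mem Se emin] := @EVT_min_rV R n (fun v => fsq (v *m M)) S S0 Sc.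
  apply: continuous_subspaceT => v.
  have vM : (w *m M) @[w --> v] --> v *m M.
    by apply: (@cvg_mulmx _ _ (nbhs v) _ 1 n n id (cst M)); [exact: cvg_id|exact: cvg_cst].
  exact: (@cvg_mdot _ _ (nbhs v) _ 1 n _ _ _ _ vM vM).
pose m := Num.sqrt (fsq (e *m M)).
have m2 : m ^+ 2 = fsq (e *m M) by rewrite sqr_sqrtr ?fsq_ge0.
have mle (v : 'rV[R]_n) : m ^+ 2 * fsq v <= fsq (v *m M).
  have [v0|v0] := eqVneq (fsq v) 0; first by rewrite v0 mulr0 fsq_ge0.
  have {}v0 : 0 < fsq v by rewrite lt_neqAle eq_sym v0 fsq_ge0.
  have := emin ((Num.sqrt (fsq v))^-1 *: v).
  rewrite -scalemxAl !fsqZ exprVn sqr_sqrtr ?fsq_ge0// -m2 => h.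
  rewrite -ler_pdivlMr// mulrC; apply: h; apply/mem_set.
  by rewrite /S /= fsqZ exprVn sqr_sqrtr ?fsq_ge0// mulVf// gt_eqF.
have ortho (v : 'rV[R]_n) : mdot v e = 0 -> mdot (v *m M) (e *m M) = 0.
  move=> ve.
  pose a := mdot (v *m M) (e *m M); pose b := fsq (v *m M) - m ^+ 2 * fsq v.
  have b0 : 0 <= b by rewrite subr_ge0.
  have key s : 0 <= 2 * s * a + s ^+ 2 * b.
    have := mle (e + s *: v).
    rewrite mulmxDl -scalemxAl !fsqD !fsqZ !mdotZr -m2 Se.
    by rewrite [mdot e v]mdotC ve mdotC -/a /b; lra.
  (* The optimal choice would be s = - a / b, but b may vanish; b + 1 still makes the quadratic
     negative unless a = 0. *)
  have := key (- a / (b + 1)) => h.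
  have b1 : 0 < b + 1 by lra.
  have : 0 <= (b + 1) ^+ 2 * (2 * (- a / (b + 1)) * a + (- a / (b + 1)) ^+ 2 * b).
    by rewrite mulr_ge0// sqr_ge0.
  have -> : (b + 1) ^+ 2 * (2 * (- a / (b + 1)) * a + (- a / (b + 1)) ^+ 2 * b)
      = - (a ^+ 2 * (b + 2)).
    by field; rewrite gt_eqF.
  rewrite oppr_ge0 => {}h; apply/eqP; rewrite -/a -sqrf_eq0 eq_le sqr_ge0 andbT.
  by move: h; rewrite pmulr_lle0//; lra.
(* If m = 0, the vector e M cannot be normalised. Then M is singular, and any unit vector in the
   kernel of M^T is orthogonal to every v M, so it can serve as f. *)
have [m0|m0] := eqVneq m 0.
  have eM : e *m M = 0 by apply: fsq_eq0; rewrite -m2 m0 expr0n.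
  have detM : \det M = 0.
    apply/eqP/det0P; exists e => //; apply: contra_eqN Se => /eqP->.
    by rewrite fsq0 eq_sym oner_eq0.
  have /det0P[g g0 gM] : \det M^T == 0 by rewrite det_tr detM.
  have {}g0 : 0 < fsq g.
    by rewrite lt_neqAle fsq_ge0 andbT eq_sym; apply: contra g0 => /eqP/fsq_eq0->.
  exists e, ((Num.sqrt (fsq g))^-1 *: g), m; split=> //.
  - split=> //; rewrite fsqZ exprVn sqr_sqrtr ?fsq_ge0// mulVf// gt_eqF//.
  - exact: sqrtr_ge0.
  - by rewrite eM m0 scale0r.
  - by move=> v _; rewrite mdotZr mdot_mulmx gM mdotC mdot0l mulr0.
exists e, (m^-1 *: (e *m M)), m; split=> //.
- by split=> //; rewrite fsqZ -m2 exprVn mulVf// sqrf_eq0.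
- exact: sqrtr_ge0.
- by rewrite scalerA divff// scale1r.
- by move=> v /ortho h; rewrite mdotZr h mulr0.
Qed.

End singular_vector.

(** * Smooth functions and fields *)

Section smooth_functions.
Context {R : realType} {n : nat}.
Local Notation Rn := 'rV[R]_n.
Implicit Types (f g : Rn -> R).

(** [continuously_derivable] speaks only of partial derivatives; Frechet differentiability is what
    the chain rule and [jacobian] require. *)
Fixpoint smooth (k : nat) f : Prop :=
  match k with
  | 0 => continuous f
  | k'.+1 => (forall x, differentiable f x) /\
             forall i, smooth k' (pderiv i f)
  end.

Lemma smooth_continuous k f : smooth k f -> continuous f.
Proof. by case: k => //= k [df _] x; exact: differentiable_continuous. Qed.

Lemma smoothW k f : smooth k.+1 f -> smooth k f.
Proof.
elim: k f => [f fk|k IH f [df fk]]; first exact: smooth_continuous fk.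
by split=> // i; exact: IH.
Qed.

Lemma smooth_continuously_derivable k f :
  smooth k f -> continuously_derivable k f.
Proof.
elim: k f => // k IH f [df fk]; split=> [x|i].
  exact: differentiable_continuous.
by split=> [x|]; [exact: diff_derivable|exact: IH (fk i)].
Qed.

Lemma pderiv_cst i (c : R) : pderiv i (cst c : Rn -> R) = cst 0.
Proof. by apply/funext => x; rewrite /pderiv derive_cst. Qed.

Lemma smooth_cst k (c : R) : smooth k (cst c : Rn -> R).
Proof.
elim: k c => [|k IH] c; first exact: cst_continuous.
split=> [x|i]; first exact: differentiable_cst.
by rewrite pderiv_cst; exact: IH.
Qed.

Lemma pderivD i f g x : differentiable f x -> differentiable g x ->
  pderiv i (f \+ g) x = pderiv i f x + pderiv i g x.
Proof. by move=> df dg; rewrite /pderiv deriveD//; exact: diff_derivable. Qed.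

Lemma smoothD k f g : smooth k f -> smooth k g -> smooth k (f \+ g).
Proof.
elim: k f g => [f g cf cg x|k IH f g [df fk] [dg gk]].
  by apply: continuousD; [exact: cf|exact: cg].
split=> [x|i]; first exact: differentiableD.
rewrite (_ : pderiv i _ = pderiv i f \+ pderiv i g); first exact: IH (fk i) (gk i).
by apply/funext => x; rewrite pderivD.
Qed.

Lemma pderivM i f g x : differentiable f x -> differentiable g x ->
  pderiv i (f \* g) x = f x * pderiv i g x + g x * pderiv i f x.
Proof. by move=> df dg; rewrite /pderiv deriveM//; exact: diff_derivable. Qed.

Lemma smoothM k f g : smooth k f -> smooth k g -> smooth k (f \* g).
Proof.
elim: k f g => [f g cf cg x|k IH f g fk gk].
  by apply: continuousM; [exact: cf|exact: cg].
have [[df dfk] [dg dgk]] := (fk, gk).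
split=> [x|i]; first exact: differentiableM.
rewrite (_ : pderiv i _ = (f \* pderiv i g) \+ (g \* pderiv i f)).
  by apply: smoothD; apply: IH; [exact: smoothW|exact: dgk|exact: smoothW|exact: dfk].
by apply/funext => x; rewrite pderivM.
Qed.

Lemma smoothZ k c f : smooth k f -> smooth k (fun x => c * f x).
Proof. by move=> fk; apply: (smoothM (smooth_cst k c) fk). Qed.

Lemma smooth_prod k (I : Type) (r : seq I) (F : I -> Rn -> R) :
  (forall i, smooth k (F i)) -> smooth k (fun x => \prod_(i <- r) F i x).
Proof.
move=> Fk; elim: r => [|i r IH].
  by under eq_fun do rewrite big_nil; exact: smooth_cst.
by under eq_fun do rewrite big_cons; exact: smoothM.
Qed.

Lemma smooth_derivable f i x : smooth 1 f -> derivable f x (delta_mx ord0 i).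
Proof. by move=> [df _]; exact: diff_derivable. Qed.

Definition grad f (x : Rn) : Rn := \row_i pderiv i f x.

Lemma near_eq_pderiv i f g (x : Rn) : {near x, f =1 g} -> pderiv i f x = pderiv i g x.
Proof.
by move=> fg; apply: near_eq_derive => //.
Qed.

End smooth_functions.

(** * One-variable building blocks: sine, cosine and exp(-1/t) *)

Section one_variable.
Context {R : realType}.
Implicit Types (g h : R -> R).

Fixpoint smooth1 (k : nat) g : Prop :=
  match k with
  | 0 => continuous g
  | k'.+1 => (forall x, derivable g x 1) /\ smooth1 k' (derive1 g)
  end.

Lemma derivable_continuous g : (forall x, derivable g x 1) -> continuous g.
Proof.
by move=> dg x; apply: differentiable_continuous; apply/derivable1_diffP.
Qed.

Lemma smooth1D k g h : smooth1 k g -> smooth1 k h -> smooth1 k (g \+ h).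
Proof.
elim: k g h => [g h cg ch x|k IH g h [dg gk] [dh hk]].
  by apply: continuousD; [exact: cg|exact: ch].
split=> [x|]; first exact: derivableD.
rewrite (_ : derive1 _ = (derive1 g) \+ (derive1 h)); first exact: IH.
by apply/funext => x; rewrite /= !derive1E deriveD.
Qed.

Lemma smooth1Z k c g : smooth1 k g -> smooth1 k (c \*: g).
Proof.
elim: k g => [g cg x|k IH g [dg gk]].
  by apply: continuousM; [exact: cst_continuous|exact: cg].
split=> [x|]; first exact: derivableZ.
rewrite (_ : derive1 _ = c \*: (derive1 g)); first exact: IH.
by apply/funext => x; rewrite /= !derive1E deriveZ.
Qed.

Lemma smooth1_sin_cos k : smooth1 k (@sin R) /\ smooth1 k (@cos R).
Proof.
elim: k => [|k [IHs IHc]]; first by split; [exact: continuous_sin|exact: continuous_cos].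
split; split=> [x|]; first exact: derivable_sin.
- rewrite (_ : derive1 _ = @cos R)//; apply/funext => x; rewrite derive1E.
  by have [] := is_derive_sin x.
- exact: derivable_cos.
- rewrite (_ : derive1 _ = (-1) \*: @sin R); first exact: smooth1Z.
  by apply/funext => x; rewrite derive1E derive_val/= scaleN1r.
Qed.

(* The derivatives of exp(-1/t) are combinations of the functions [flat m]. *)
Definition flat (m : nat) (t : R) : R :=
  if 0 < t then t^-1 ^+ m * expR (- t^-1) else 0.

(** With s = 1/t, exp s = exp (s / (m+1)) ^ (m+1) >= (s / (m+1)) ^ (m+1), which beats s ^ m by one
    power. This linear bound is what gives differentiability at 0. *)
Lemma flat_le m : exists2 C : R, 0 < C & forall t, `|flat m t| <= C * `|t|.
Proof.
exists (m.+1%:R ^+ m.+1); first by rewrite exprn_gt0.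
move=> t; rewrite /flat; case: ifPn => [t0|_]; last first.
  by rewrite normr0 mulr_ge0// exprn_ge0.
have m0 : (0 : R) < m.+1%:R by [].
rewrite ger0_norm; last by rewrite mulr_ge0 ?expR_ge0// exprn_ge0// invr_ge0 (ltW t0).
rewrite gtr0_norm// expRN ler_pdivrMr ?expR_gt0//.
have h : (t^-1 / m.+1%:R) ^+ m.+1 <= expR t^-1.
  have -> : expR t^-1 = expR (t^-1 / m.+1%:R) ^+ m.+1.
    by rewrite -expRM_natl; congr expR; field; rewrite gt_eqF//= gt_eqF.
  rewrite lerXn2r ?nnegrE ?expR_ge0//; first by rewrite divr_ge0// invr_ge0 ltW.
  by apply: le_trans (expR_ge1Dx _); rewrite lerDr.
apply: (@le_trans _ _ (m.+1%:R ^+ m.+1 * t * (t^-1 / m.+1%:R) ^+ m.+1)); last first.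
  by rewrite ler_wpM2l// mulr_ge0 ?exprn_ge0// ltW.
rewrite le_eqVlt; apply/orP; left; apply/eqP.
rewrite exprMn !exprVn [t ^+ m.+1]exprS; clear h; move: m0.
set M : R := m.+1%:R => m0; field.
by rewrite !expf_neq0 ?gt_eqF.
Qed.

(** Away from 0 this is calculus. At 0 the difference quotient of [flat m] is [flat m.+1], which
    tends to 0 by [flat_le]. *)
Lemma is_derive_flat m (t : R) :
  is_derive t 1 (flat m) (flat m.+2 t - m%:R * flat m.+1 t).
Proof.
have [t0|t0|<-] := ltgtP 0 t.
- have nt : \forall s \near t, s^-1 ^+ m * expR (- s^-1) = flat m s.
    near=> s; rewrite /flat ifT//; near: s.
    exact: lt_nbhsr.
  apply: (near_eq_is_derive nt).
  have t1 : t != 0 by rewrite gt_eqF.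
  have dV : is_derive t 1 (fun s : R => s^-1) (- t ^- 2).
    have := @is_deriveV _ (fun y : R => y) t 1 1 t1 (is_derive_id t 1).
    by rewrite /GRing.scale/= mulr1.
  have dE : is_derive t 1 (fun s : R => expR (- s^-1)) (t ^- 2 * expR (- t^-1)).
    have := @is_derive1_comp _ (@expR R) (fun s => - s^-1) t (expR (- t^-1)) (t ^- 2).
    rewrite mulrC; apply.
    by rewrite -[t ^- 2]opprK; exact: is_deriveN.
  have dP : is_derive t 1 (fun s : R => s^-1 ^+ m) (- (m%:R * t^-1 ^+ m.+1)).
    have := is_deriveX m dV; rewrite (_ : _ ^+ m = fun s : R => s^-1 ^+ m); last first.
      by apply/funext => s; rewrite fctE.
    congr (is_derive _ _ _ _); rewrite /GRing.scale/=; clear nt.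
    by case: m => [|m]; rewrite /= ?mul0r ?oppr0// -exprVn !exprS; ring.
  apply: (is_derive_eq (is_deriveM dP dE)).
  by rewrite /flat t0 /GRing.scale/= -exprVn !exprS; ring.
- have nt : \forall s \near t, cst 0 s = flat m s.
    near=> s; rewrite /flat ifN// -leNgt ltW//; near: s.
    exact: lt_nbhsl.
  apply: (near_eq_is_derive nt).
  rewrite /flat ltNge (ltW t0)/= mulr0 subr0; exact: is_derive_cst.
- rewrite /flat ltxx mulr0 subr0.
  have lim0 : h^-1 *: ((flat m \o shift 0) (h *: (1 : R)) - flat m 0) @[h --> 0^'] --> (0 : R).
    have [C C0 HC] := flat_le m.+1.
    apply/cvgr0Pnorm_lt => e e0.
    have : \forall h \near (0 : R)^', `|h| < e / C.
      apply: cvg_within; apply/nbhs_ballP; exists (e / C) => /=; first exact: divr_gt0.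
      by move=> h; rewrite /ball/= sub0r normrN.
    apply: filterS => h he.
    have -> : h^-1 *: ((flat m \o shift 0) (h *: (1 : R)) - flat m 0) = flat m.+1 h.
      rewrite /= addr0 {2}/flat ltxx subr0 /GRing.scale/= mulr1 /flat.
      by case: ifP => _; rewrite ?mulr0// exprS mulrA.
    by apply: le_lt_trans (HC _) _; rewrite -ltr_pdivlMl// mulrC.
  apply: DeriveDef; first by apply/cvg_ex; exists 0.
  by apply/cvg_lim.
Unshelve. all: by end_near. Qed.

Lemma smooth1_flat k m : smooth1 k (flat m).
Proof.
elim: k m => [|k IH] m.
  by apply: derivable_continuous => x; have [] := is_derive_flat m x.
split=> [x|]; first by have [] := is_derive_flat m x.
rewrite (_ : derive1 _ = flat m.+2 \+ ((- m%:R) \*: flat m.+1)).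
  by apply: smooth1D; rewrite //; exact: smooth1Z.
apply/funext => x; rewrite derive1E (@derive_val _ _ _ _ _ _ _ (is_derive_flat m x)).
by rewrite /= /GRing.scale/= mulNr.
Qed.

Lemma flat_ge0 m t : 0 <= flat m t.
Proof.
rewrite /flat; case: ifP => // t0.
by rewrite mulr_ge0 ?expR_ge0// exprn_ge0// invr_ge0 ltW.
Qed.

Lemma flat0_le1 t : flat 0 t <= 1.
Proof.
rewrite /flat; case: ifP => // t0.
by rewrite mul1r -expR0 ler_expR oppr_le0 invr_ge0 ltW.
Qed.

End one_variable.

Section smooth_composition.
Context {R : realType} {n : nat}.
Local Notation Rn := 'rV[R]_n.

Lemma diff_comp_affine (g : R -> R) (e : Rn) c x :
  derivable g (mdot x e + c) 1 ->
  differentiable (fun y => g (mdot y e + c)) x /\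
  forall v, 'D_v (fun y => g (mdot y e + c)) x = mdot v e * (derive1 g) (mdot x e + c).
Proof.
move=> dg.
pose l (y : Rn) := mdot y e.
have llin : linear l by move=> a u v; rewrite /l mdotDl mdotZl.
pose lM := GRing.isLinear.Build _ _ _ _ _ llin.
pose lL : {linear Rn -> R} := HB.pack l lM.
have lc : continuous lL by exact: continuous_mdotr.
have dl y : differentiable lL y by exact: linear_differentiable.
pose a : Rn -> R := l + cst c.
have da : differentiable a x by exact: differentiableD (dl x) (differentiable_cst c x).
have dav v : 'd a x v = l v.
  by rewrite (diffD (dl x) (differentiable_cst c x)) /= (diff_lin _ lc) diff_cst addr0.
have dg' : differentiable g (a x) by exact/derivable1_diffP.
have dc : differentiable (g \o a) x by exact: differentiable_comp.
split=> [//|v]; transitivity ('D_v (g \o a) x) => //.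
rewrite deriveE// diff_comp//= dav.
by rewrite deriv1E.
Qed.

Lemma smooth_comp_affine k (g : R -> R) (e : Rn) c :
  smooth1 k g -> smooth k (fun y : Rn => g (mdot y e + c)).
Proof.
elim: k g => [g cg x|k IH g [dg gk]].
  apply: (@continuous_comp _ _ _ (fun y => mdot y e + c) g); last exact: cg.
  by apply: continuousD; [exact: continuous_mdotr|exact: cst_continuous].
split=> [x|i]; first by have [] := diff_comp_affine (dg (mdot x e + c)).
rewrite (_ : pderiv i _ = fun y => mdot (delta_mx ord0 i) e * (derive1 g) (mdot y e + c)).
  by apply: smoothZ; exact: IH.
by apply/funext => x; rewrite /pderiv (diff_comp_affine (dg _)).2.
Qed.

Lemma pderiv_comp_affine (g : R -> R) (e : Rn) c i x :
  (forall t, derivable g t 1) ->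
  pderiv i (fun y => g (mdot y e + c)) x = e ord0 i * (derive1 g) (mdot x e + c).
Proof.
move=> dg; rewrite /pderiv (diff_comp_affine (dg _)).2; congr (_ * _).
rewrite mdotE big_ord1 (bigD1 i)//= mxE !eqxx mul1r big1 ?addr0// => j ji.
by rewrite mxE (negbTE ji) andbF mul0r.
Qed.

End smooth_composition.

Section jacobian_matrix.
Context {R : realType} {n : nat}.
Local Notation Rn := 'rV[R]_n.
Implicit Types (u w : Rn -> Rn).

Lemma differentiable_row u x :
  (forall a, differentiable (fun y => u y ord0 a : R) x) -> differentiable u x.
Proof.
move=> du.
have -> : u = \sum_(a < n) (fun y => u y ord0 a *: delta_mx ord0 a).
  apply/funext => y; rewrite fct_sumE; apply/rowP => j.
  rewrite summxE (bigD1 j)//= !mxE !eqxx mulr1 big1 ?addr0// => i ij.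
  by rewrite !mxE [j == i]eq_sym (negbTE ij) andbF mulr0.
by apply: differentiable_sum => a; exact: differentiableZl.
Qed.

Lemma differentiable_entry u x a :
  differentiable u x -> differentiable (fun y => u y ord0 a : R) x.
Proof.
move=> du; apply: (@differentiable_comp _ _ _ _ u (fun v => v ord0 a)) => //.
exact: differentiable_coord.
Qed.

Lemma derive_entry u x (v : Rn) a : differentiable u x ->
  'D_v (fun y => u y ord0 a : R) x = ('D_v u x) ord0 a.
Proof.
move=> du; have dua := differentiable_entry a du.
rewrite !deriveE//.
rewrite (_ : (fun y => u y ord0 a : R) = (fun v : Rn => v ord0 a : R) \o u)//.
rewrite diff_comp//=; last exact: differentiable_coord.
have @f : {linear Rn -> R}.
  by exists (fun N : Rn => N ord0 a); do 2![eexists]; do ?[constructor];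
     rewrite ?mxE// => ? *; rewrite ?mxE//; move=> ?; rewrite !mxE.
rewrite (_ : (fun v0 : Rn => v0 ord0 a) = f) // diff_lin//.
exact: coord_continuous.
Qed.

Lemma jacobianE u x i a : differentiable u x ->
  jacobian u x i a = pderiv i (fun y => u y ord0 a) x.
Proof.
move=> du; rewrite /pderiv derive_entry// deriveEjacobian//.
by rewrite -rowE [RHS]mxE.
Qed.

Local Opaque jacobian.

Lemma jacobian_rank1 (g : Rn -> R) (f : Rn) x : differentiable g x ->
  jacobian (fun y => g y *: f) x = (grad g x)^T *m f.
Proof.
move=> dg; apply/matrixP => i a; rewrite jacobianE; last exact: differentiableZl.
rewrite mxE big_ord1 !mxE.
rewrite (_ : (fun y => (g y *: f) ord0 a) = (fun y => g y) \* cst (f ord0 a)).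
  by rewrite pderivM// pderiv_cst mulr0 add0r mulrC.
by apply/funext => y; rewrite mxE.
Qed.

Lemma jacobianD u w x : differentiable u x -> differentiable w x ->
  jacobian (fun y => u y + w y) x = jacobian u x + jacobian w x.
Proof.
move=> du dw; apply/matrixP => i a.
apply: etrans (jacobianE i a (differentiableD du dw)) _.
have -> : (jacobian u x + jacobian w x) i a =
    pderiv i (fun y => u y ord0 a) x + pderiv i (fun y => w y ord0 a) x.
  by rewrite mxE; congr (_ + _); exact: jacobianE.
rewrite -pderivD; try exact: differentiable_entry.
by congr pderiv; apply/funext => y; rewrite mxE.
Qed.

Lemma jacobian_cst (c : Rn) x : jacobian (cst c : Rn -> Rn) x = 0.
Proof.
apply/matrixP => i a; rewrite jacobianE; last exact: differentiable_cst.
by rewrite mxE /pderiv derive_cst.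
Qed.

End jacobian_matrix.

Section test_fields.
Context {R : realType} {n : nat}.
Local Notation Rn := 'rV[R]_n.
Implicit Types (U : set Rn) (w : Rn -> Rn).

(* Same as [test_field], but with Frechet differentiability at every order. *)
Definition tfield U w : Prop :=
  (forall k a, smooth k (fun x => w x ord0 a)) /\
  exists K, [/\ compact K, K `<=` U & forall x, ~ K x -> w x = 0].

Lemma tfield_test_field U w : tfield U w -> test_field U w.
Proof.
move=> [sw [K [cK KU K0]]] a; split.
  by move=> k; apply: smooth_continuously_derivable.
by exists K; split=> // x /K0 ->; rewrite mxE.
Qed.

Lemma tfield_differentiable U w x : tfield U w -> differentiable w x.
Proof. by move=> [sw _]; apply: differentiable_row => a; have [] := sw 1 a. Qed.

Lemma tfield_continuous U w : tfield U w -> continuous w.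
Proof.
by move=> tw x; apply: differentiable_continuous; exact: tfield_differentiable tw.
Qed.

Lemma tfield_jacobianE U w x i a : tfield U w ->
  jacobian w x i a = pderiv i (fun y => w y ord0 a) x.
Proof. by move=> tw; rewrite jacobianE//; exact: tfield_differentiable tw. Qed.

Lemma tfield_continuous_jacobian U w : tfield U w -> continuous (jacobian w).
Proof.
move=> tw x; apply: (@cvg_mx _ _ (nbhs x)) => i a.
rewrite (_ : (fun y => _) = pderiv i (fun y => w y ord0 a)).
  rewrite (tfield_jacobianE x i a tw).
  have [_ /(_ i) h] := tw.1 1 a; exact: h.
by apply/funext => y; exact: tfield_jacobianE tw.
Qed.

Lemma tfield0 U : tfield U (cst 0).
Proof.
split=> [k a|]; first by under eq_fun do rewrite mxE; exact: smooth_cst.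
by exists set0; split=> //; exact: compact0.
Qed.

Lemma tfieldD U w1 w2 : tfield U w1 -> tfield U w2 ->
  tfield U (fun x => w1 x + w2 x).
Proof.
move=> [s1 [K1 [c1 K1U K10]]] [s2 [K2 [c2 K2U K20]]]; split=> [k a|].
  under eq_fun do rewrite mxE.
  exact: smoothD.
exists (K1 `|` K2); split; first exact: compactU.
  by rewrite subUset.
by move=> x /not_orP[/K10-> /K20->]; rewrite addr0.
Qed.

Lemma tfield_jacobianD U w1 w2 x : tfield U w1 -> tfield U w2 ->
  jacobian (fun y => w1 y + w2 y) x = jacobian w1 x + jacobian w2 x.
Proof.
by move=> t1 t2; apply: jacobianD; [exact: tfield_differentiable t1|exact: tfield_differentiable t2].
Qed.

End test_fields.

(** * Borel sets, boxes and the divergence lemma *)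

Section borel_matrices.
Context {R : realType} {p q : nat}.
Local Notation M := 'M[R]_(p, q).

Lemma open_mx_measurable (U : set M) : open U -> measurable U.
Proof. by move=> oU; apply: sub_sigma_algebra. Qed.

Lemma closed_mx_measurable (F : set M) : closed F -> measurable F.
Proof.
by move=> cF; rewrite -(setCK F); apply: measurableC; apply: open_mx_measurable; exact: closed_openC.
Qed.

Lemma compact_mx_measurable (K : set M) : compact K -> measurable K.
Proof.
by move=> cK; apply: closed_mx_measurable; apply: compact_closed cK; exact: norm_hausdorff.
Qed.

Lemma open_continuous_measurable (D : set M) (f : M -> R) : open D ->
  (forall x, D x -> {for x, continuous f}) -> measurable_fun D f.
Proof.
move=> oD cf; apply: (measurability _ (RGenOpens.measurableE R)) => _ [_ [a [b ->] <-]].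
apply: open_mx_measurable.
have : open (D `&` f @^-1` `]a, b[ : set M).
  rewrite openE => x [Dx fx]; apply: filterI; first exact: open_nbhs_nbhs.
  by apply: (cf x Dx); apply: open_nbhs_nbhs; split=> //; exact: interval_open.
by [].
Qed.

Lemma continuous_mx_measurable (D : set M) (f : M -> R) : measurable D -> continuous f -> measurable_fun D f.
Proof.
move=> mD cf; apply: (measurable_funS measurableT) => //.
by apply: (@open_continuous_measurable setT f openT) => x _; exact: cf.
Qed.

End borel_matrices.

Section bounded_integrable.
Context d {T : measurableType d} {R : realType} (mu : {measure set T -> \bar R}).

Lemma bounded_integrable (D : set T) (f : T -> R) C : measurable D ->
  (mu D < +oo)%E -> measurable_fun D f -> (forall x, D x -> `|f x| <= C) ->
  mu.-integrable D (EFin \o f).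
Proof.
move=> mD Doo mf fC; apply: measurable_bounded_integrable => //.
exists C; split; first exact: num_real.
by move=> r Cr x Dx; apply: le_trans (fC x Dx) (ltW Cr).
Qed.

Lemma bounded_support_integrable (D : set T) (f : T -> R) C : measurable D ->
  (mu D < +oo)%E -> measurable_fun setT f -> (forall x, `|f x| <= C) ->
  (forall x, ~ D x -> f x = 0) -> mu.-integrable setT (EFin \o f).
Proof.
move=> mD Doo mf fC f0.
have -> : EFin \o f = (EFin \o f) \_ D.
  apply/funext => x; rewrite patchE; case: ifPn => // /negP xD.
  by rewrite /= f0// => Dx; apply: xD; exact/mem_set.
apply/(integrable_mkcond _ mD); apply: (@bounded_integrable _ _ C) => //.
exact: measurable_funS mf.
Qed.

End bounded_integrable.

Section boxes.
Context {R : realType} {n : nat}.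
Local Notation Rn := 'rV[R]_n.
Local Notation mu := (lebesgue_row R n).

(* Half-open boxes, so that splitting one gives a partition. *)
Definition box (a b : Rn) : set Rn :=
  [set x | forall i, x ord0 i \in `[a ord0 i, b ord0 i[].

Lemma coord_measurable (A : 'I_n -> set R) : (forall i, measurable (A i)) ->
  measurable [set x : Rn | forall i, A i (x ord0 i)].
Proof.
move=> mA; rewrite (_ : [set _ | _] = \bigcap_(i in [set: 'I_n])
    (fun v : 'rV[R]_n => v ord0 i) @^-1` A i); last first.
  by apply/seteqP; split=> v h i; [move=> _; exact: h|exact: h].
apply: fin_bigcap_measurable => [|i _]; first exact: finite_finset.
rewrite -[X in measurable X]setTI.
by apply: measurable_row_coord => //; exact: mA.
Qed.

Lemma boxE a b :
  box a b = [set x : Rn | forall i, `[a ord0 i, b ord0 i[%classic (x ord0 i)].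
Proof. by apply/seteqP; split=> x h i; have := h i. Qed.

Lemma box_measurable a b : measurable (box a b).
Proof.
rewrite boxE; apply: (@coord_measurable (fun i => `[a ord0 i, b ord0 i[%classic)) => i.
exact: measurable_itv.
Qed.

Lemma box_measure (a b : Rn) : (forall i, a ord0 i <= b ord0 i) ->
  mu (box a b) = (\prod_(i < n) (b ord0 i - a ord0 i))%:E.
Proof.
move=> ab; rewrite boxE (@lebesgue_row_box R n (fun i => `[a ord0 i, b ord0 i[%classic)) => [|i]; last exact: measurable_itv.
rewrite -prodEFin; apply: eq_bigr => i _.
rewrite lebesgue_measure_itv/= lte_fin.
by have := ab i; rewrite le_eqVlt => /orP[/eqP->|->]; rewrite ?ltxx ?subrr ?EFinB.
Qed.

Definition cube (M : R) : set Rn := [set x | forall i, x ord0 i \in `[- M, M]].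

Lemma cubeE M : cube M = [set x : Rn | forall i, `[- M, M]%classic (x ord0 i)].
Proof. by apply/seteqP; split=> x h i; have := h i. Qed.

Lemma cube_measurable M : measurable (cube M).
Proof.
by rewrite cubeE; apply: (@coord_measurable (fun=> `[- M, M]%classic)) => i; exact: measurable_itv.
Qed.

Lemma cube_measure_fin M : (mu (cube M) < +oo)%E.
Proof.
rewrite cubeE (@lebesgue_row_box R n (fun=> `[- M, M]%classic)) => [|i]; last exact: measurable_itv.
rewrite (eq_bigr (fun=> (if - M < M then M - - M else 0)%:E)); last first.
  by move=> i _; rewrite lebesgue_measure_itv/= lte_fin; case: ifP => //.
by rewrite prodEFin ltry.
Qed.

Lemma cube_compact M : compact (cube M).
Proof.
by rewrite cubeE; apply: (@rV_compact R n (fun=> `[- M, M]%classic)) => i; exact: segment_compact.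
Qed.

Lemma norm_le_cube (M : R) (x : Rn) : `|x| <= M -> cube M x.
Proof.
by move=> xM i; rewrite in_itv/= -ler_norml; apply: le_trans (entry_norm_le _ _ _) xM.
Qed.

Lemma bounded_sub_cube (A : set Rn) : bounded_set A -> exists2 M : R, 0 < M & A `<=` cube M.
Proof.
move=> [M [Mr AM]]; exists (`|M| + 1); first by rewrite ltr_wpDl.
by move=> x Ax; apply: norm_le_cube; apply: AM => //; rewrite (le_lt_trans (ler_norm _))// ltrDl.
Qed.

Lemma compact_sub_cube (K : set Rn) : compact K -> exists2 M : R, 0 < M & K `<=` cube M.
Proof. by move=> /compact_bounded; exact: bounded_sub_cube. Qed.

Lemma bounded_measure_fin (A : set Rn) : measurable A -> bounded_set A -> (mu A < +oo)%E.
Proof.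
move=> mA /bounded_sub_cube[M _ AM].
apply: le_lt_trans (cube_measure_fin M).
by apply: le_measure => //; rewrite inE//; exact: cube_measurable.
Qed.

Lemma compact_measure_fin (A : set Rn) : compact A -> (mu A < +oo)%E.
Proof.
by move=> cA; apply: bounded_measure_fin; [exact: compact_mx_measurable|exact: compact_bounded].
Qed.

End boxes.

Section divergence.
Context {R : realType}.

(** A directional derivative sees only the restriction to one line, so it passes freely between a
    function of several variables and its slices. *)
Lemma is_derive_along (V W : normedModType R) (U : normedModType R)
  (f : V -> U) (g : W -> U) x v x' v' d :
  (forall h : R, g (h *: v' + x') = f (h *: v + x)) ->
  is_derive x v f d -> is_derive x' v' g d.
Proof.
move=> gf [df <-].
have g0 : g x' = f x by have := gf 0; rewrite !scale0r !add0r.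
have e : (fun h : R => h^-1 *: ((g \o shift x') (h *: v') - g x')) =
         (fun h : R => h^-1 *: ((f \o shift x) (h *: v) - f x)).
  by apply/funext => h; rewrite /= gf g0.
by split; rewrite /derivable /derive e.
Qed.

(** Fundamental theorem of calculus on an interval whose endpoints lie where F vanishes; [|M| + 1]
    keeps the interval nondegenerate when M is negative. *)
Lemma integral_derive_eq0 (F G : R -> R) (M : R) :
  (forall t : R, is_derive t 1 F (G t)) -> continuous G ->
  (forall t, M < `|t| -> F t = 0 /\ G t = 0) ->
  (\int[lebesgue_measure]_t (G t)%:E = 0)%E.
Proof.
move=> dF cG FG0; pose N := `|M| + 1.
have N0 : 0 < N by rewrite ltr_wpDl.
have MN : M < N by rewrite (le_lt_trans (ler_norm _))// ltrDl.
rewrite (_ : (fun t => (G t)%:E) = (fun t => (G t)%:E) \_ `[- N, N]); last first.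
  apply/funext => t; rewrite patchE; case: ifPn => // /negP tN.
  rewrite (FG0 t _).2//; rewrite ltNge; apply/negP => tM; apply: tN.
  by apply/mem_set; rewrite /= in_itv/= -ler_norml; apply: le_trans tM (ltW MN).
rewrite -integral_mkcond (@continuous_FTC2 _ _ F).
- by rewrite !(FG0 _ _).1 ?subee// ?normrN gtr0_norm.
- by rewrite gtrN.
- by apply: continuous_subspaceT.
- have cF : continuous F.
    by apply: derivable_continuous => x; have [] := dF x.
  split=> [x _||]; first by have [] := dF x.
    by apply: cvg_at_right_filter; exact: cF.
  by apply: cvg_at_left_filter; exact: cF.
- by move=> x _; rewrite derive1E; have [_ ->] := dF x.
Qed.

Lemma row_consDl n t s (v : 'rV[R]_n) :
  row_cons (s *: (1 : R) + t, v) = s *: delta_mx ord0 ord0 + row_cons (t, v).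
Proof.
apply/rowP => i; rewrite [RHS]mxE; have [j ->|->] := unliftP ord0 i.
  by rewrite !row_consS !mxE /= mulr0 add0r.
by rewrite !row_cons0 !mxE.
Qed.

Lemma row_consDr n t s (i : 'I_n) (v : 'rV[R]_n) :
  row_cons (t, s *: delta_mx ord0 i + v) =
  s *: delta_mx ord0 (lift ord0 i) + row_cons (t, v).
Proof.
apply/rowP => k; rewrite [RHS]mxE; have [j ->|->] := unliftP ord0 k.
  by rewrite !row_consS !mxE /= (inj_eq (@lift_inj _ ord0)).
by rewrite !row_cons0 !mxE /= mulr0 add0r.
Qed.

Lemma continuous_row_cons n (t : R) (v : 'rV[R]_n) :
  (forall s, (fun w => row_cons (s, w)) w @[w --> v] --> row_cons (s, v)) /\
  (fun s => row_cons (s, v)) s @[s --> t] --> row_cons (t, v).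
Proof.
split=> [s|]; [apply: (@cvg_mx _ _ (nbhs v))|apply: (@cvg_mx _ _ (nbhs t))] => i k; rewrite (ord1 i); have [j ->|->] := unliftP ord0 k.
- rewrite row_consS; under eq_cvg do rewrite row_consS.
  by apply: coord_continuous.
- by rewrite row_cons0; under eq_cvg do rewrite row_cons0; exact: cvg_cst.
- by rewrite row_consS; under eq_cvg do rewrite row_consS; exact: cvg_cst.
- by rewrite row_cons0; under eq_cvg do rewrite row_cons0; exact: cvg_id.
Qed.

(** [lebesgue_row] in dimension n + 1 is by construction the pushforward of a product measure. This
    change of variables, together with integrability, opens the way to Fubini. *)
Lemma integral_lebesgue_rowS n (f : 'rV[R]_n.+1 -> R) C M :
  continuous f -> (forall x, `|f x| <= C) ->
  (forall (x : 'rV[R]_n.+1) j, M < `|x ord0 j| -> f x = 0) ->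
  ((@lebesgue_measure R) \x (lebesgue_row R n))%E.-integrable setT
    (fun p => (f (row_cons p))%:E) /\
  (\int[lebesgue_row R n.+1]_x (f x)%:E =
  \int[(@lebesgue_measure R) \x (lebesgue_row R n)]_p (f (row_cons p))%:E)%E.
Proof.
move=> cf fC f0.
have mf : measurable_fun setT f by exact: continuous_mx_measurable.
have mr := @measurable_row_cons R n.
have i0 : ((@lebesgue_measure R) \x (lebesgue_row R n))%E.-integrable setT
    (fun p => (f (row_cons p))%:E).
  apply: (@bounded_support_integrable _ _ _ _ (@row_cons R n @^-1` cube M) (f \o @row_cons R n) C).
  - by rewrite -[X in measurable X]setTI; apply: mr => //; exact: cube_measurable.
  - by have := @cube_measure_fin R n.+1 M.
  - exact: (measurableT_comp mf mr).
  - by move=> p; exact: fC.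
  - move=> p; rewrite /= /cube/= => /existsNP[j /negP].
    by rewrite in_itv/= -ler_norml -ltNge => /f0.
split=> //.
pose m' := (measure_function_pushforward__canonical__measure_function_Measure
  ((@lebesgue_measure R) \x (lebesgue_row R n))%E mr).
rewrite (eq_measure_integral m'); last by [].
rewrite (integral_pushforward mr) ?preimage_setT//.
exact/measurable_EFinP.
Qed.

(** Induction on the dimension through Fubini. In the first direction the first variable is
    integrated first, and the one-dimensional case applies; in any other direction the inner
    integral over the remaining variables vanishes by induction. *)
Lemma integral_pderiv_eq0 n (i : 'I_n) (F G : 'rV[R]_n -> R) C M :
  (forall x, is_derive x (delta_mx ord0 i) F (G x)) -> continuous G ->
  (forall x, `|G x| <= C) ->
  (forall (x : 'rV[R]_n) j, M < `|x ord0 j| -> F x = 0 /\ G x = 0) ->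
  (\int[lebesgue_row R n]_x (G x)%:E = 0)%E.
Proof.
elim: n i F G => [[]//|n IH] i F G dF cG GC FG0.
have [Gi ->] := integral_lebesgue_rowS cG GC (fun x j h => (FG0 x j h).2).
have [j ij|i0] := unliftP ord0 i.
  rewrite -integral12_prod_meas1// integral0_eq// => t _.
  apply: (IH j (fun v => F (row_cons (t, v))) (fun v => G (row_cons (t, v)))) => //.
  - move=> v; apply: is_derive_along (dF (row_cons (t, v))) => h.
    by rewrite row_consDr ij.
  - move=> v; apply: (@continuous_comp _ _ _ (fun v => row_cons (t, v)) G); last exact: cG.
    exact: (continuous_row_cons t v).1.
  - by move=> v k kM; apply: (FG0 _ (lift ord0 k)); rewrite row_consS.
rewrite -integral21_prod_meas1// integral0_eq// => v _.
apply: (@integral_derive_eq0 (fun t => F (row_cons (t, v))) (fun t => G (row_cons (t, v))) M).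
- move=> t; apply: is_derive_along (dF (row_cons (t, v))) => h.
  by rewrite row_consDl i0.
- move=> t; apply: (@continuous_comp _ _ _ (fun t => row_cons (t, v)) G); last exact: cG.
  exact: (continuous_row_cons t v).2.
- by move=> t tM; apply: (FG0 _ ord0); rewrite row_cons0.
Qed.

End divergence.

Section compact_support.
Context {R : realType} {n : nat}.
Local Notation Rn := 'rV[R]_n.
Local Notation mu := (lebesgue_row R n).
Implicit Types (f g u : Rn -> R) (K O : set Rn).

Definition supp_in K f := forall x, ~ K x -> f x = 0.

Lemma compact_near_out K x : compact K -> ~ K x -> \forall y \near x, ~ K y.
Proof.
move=> cK Kx; have cl : closed K by exact: compact_closed (@norm_hausdorff _ _) cK.
by apply: open_nbhs_nbhs; split=> //; exact: closed_openC.
Qed.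

(** Off K the product is zero in a whole neighbourhood, so u may be arbitrary outside O. *)
Lemma supp_in_continuousM O K u f : compact K -> K `<=` O ->
  (forall x, O x -> {for x, continuous u}) -> continuous f -> supp_in K f ->
  continuous (fun x => u x * f x).
Proof.
move=> cK KO cu cf f0 x; have [Kx|Kx] := pselect (K x).
  by apply: continuousM; [apply: cu; exact: KO|exact: cf].
rewrite /continuous_at f0// mulr0.
move=> A /nbhs_singleton A0; apply: filterS (compact_near_out cK Kx) => y Ky /=.
by rewrite f0// mulr0.
Qed.

Lemma supp_in_bounded K f : compact K -> continuous f -> supp_in K f ->
  exists2 C, 0 <= C & forall x, `|f x| <= C.
Proof.
move=> cK cf f0.
have /compact_bounded[M [_ HM]] : compact (f @` K).
  by apply: continuous_compact => //; exact: continuous_subspaceT.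
exists (`|M| + 1) => [|x]; first by rewrite addr_ge0.
have [Kx|Kx] := pselect (K x); last by rewrite f0// normr0 addr_ge0.
by apply: HM; [rewrite (le_lt_trans (ler_norm _))// ltrDl|exists x].
Qed.

Lemma supp_in_integrable K f : compact K -> continuous f -> supp_in K f ->
  mu.-integrable setT (EFin \o f).
Proof.
move=> cK cf f0; have [C _ fC] := supp_in_bounded cK cf f0.
apply: (@bounded_support_integrable _ _ _ mu K f C) => //.
- exact: compact_mx_measurable.
- exact: compact_measure_fin.
- exact: continuous_mx_measurable.
Qed.

Lemma supp_in_pderiv K f i : compact K -> supp_in K f -> supp_in K (pderiv i f).
Proof.
move=> cK f0 x Kx; rewrite (@near_eq_pderiv _ _ i f (cst 0)) ?pderiv_cst//.
by apply: filterS (compact_near_out cK Kx) => y /f0 ->.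
Qed.

(** The divergence lemma for u f. All regularity of u is asked on O only, because it is later
    applied to functions that are C^1 on a single open piece. *)
Lemma integral_by_parts O K u f i : compact K -> K `<=` O ->
  (forall x, O x -> {for x, continuous u}) ->
  (forall x, O x -> derivable u x (delta_mx ord0 i)) ->
  (forall x, O x -> {for x, continuous (pderiv i u)}) ->
  continuous f -> (forall x, derivable f x (delta_mx ord0 i)) ->
  continuous (pderiv i f) -> supp_in K f ->
  [/\ mu.-integrable setT (EFin \o (fun x => u x * pderiv i f x)),
      mu.-integrable setT (EFin \o (fun x => pderiv i u x * f x)) &
      \int[mu]_x (u x * pderiv i f x) = - \int[mu]_x (pderiv i u x * f x)].
Proof.
move=> cK KO cu du cdu cf df cdf f0.
have df0 := supp_in_pderiv i cK f0.
have c1 := supp_in_continuousM cK KO cu cdf df0.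
have c2 := supp_in_continuousM cK KO cdu cf f0.
have s1 : supp_in K (fun x => u x * pderiv i f x) by move=> x /df0 ->; rewrite mulr0.
have s2 : supp_in K (fun x => pderiv i u x * f x) by move=> x /f0 ->; rewrite mulr0.
have i1 := supp_in_integrable cK c1 s1.
have i2 := supp_in_integrable cK c2 s2.
split=> //; apply/eqP; rewrite -addr_eq0; apply/eqP.
rewrite -RintegralD//.
pose G x := u x * pderiv i f x + pderiv i u x * f x.
have cG : continuous G by move=> x; exact: cvgD (c1 x) (c2 x).
have s3 : supp_in K G by move=> x Kx; rewrite /G s1// s2// addr0.
have [C _ GC] := supp_in_bounded cK cG s3.
have [M M0 KM] := compact_sub_cube cK.
have out (x : Rn) j : M < `|x ord0 j| -> ~ K x.
  move=> xM Kx; have := KM _ Kx j.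
  by rewrite in_itv/= -ler_norml leNgt xM.
have dF x : is_derive x (delta_mx ord0 i) (fun x => u x * f x) (G x).
  have [Kx|Kx] := pselect (K x).
    have du' := derivableP (du x (KO _ Kx)); have df' := derivableP (df x).
    by apply: (is_derive_eq (is_deriveM du' df')); rewrite /GRing.scale/= [f x * _]mulrC.
  have z : is_derive x (delta_mx ord0 i : Rn) (cst (0 : R)) 0 by exact: is_derive_cst.
  rewrite s3//; apply: near_eq_is_derive z.
  by apply: filterS (compact_near_out cK Kx) => y /f0 ->; rewrite mulr0.
rewrite /Rintegral (@integral_pderiv_eq0 _ _ i (fun x => u x * f x) G C M)//.
by move=> x j /out Kx; rewrite s3// f0// mulr0.
Qed.

Lemma test_function_C1 O f : test_function O f ->
  [/\ continuous f, forall i x, derivable f x (delta_mx ord0 i),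
      forall i, continuous (pderiv i f) &
      exists K, [/\ compact K, K `<=` O & supp_in K f]].
Proof.
move=> [cf [K [cK KO f0]]]; split.
- by have := cf 0%N.
- by move=> i x; have [_ /(_ i)[]] := cf 1%N.
- by move=> i; have [_ /(_ i)[_]] := cf 1%N.
- by exists K; split.
Qed.

Lemma supp_in_Rintegral O K f : K `<=` O -> supp_in K f ->
  \int[mu]_(x in O) f x = \int[mu]_x f x.
Proof.
move=> KO f0; rewrite Rintegral_mkcond; apply: eq_Rintegral => x _.
rewrite patchE; case: ifPn => // /negP Ox; rewrite f0// => /KO h.
by apply: Ox; exact/mem_set.
Qed.

End compact_support.

(** * Countable covers, positivity and compact exhaustion of open sets *)

Section open_sets.
Context {R : realType} {n : nat}.
Local Notation Rn := 'rV[R]_n.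
Local Notation mu := (lebesgue_row R n).

Definition obox (a b : Rn) : set Rn :=
  [set x | forall i, a ord0 i < x ord0 i < b ord0 i].

Definition cbox (a b : Rn) : set Rn :=
  [set x | forall i, a ord0 i <= x ord0 i <= b ord0 i].

Lemma oboxE a b :
  obox a b = [set x : Rn | forall i, `]a ord0 i, b ord0 i[%classic (x ord0 i)].
Proof. by apply/seteqP; split=> x h i; have := h i; rewrite /= in_itv. Qed.

Lemma cboxE a b :
  cbox a b = [set x : Rn | forall i, `[a ord0 i, b ord0 i]%classic (x ord0 i)].
Proof. by apply/seteqP; split=> x h i; have := h i; rewrite /= in_itv. Qed.

Lemma obox_measurable a b : measurable (obox a b).
Proof.
rewrite oboxE; apply: (@coord_measurable R n (fun i => `]a ord0 i, b ord0 i[%classic)) => i.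
exact: measurable_itv.
Qed.

Lemma cbox_compact a b : compact (cbox a b).
Proof.
rewrite cboxE; apply: (@rV_compact R n (fun i => `[a ord0 i, b ord0 i]%classic)) => i.
exact: segment_compact.
Qed.

Lemma obox_cbox a b : obox a b `<=` cbox a b.
Proof. by move=> x xab i; have /andP[/ltW-> /ltW->] := xab i. Qed.

Lemma ball_obox (c : Rn) r : 0 < r -> ball c r = obox (c - const_mx r) (c + const_mx r).
Proof.
move=> r0; apply/seteqP; split=> [x [_ xr] i|x xr].
  have := xr ord0 i; rewrite /ball/= ltr_norml !mxE => h; lra.
split=> // i j; rewrite (ord1 i) /ball/= ltr_norml.
by have := xr j; rewrite !mxE => h; lra.
Qed.

Lemma open_ball_seq (U : set Rn) : open U -> exists B : nat -> set Rn,
  U = \bigcup_m B m /\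
  forall m, B m = set0 \/ exists c r, [/\ 0 < r, B m = ball c r & B m `<=` U].
Proof.
move=> oU; pose T : Type := ('rV[rat]_n * nat)%type.
pose good (qk : T) := ball (map_mx ratr qk.1 : 'rV[R]_n) qk.2.+1%:R^-1 `<=` U.
pose b (qk : T) := ball (map_mx ratr qk.1 : 'rV[R]_n) qk.2.+1%:R^-1.
exists (fun m => if unpickle m is Some qk then
   (if `[< good qk >] then b qk else set0) else set0); split.
  rewrite {1}(row_open_bigcup oU); apply/seteqP; split=> [x [qk gqk bx]|x [m _]].
    by exists (pickle qk) => //; rewrite pickleK; case: asboolP.
  by case: unpickle => // qk; case: asboolP => // gqk bx; exists qk.
move=> m; case: unpickle => [qk|]; last by left.
case: asboolP => [gqk|_]; last by left.
by right; exists (map_mx ratr qk.1), qk.2.+1%:R^-1; split=> //; rewrite invr_gt0.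
Qed.

(** Lindelof argument: every point of U lies in a rational ball on which P holds almost everywhere,
    and there are countably many of these. *)
Lemma ae_open (U : set Rn) (P : Rn -> Prop) : open U ->
  (forall x, U x -> exists2 e : R, 0 < e & \forall y \ae mu, ball x e y -> P y) ->
  \forall y \ae mu, U y -> P y.
Proof.
move=> oU h; pose T : Type := ('rV[rat]_n * nat)%type.
pose b (qk : T) := ball (map_mx ratr qk.1 : 'rV[R]_n) qk.2.+1%:R^-1.
pose good (qk : T) := \forall y \ae mu, b qk y -> P y.
pose bad m : set Rn := if unpickle m is Some qk then
   (if `[< good qk >] then ~` [set y | b qk y -> P y] else set0) else set0.
apply: (@negligibleS _ _ _ _ (\bigcup_m bad m)).
  move=> y /= /not_implyP[Uy nP].
  have [e e0 ae_e] := h y Uy.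
  have : ball y e y by exact: ballxx.
  have ob : open (ball y e) by exact: ball_open.
  rewrite (row_open_bigcup ob) => -[qk /= sub qky].
  exists (pickle (qk : T)) => //; rewrite /bad pickleK; case: asboolP.
    by move=> _ /= /(_ qky).
  case; apply: filterS ae_e => z hz bz; apply: hz; exact: sub.
apply: negligible_bigcup => m; rewrite /bad; case: unpickle => [qk|]; last exact: negligible_set0.
by case: asboolP => // _; exact: negligible_set0.
Qed.

Lemma ball_measure_gt0 (c : Rn) r : 0 < r -> (0 < mu (ball c r))%E.
Proof.
move=> r0; rewrite ball_obox// oboxE.
rewrite (@lebesgue_row_box R n (fun i => `](c - const_mx r) ord0 i, (c + const_mx r) ord0 i[%classic)); last first.
  by move=> i; exact: measurable_itv.
rewrite (eq_bigr (fun=> (2 * r)%:E)); last first.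
  move=> i _; rewrite lebesgue_measure_itv/= !mxE lte_fin ifT; last by lra.
  by rewrite -EFinB; congr EFin; ring.
by rewrite prodEFin lte_fin prodr_gt0// => i _; rewrite mulr_gt0.
Qed.

Lemma open_measure_gt0 (U : set Rn) : open U -> U !=set0 -> (0 < mu U)%E.
Proof.
move=> oU [x Ux]; have /nbhs_ballP[e /= e0 eU] : nbhs x U by exact: open_nbhs_nbhs.
apply: lt_le_trans (ball_measure_gt0 x e0) _; apply: le_measure => //; rewrite inE.
  by apply: open_mx_measurable; exact: ball_open.
exact: open_mx_measurable.
Qed.

Lemma ae_open_exists (U : set Rn) (P : Rn -> Prop) : open U -> U !=set0 ->
  (\forall x \ae mu, U x -> P x) -> exists2 x, U x & P x.
Proof.
move=> oU U0 aeP; apply: contrapT => nP.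
have : mu.-negligible U.
  apply: negligibleS aeP => x Ux /= /(_ Ux) Px.
  by apply: nP; exists x.
move=> /negligibleP; have mU : measurable U by exact: open_mx_measurable.
by move=> /(_ mU) muU; have := open_measure_gt0 oU U0; rewrite muU ltxx.
Qed.

(** [K j] consists of the points whose ball of radius 1 / (j + 1) stays in U. It is closed because
    its complement is the union of the balls of that radius centred outside U. *)
Lemma compact_exhaustion (U : set Rn) : open U -> bounded_set U ->
  exists K : nat -> set Rn, [/\ forall j, compact (K j), forall j, K j `<=` U,
    forall i j, (i <= j)%N -> K i `<=` K j & U = \bigcup_j K j].
Proof.
move=> oU bU; have [M M0 UM] := bounded_sub_cube bU.
pose K j := [set x | ball x (j.+1%:R^-1 : R) `<=` U].
have j0 j : (0 : R) < j.+1%:R^-1 by rewrite invr_gt0.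
have KU j : K j `<=` U by move=> x; apply; exact: ballxx.
exists K; split=> //.
- move=> j; apply: (subclosed_compact _ (@cube_compact R n M)).
    rewrite -[K j]setCK; apply: open_closedC.
    have -> : ~` K j = \bigcup_(y in ~` U) ball y (j.+1%:R^-1 : R).
      apply/seteqP; split=> [x /existsNP[y /not_implyP[xy Uy]]|x [y Uy yx] /= Kx].
        by exists y => //; exact: ball_sym.
      by apply: Uy; apply: Kx; exact: ball_sym.
    by apply: bigcup_open => y _; exact: ball_open.
  by move=> x /KU; exact: UM.
- move=> i j ij x Kx; apply: subset_trans Kx; apply: le_ball.
  by rewrite lef_pV2 ?posrE// ler_nat.
- apply/seteqP; split=> [x Ux|x [j _ /KU]//].
  have /nbhs_ballP[e /= e0 eU] : nbhs x U by exact: open_nbhs_nbhs.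
  have [k _ /= ke] : \forall k \near \oo, k.+1%:R^-1 < e.
    exact: (near_infty_natSinv_lt (PosNum e0)).
  exists k => //; apply: subset_trans eU; apply: le_ball.
  by rewrite ltW// ke/=.
Qed.

(** Continuity of the measure from above along the differences U \ K j, whose intersection is
    empty. *)
Lemma inner_compact (U : set Rn) e : open U -> bounded_set U -> 0 < e ->
  exists K, [/\ compact K, K `<=` U & (mu (U `\` K) < e%:E)%E].
Proof.
move=> oU bU e0; have [K [cK KU ndK UK]] := compact_exhaustion oU bU.
have mU : measurable U by exact: open_mx_measurable.
have mK j : measurable (K j) by exact: compact_mx_measurable.
have /= : (mu \o (fun j => U `\` K j)) x @[x --> \oo] --> mu (\bigcap_j (U `\` K j)).
  apply: nonincreasing_cvg_mu.
  - apply: le_lt_trans (bounded_measure_fin mU bU).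
    by apply: le_measure; rewrite ?inE//; apply: measurableD.
  - by move=> j; apply: measurableD.
  - by apply: bigcap_measurable => // j _; apply: measurableD.
  - by move=> i j ij; apply/subsetPset => x [Ux nK]; split=> // /(ndK _ _ ij).
have -> : \bigcap_j (U `\` K j) = set0.
  apply/seteqP; split=> // x h; have [Ux _] := h 0%N I.
  by move: Ux; rewrite UK => -[j _ Kj]; have [_] := h j I; apply.
rewrite measure0 => h.
have [j _ /(_ j (leqnn j)) hj] : \forall j \near \oo, (mu (U `\` K j) < e%:E)%E.
  by apply: (h [set y | (y < e%:E)%E]); apply: open_nbhs_nbhs; split; [exact: open_ereal_lt_ereal|rewrite /= lte_fin].
by exists (K j).
Qed.

End open_sets.

(** * Cutoffs and the fundamental lemma of the calculus of variations *)

Section cutoff.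
Context {R : realType} {n : nat}.
Local Notation Rn := 'rV[R]_n.

Lemma mdot_delta (x : Rn) i : mdot x (delta_mx ord0 i) = x ord0 i.
Proof.
rewrite mdotE big_ord1 (bigD1 i)//= mxE !eqxx mulr1 big1 ?addr0// => j ji.
by rewrite mxE (negbTE ji) andbF mulr0.
Qed.

(** As k grows this tends to the indicator of the open box while staying between 0 and 1. Writing
    each factor through [mdot] puts it in the form handled by [smooth_comp_affine]. *)
Definition bump (a b : Rn) (k : nat) (x : Rn) : R := \prod_(i < n)
  (flat 0 (mdot x (k.+1%:R *: delta_mx ord0 i) + - (k.+1%:R * a ord0 i)) *
   flat 0 (mdot x (- k.+1%:R *: delta_mx ord0 i) + k.+1%:R * b ord0 i)).

Lemma bumpE a b k x : bump a b k x = \prod_(i < n)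
  (flat 0 (k.+1%:R * (x ord0 i - a ord0 i)) *
   flat 0 (k.+1%:R * (b ord0 i - x ord0 i))).
Proof.
apply: eq_bigr => i _; rewrite !mdotZr !mdot_delta.
by congr (flat 0 _ * flat 0 _); ring.
Qed.

Lemma bump_smooth a b k m : smooth m (bump a b k).
Proof.
apply: smooth_prod => i; apply: smoothM; apply: smooth_comp_affine; exact: smooth1_flat.
Qed.

Lemma bump_ge0 a b k x : 0 <= bump a b k x.
Proof. by apply: prodr_ge0 => i _; rewrite mulr_ge0// flat_ge0. Qed.

Lemma bump_le1 a b k x : bump a b k x <= 1.
Proof.
apply: (@le_trans _ _ (\prod_(i < n) 1)); last by rewrite big1.
by apply: ler_prod => i _; rewrite mulr_ge0 ?flat_ge0//= mulr_ile1 ?flat_ge0 ?flat0_le1.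
Qed.

Lemma bump_out a b k x : ~ obox a b x -> bump a b k x = 0.
Proof.
move=> /existsNP[i /negP]; rewrite negb_and -!leNgt bumpE (bigD1 i)//= => h.
suff -> : flat 0 (k.+1%:R * (x ord0 i - a ord0 i)) *
   flat 0 (k.+1%:R * (b ord0 i - x ord0 i)) = 0 by rewrite mul0r.
by case/orP: h => h; rewrite /flat; [rewrite ifN ?mul0r//|rewrite [X in _ * X]ifN ?mulr0//];
  rewrite -leNgt mulr_ge0_le0// subr_le0.
Qed.

(** The point may lie on the boundary of the box, where the bump does not vanish nearby. It is
    nevertheless a minimum of a nonnegative function along the line, so the derivative there is
    0. *)
Lemma bump_pderiv_out a b k i x : ~ obox a b x -> pderiv i (bump a b k) x = 0.
Proof.
move=> /bump_out b0.
pose g (h : R) := bump a b k (h *: delta_mx ord0 i + x).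
have dg h : derivable g h 1.
  have db := derivableP (@smooth_derivable _ _ _ i (h *: delta_mx ord0 i + x) (@bump_smooth a b k 1)).
  suff : is_derive h 1 g ('D_(delta_mx ord0 i) (bump a b k) (h *: delta_mx ord0 i + x)) by case.
  apply: is_derive_along db => s.
  by rewrite /g scalerDl addrA /= /GRing.scale/= mulr1.
have g0 : is_derive (0 : R) 1 g 0.
  apply: (@derive1_at_min _ g (-1) 1) => //.
  - by rewrite in_itv/=; apply/andP; split; lra.
  - by move=> t _; rewrite /g scale0r add0r b0 bump_ge0.
have : is_derive x (delta_mx ord0 i) (bump a b k) 0.
  apply: (is_derive_along _ g0) => h.
  by rewrite /g addr0 /GRing.scale/= mulr1.
by case.
Qed.

Lemma cvg_flat (t : R) : 0 < t -> flat 0 (k.+1%:R * t) @[k --> \oo] --> (1 : R).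
Proof.
move=> t0.
have -> : (fun k => flat 0 (k.+1%:R * t)) = (fun k => expR (- (harmonic k * t^-1))).
  apply/funext => k; rewrite /flat mulr_gt0// expr0 mul1r invfM//.
rewrite -expR0; apply: continuous_cvg; first exact: continuous_expR.
rewrite -oppr0; apply: cvgN; rewrite -(mul0r t^-1).
by apply: cvgMl; exact: cvg_harmonic.
Qed.

Lemma bump_cvg a b x : obox a b x -> bump a b k x @[k --> \oo] --> (1 : R).
Proof.
move=> ab; under eq_cvg do rewrite bumpE.
suff : (\prod_(i < n) (flat 0 (k.+1%:R * (x ord0 i - a ord0 i)) *
   flat 0 (k.+1%:R * (b ord0 i - x ord0 i)))) @[k --> \oo] --> \prod_(i < n) (1 : R).
  by rewrite big1.
apply: cvg_big => [|i _]; first exact: mul_continuous.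
have /andP[ai bi] := ab i; rewrite -[X in _ --> X](mulr1 (1 : R)).
by apply: cvgM; apply: cvg_flat; rewrite subr_gt0.
Qed.

Lemma bump_test_function (Omega : set Rn) a b k :
  cbox a b `<=` Omega -> test_function Omega (bump a b k).
Proof.
move=> ab; split.
  by move=> m; apply: smooth_continuously_derivable; exact: bump_smooth.
exists (cbox a b); split=> //; first exact: cbox_compact.
by move=> x abx; apply: bump_out => /obox_cbox.
Qed.

End cutoff.

Section dominated.
Context d {T : measurableType d} {R : realType} (mu : {measure set T -> \bar R}).
Implicit Types (D : set T) (f g : T -> R).

Lemma Rdominated_convergence D (f_ : nat -> T -> R) f g : measurable D ->
  (forall k, measurable_fun D (f_ k)) -> measurable_fun D f ->
  (\forall x \ae mu, D x -> f_ k x @[k --> \oo] --> f x) ->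
  mu.-integrable D (EFin \o g) ->
  (forall k x, D x -> `|f_ k x| <= g x) ->
  [/\ mu.-integrable D (EFin \o f),
   \int[mu]_(x in D) `|f_ k x - f x| @[k --> \oo] --> (0 : R) &
   \int[mu]_(x in D) f_ k x @[k --> \oo] --> \int[mu]_(x in D) f x].
Proof.
move=> mD mf_ mf cvf ig fg.
have [|||||] := @dominated_convergence _ _ _ mu D mD (fun k => EFin \o f_ k) (EFin \o f) (EFin \o g).
- by move=> k; exact/measurable_EFinP.
- exact/measurable_EFinP.
- by apply: filterS cvf => x h Dx; apply: cvg_EFin; [exact: nearW|exact: h].
- exact: ig.
- by apply: aeW => x k Dx; rewrite /= lee_fin fg.
move=> intf h1 h2; split=> //.
  exact: fine_cvg h1.
by apply: fine_cvg; rewrite fineK//; exact: integrable_fin_num.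
Qed.

Lemma Rbounded_convergence D (f_ : nat -> T -> R) f C : measurable D ->
  (mu D < +oo)%E ->
  (forall k, measurable_fun D (f_ k)) -> measurable_fun D f ->
  (\forall x \ae mu, D x -> f_ k x @[k --> \oo] --> f x) ->
  (forall k x, D x -> `|f_ k x| <= C) ->
  [/\ mu.-integrable D (EFin \o f),
   \int[mu]_(x in D) `|f_ k x - f x| @[k --> \oo] --> (0 : R) &
   \int[mu]_(x in D) f_ k x @[k --> \oo] --> \int[mu]_(x in D) f x].
Proof.
move=> mD Doo mf_ mf cvf fC.
apply: (@Rdominated_convergence D f_ f (cst C)) => //.
by apply: (@bounded_integrable _ _ _ _ _ _ `|C|) => //; exact: measurable_cst.
Qed.

End dominated.

Section fundamental_lemma.
Context {R : realType} {n : nat}.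
Local Notation Rn := 'rV[R]_n.
Local Notation mu := (lebesgue_row R n).

Let boxes : set (set Rn) := [set obox p.1 p.2 | p in [set: Rn * Rn]].

Lemma measurable_generated_by_boxes :
  (@measurable _ Rn : set (set Rn)) = <<s boxes >>.
Proof.
apply/seteqP; split.
  apply: smallest_sub; first exact: smallest_sigma_algebra.
  move=> U /open_ball_seq[B [-> HB]].
  apply: sigma_algebra_bigcup => m; have [->|[c [r [r0 -> _]]]] := HB m.
    exact: sigma_algebra0.
  apply: sub_sigma_algebra; rewrite ball_obox//.
  by exists (c - const_mx r, c + const_mx r).
apply: smallest_sub; first exact: sigma_algebra_measurable.
by move=> _ [p _ <-]; exact: obox_measurable.
Qed.

Lemma obox_setI (a b c d : Rn) : obox a b `&` obox c d =
  obox (\row_i Num.max (a ord0 i) (c ord0 i)) (\row_i Num.min (b ord0 i) (d ord0 i)).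
Proof.
apply/seteqP; split=> [x [h1 h2] i|x h].
  by rewrite !mxE gt_max lt_min; have /andP[-> ->] := h1 i; have /andP[-> ->] := h2 i.
by split=> i; have := h i; rewrite !mxE gt_max lt_min => /andP[/andP[h1 h2] /andP[h3 h4]]; apply/andP.
Qed.

Variables (Omega : set Rn) (Omega_open : open Omega) (G : Rn -> R).
Hypothesis G_loc : loc_integrable Omega G.
Hypothesis G_test : forall f, test_function Omega f -> \int[mu]_(x in Omega) (G x * f x) = 0.

(** Test with the bumps of the box and let them increase to its indicator; |G| dominates on the
    compact closed box. *)
Lemma integral_obox_eq0 a b : cbox a b `<=` Omega ->
  (\int[mu]_(x in obox a b) (G x)%:E = 0)%E.
Proof.
move=> abO; have cab : compact (cbox a b) by exact: cbox_compact.
have mab := compact_mx_measurable cab.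
have iG := G_loc cab abO.
have mG : measurable_fun (cbox a b) G by have /integrableP[/measurable_EFinP] := iG.
have bump0 k : \int[mu]_(x in cbox a b) (G x * bump a b k x) = 0.
  rewrite -(G_test (bump_test_function k abO)).
  have s0 : supp_in (cbox a b) (fun x => G x * bump a b k x).
    by move=> x abx; rewrite bump_out ?mulr0// => /obox_cbox.
  by rewrite (supp_in_Rintegral abO s0) -(@supp_in_Rintegral _ _ (cbox a b) _ _ (@subset_refl _ _) s0).
have [|||||_ _ h] := @Rdominated_convergence _ _ _ mu (cbox a b) (fun k x => G x * bump a b k x) (G \_ (obox a b)) (fun x => `|G x|) mab.
- move=> k; apply: measurable_funM => //; apply: continuous_mx_measurable => //.
  by apply: (@smooth_continuous _ _ 0); exact: bump_smooth.
- apply/measurable_restrict => //; first exact: obox_measurable.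
  by apply: measurable_funS mG => // x [].
- apply: aeW => x _; rewrite patchE; case: ifPn => [/set_mem abx|/negP nab].
    by rewrite -[X in _ --> X]mulr1; apply: cvgMr; exact: bump_cvg.
  rewrite (_ : (fun k => _) = cst 0); first exact: cvg_cst.
  by apply/funext => k; rewrite bump_out ?mulr0// => h; apply: nab; exact/mem_set.
- by have := integrable_abse iG.
- move=> k x _; rewrite normrM ler_piMr// ger0_norm ?bump_ge0//; exact: bump_le1.
have {}h : \int[mu]_(x in cbox a b) (G \_ (obox a b)) x = 0.
  move: h; rewrite (_ : (fun k => _) = cst 0); last by apply/funext => k; exact: bump0.
  by move=> h; apply: (cvg_unique _ h (@cvg_cst _ _ _ _ _)); exact: norm_hausdorff.
move: h; rewrite -Rintegral_mkcondr setIidr; last exact: obox_cbox.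
rewrite /Rintegral => h; rewrite -[LHS]fineK ?h//.
apply: integrable_fin_num; first exact: obox_measurable.
apply: integrableS iG => //; [exact: obox_measurable|exact: obox_cbox].
Qed.

(** Sets on which the truncated G integrates to 0 form a Dynkin system. It contains the open boxes,
    which are stable under intersection and generate the Borel sets. *)
Lemma integral_sub_obox_eq0 c d A : cbox c d `<=` Omega -> measurable A ->
  mu.-integrable setT (EFin \o (G \_ (obox c d))) /\
  (\int[mu]_(x in A) ((G \_ (obox c d)) x)%:E = 0)%E.
Proof.
move=> cdO mA; have mcd := obox_measurable c d.
have iG : mu.-integrable setT (EFin \o (G \_ (obox c d))).
  rewrite -restrict_EFin; apply/(integrable_mkcond _ mcd).
  apply: integrableS (G_loc (@cbox_compact _ _ c d) cdO) => //; last exact: obox_cbox.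
  by apply: compact_mx_measurable; exact: cbox_compact.
split=> //; pose gB x := ((G \_ (obox c d)) x)%:E.
have P0 : forall A, measurable A -> (\int[mu]_(x in A) gB x = \int[mu]_(x in A `&` obox c d) (G x)%:E)%E.
  by move=> B mB; rewrite integral_mkcondr; apply: eq_integral => x _; rewrite /gB restrict_EFin.
move: mA; rewrite measurable_generated_by_boxes => mA.
apply: (@dynkin_induction _ _ boxes (fun A => (\int[mu]_(x in A) gB x = 0)%E)) mA.
- exact: measurable_generated_by_boxes.
- move=> _ _ [p _ <-] [q _ <-]; rewrite obox_setI.
  by exists (\row_i Num.max (p.1 ord0 i) (q.1 ord0 i), \row_i Num.min (p.2 ord0 i) (q.2 ord0 i)).
- by rewrite P0// setTI integral_obox_eq0.
- move=> _ [[a b] _ <-] /=; rewrite P0; last exact: obox_measurable.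
  rewrite obox_setI integral_obox_eq0//; apply: subset_trans cdO => x h i.
  by have := h i; rewrite !mxE ge_max le_min => /andP[/andP[_ ->] /andP[_ ->]].
- move=> S mS S0.
  have := @integral_setU_EFin _ _ _ mu S (~` S) (G \_ (obox c d)) mS (measurableC mS).
  rewrite setUv => h.
  have := P0 _ measurableT; rewrite setTI integral_obox_eq0// h.
  + by rewrite -/gB S0 add0e.
  + by have /integrableP[/measurable_EFinP] := iG.
  + by apply/disj_setPS => x [].
- move=> F mF tF F0; rewrite integral_bigcup//.
    by rewrite eseries0// => i _ _; exact: F0.
  by apply: integrableS iG => //; exact: bigcup_measurable.
Qed.

Lemma fundamental_lemma : \forall x \ae mu, Omega x -> G x = 0.
Proof.
apply: ae_open => // x Ox.
have /nbhs_ballP[e /= e0 eO] : nbhs x Omega by exact: open_nbhs_nbhs.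
have e20 : 0 < e / 2 by rewrite divr_gt0.
exists (e / 2) => //; rewrite ball_obox//.
set c := x - _; set d := x + _.
have cdO : cbox c d `<=` Omega.
  move=> y h; apply: eO; split=> // i j; rewrite (ord1 i) /ball/= ltr_norml.
  by have := h j; rewrite !mxE => hj; lra.
have [iG _] := integral_sub_obox_eq0 cdO measurable0.
have : ae_eq mu setT (EFin \o (G \_ (obox c d))) (cst 0%E).
  apply: integral_ae_eq => // E _ mE.
  by rewrite integral_cst// mul0e; have [_] := integral_sub_obox_eq0 cdO mE.
apply: filterS => y /(_ I) /= [] + cdy.
by rewrite patchE ifT//; exact/mem_set.
Qed.

End fundamental_lemma.

Section continuous_integrable.
Context {R : realType} {n : nat}.
Local Notation Rn := 'rV[R]_n.
Local Notation mu := (lebesgue_row R n).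

Lemma compact_integrable (K : set Rn) (f : Rn -> R) : compact K -> continuous f ->
  mu.-integrable K (EFin \o f).
Proof.
move=> cK cf.
have /compact_bounded[M [_ HM]] : compact (f @` K).
  by apply: continuous_compact => //; exact: continuous_subspaceT.
have mK := compact_mx_measurable cK.
apply: (@bounded_integrable _ _ _ _ _ _ (`|M| + 1)) => //.
- exact: compact_measure_fin.
- exact: continuous_mx_measurable.
- by move=> x Kx; apply: HM; [rewrite (le_lt_trans (ler_norm _))// ltrDl|exists x].
Qed.

Lemma box_sub_cbox (a b : Rn) : box a b `<=` cbox a b.
Proof. by move=> x h i; have := h i; rewrite in_itv/= => /andP[-> /ltW->]. Qed.

Lemma box_integrable (a b : Rn) (f : Rn -> R) : continuous f ->
  mu.-integrable (box a b) (EFin \o f).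
Proof.
move=> cf; have cc : compact (cbox a b) by exact: cbox_compact.
apply: integrableS (compact_integrable cc cf).
- exact: compact_mx_measurable.
- exact: box_measurable.
- exact: box_sub_cbox.
Qed.

Lemma box_measure_fin (a b : Rn) : (mu (box a b) < +oo)%E.
Proof.
have cc : compact (cbox a b) by exact: cbox_compact.
apply: le_lt_trans (compact_measure_fin cc).
apply: le_measure; rewrite ?inE; [exact: box_measurable|exact: compact_mx_measurable|exact: box_sub_cbox].
Qed.

Lemma obox_measure (a b : Rn) : (forall i, a ord0 i <= b ord0 i) ->
  mu (obox a b) = mu (box a b).
Proof.
move=> ab; rewrite box_measure// oboxE.
rewrite (@lebesgue_row_box R n (fun i => `]a ord0 i, b ord0 i[%classic)) => [|i]; last exact: measurable_itv.
rewrite -prodEFin; apply: eq_bigr => i _.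
rewrite lebesgue_measure_itv/= lte_fin.
by have := ab i; rewrite le_eqVlt => /orP[/eqP->|->]; rewrite ?ltxx ?subrr ?EFinB.
Qed.

(** The integrals tend to the volume of the box, so some k exceeds half of it. *)
Lemma bump_sqr_integral (a b : Rn) : (forall i, a ord0 i < b ord0 i) ->
  exists k, fine (mu (box a b)) / 2 <= \int[mu]_(x in box a b) bump a b k x ^+ 2.
Proof.
move=> ab; have ab' i : a ord0 i <= b ord0 i by rewrite ltW.
pose V := fine (mu (box a b)).
have V0 : 0 < V.
  rewrite /V box_measure//= prodr_gt0// => i _; by rewrite subr_gt0.
have mb := @box_measurable R n a b.
have mo := @obox_measurable R n a b.
have [||||_ _ h] := @Rbounded_convergence _ _ _ mu (box a b)
  (fun k x => bump a b k x ^+ 2) (\1_(obox a b)) 1 mb (box_measure_fin a b).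
- move=> k; apply: measurable_funX; apply: continuous_mx_measurable => //.
  by apply: (@smooth_continuous _ _ 0); exact: bump_smooth.
- exact: measurable_indic.
- apply: aeW => x _; rewrite indicE; have [xab|xab] := boolP (x \in _).
    rewrite -[X in _ --> X](expr1n R 2); under eq_cvg do rewrite expr2.
    by rewrite expr2; apply: cvgM; apply: bump_cvg; exact: set_mem.
  rewrite (_ : (fun k => _) = cst 0); first exact: cvg_cst.
  apply/funext => k; rewrite bump_out ?expr0n// => h; move/negP: xab; apply.
  exact: mem_set.
- by move=> k x _; rewrite ger0_norm ?sqr_ge0// expr_le1 ?bump_ge0 ?bump_le1.
have e : \int[mu]_(x in box a b) \1_(obox a b) x = V.
  rewrite /Rintegral integral_indic// setIidl; first by congr fine; exact: obox_measure.
  by move=> x xab i; have /andP[/ltW h1 h2] := xab i; rewrite in_itv/= h1 h2.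
rewrite e in h; rewrite -/V.
have : \forall k \near \oo, V / 2 < \int[mu]_(x in box a b) bump a b k x ^+ 2.
  by apply: (cvgr_gt V) => //; lra.
by move=> [k _ /(_ k (leqnn k)) /ltW hk]; exists k.
Qed.

End continuous_integrable.

(** * Rank-one waves cut off to a box *)

Section wave.
Context {R : realType} {n : nat}.
Local Notation Rn := 'rV[R]_n.
Local Opaque jacobian.

(** The phase of a wave. Having both phases at hand replaces any averaging of fast oscillations by
    the identity sin^2 + cos^2 = 1. *)
Definition osc (s : bool) : R -> R := if s then @sin R else @cos R.
Definition dosc (s : bool) : R -> R := if s then @cos R else fun t => - sin t.

Lemma derive1_osc s : derive1 (osc s) = dosc s.
Proof.
apply/funext => x; rewrite derive1E; case: s => /=; first by have [] := is_derive_sin x.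
by have [] := is_derive_cos x.
Qed.

Lemma smooth1_osc s k : smooth1 k (osc s).
Proof. by case: s; have [] := @smooth1_sin_cos R k. Qed.

Lemma osc_le1 s t : `|osc s t| <= 1.
Proof.
by case: s; rewrite ler_norml ?sin_geN1 ?sin_le1 ?cos_geN1 ?cos_le1.
Qed.

Lemma dosc_le1 s t : `|dosc s t| <= 1.
Proof.
case: s; rewrite /= ?normrN; [exact: (osc_le1 false)|exact: (osc_le1 true)].
Qed.

Variables (a b : Rn) (k : nat) (e f : Rn) (tau N : R).

(** Amplitude tau / N at frequency N: the main slope is of size tau whatever N, while values and
    cutoff error are O(1/N). The [+ 0] matches the affine form of [smooth_comp_affine]. *)
Definition wave_amp s (x : Rn) : R :=
  tau / N * (bump a b k x * osc s (mdot x (N *: e) + 0)).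

Definition wave s (x : Rn) : Rn := wave_amp s x *: f.

Lemma wave_amp_smooth s m : smooth m (wave_amp s).
Proof.
apply: smoothZ; apply: smoothM; first exact: bump_smooth.
exact/smooth_comp_affine/smooth1_osc.
Qed.

Lemma wave_amp_out s x : ~ obox a b x -> wave_amp s x = 0.
Proof. by move=> xab; rewrite /wave_amp bump_out// mul0r mulr0. Qed.

Lemma wave_tfield U s : cbox a b `<=` U -> tfield U (wave s).
Proof.
move=> abU; split=> [m i|].
  rewrite (_ : (fun x => _) = fun x => f ord0 i * wave_amp s x).
    by apply: smoothZ; exact: wave_amp_smooth.
  by apply/funext => x; rewrite mxE mulrC.
exists (cbox a b); split=> //; first exact: cbox_compact.
by move=> x xab; rewrite /wave wave_amp_out ?scale0r// => /obox_cbox.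
Qed.

Lemma grad_wave_amp s x : N != 0 -> grad (wave_amp s) x =
  (tau * bump a b k x * dosc s (mdot x (N *: e) + 0)) *: e +
  (tau / N * osc s (mdot x (N *: e) + 0)) *: grad (bump a b k) x.
Proof.
move=> N0; apply/rowP => i; rewrite !mxE.
pose o := fun x : Rn => osc s (mdot x (N *: e) + 0).
have db y : differentiable (bump a b k) y by have [] := @bump_smooth R n a b k 1.
have do_ y : differentiable o y.
  by have [] := @smooth_comp_affine R n 1 (osc s) (N *: e) 0 (smooth1_osc s 1).
rewrite (_ : wave_amp s = (cst (tau / N) : Rn -> R) \* (bump a b k \* o))//.
rewrite pderivM//; last exact: differentiableM.
rewrite pderiv_cst mulr0 addr0 pderivM// pderiv_comp_affine; last first.
  by move=> t; have [] := smooth1_osc s 1.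
rewrite derive1_osc mxE /o; set u := bump a b k x; set d := dosc s _.
have -> : e 0 i = e ord0 i by [].
by rewrite /=; field.
Qed.

Lemma jacobian_wave s x : N != 0 -> jacobian (wave s) x =
  (tau * bump a b k x * dosc s (mdot x (N *: e) + 0)) *: (e^T *m f) +
  (tau / N * osc s (mdot x (N *: e) + 0)) *: ((grad (bump a b k) x)^T *m f).
Proof.
move=> N0; rewrite /wave jacobian_rank1; last by have [] := wave_amp_smooth s 1.
by rewrite grad_wave_amp// linearD !linearZ mulmxDl -!scalemxAl.
Qed.

Lemma wave_out s x : N != 0 -> ~ obox a b x -> wave s x = 0 /\ jacobian (wave s) x = 0.
Proof.
move=> N0 xab; split; first by rewrite /wave wave_amp_out// scale0r.
rewrite jacobian_wave// bump_out// mulr0 mul0r scale0r add0r.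
rewrite (_ : grad _ _ = 0) ?trmx0 ?mul0mx ?scaler0//.
by apply/rowP => i; rewrite !mxE bump_pderiv_out.
Qed.

Lemma wave_amp_le s x : 0 <= tau / N -> `|wave_amp s x| <= tau / N.
Proof.
move=> tN; rewrite normrM ger0_norm// ler_piMr// normrM ger0_norm ?bump_ge0//.
by rewrite mulr_ile1 ?bump_ge0 ?bump_le1 ?osc_le1.
Qed.

Lemma wave_le s x : fsq f = 1 -> 0 <= tau / N -> `|wave s x| <= tau / N.
Proof.
move=> f1 tN; apply: mx_norm_le => // i j; rewrite mxE normrM.
apply: le_trans (wave_amp_le s x tN); rewrite ler_piMr//.
by rewrite -(@expr_le1 _ 2)// real_normK ?num_real// -f1 entry_fsq_le.
Qed.

(** The cross terms of the two phases are opposite and cancel, so the sum of energies is exactly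
    tau^2 u^2 plus a nonnegative cutoff term, with no oscillation left. *)
Lemma wave_jacobian_sum x : N != 0 -> fsq e = 1 -> fsq f = 1 ->
  tau ^+ 2 * bump a b k x ^+ 2 <=
  fsq (jacobian (wave true) x) + fsq (jacobian (wave false) x).
Proof.
move=> N0 e1 f1; rewrite !jacobian_wave//=.
set y := mdot _ _ + 0; set u := bump a b k x.
set E := e^T *m f; set G := _^T *m f.
have E1 : fsq E = 1 by rewrite fsq_rank1 e1 f1 mulr1.
have G0 : 0 <= (tau / N) ^+ 2 * fsq G by rewrite mulr_ge0 ?sqr_ge0 ?fsq_ge0.
have sc : cos y ^+ 2 + sin y ^+ 2 = 1 := cos2Dsin2 y.
rewrite !fsqD !fsqZ !mdotZl !mdotZr E1 /=.
have -> : (tau * u * cos y) ^+ 2 * 1 +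
  2 * (tau * u * cos y * (tau / N * sin y * mdot E G)) +
  (tau / N * sin y) ^+ 2 * fsq G +
  ((tau * u * - sin y) ^+ 2 * 1 +
  2 * (tau * u * - sin y * (tau / N * cos y * mdot E G)) +
  (tau / N * cos y) ^+ 2 * fsq G) =
  (cos y ^+ 2 + sin y ^+ 2) * (tau ^+ 2 * u ^+ 2 + (tau / N) ^+ 2 * fsq G) by ring.
by rewrite sc mul1r lerDl.
Qed.

End wave.

(** * Oscillations that raise the least singular value *)

Section perturbation_constants.
Context {R : realType}.

(** Half of the distance from m to sqrt B keeps m + tau strictly below sqrt B. Negative slopes t are
    harmless because m >= 0 gives |m + t| <= m + tau. *)
Lemma rank1_amplitude (B c m : R) : 0 < B -> 0 <= m -> m ^+ 2 <= c -> c < B ->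
  let tau := (Num.sqrt B - m) / 2 in
  [/\ 0 < tau, (m + tau) ^+ 2 < B & forall t, `|t| <= tau -> (m + t) ^+ 2 <= (m + tau) ^+ 2].
Proof.
move=> B0 m0 mc cB tau; pose r := Num.sqrt B.
have r0 : 0 < r by rewrite sqrtr_gt0.
have r2 : r ^+ 2 = B by rewrite sqr_sqrtr// ltW.
have mr : m < r.
  have : m ^+ 2 < r ^+ 2 by rewrite r2; exact: le_lt_trans cB.
  by nra.
have t0 : 0 < tau by rewrite divr_gt0// subr_gt0.
have mt : m + tau < r by rewrite /tau -/r; lra.
split=> //.
  by rewrite -r2; nra.
by move=> t /ler_normlP[h1 h2]; nra.
Qed.

(** With r = sqrt B, B - m^2 <= 2 r (r - m), hence d^2 <= 4 n^2 (r - m)^2 T. As the right side is (r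
    - m)^2 / 16, the constant 64 would give a weak inequality; 256 makes it strict, so that it
    persists near the point. *)
Lemma defect_amplitude (n : nat) (B T m d : R) : 0 < B -> B <= T -> 0 <= m -> m ^+ 2 < B ->
  0 < d -> d <= n%:R * (B - m ^+ 2) ->
  (256 * n%:R ^+ 2 * T)^-1 * d ^+ 2 < ((Num.sqrt B - m) / 2) ^+ 2 / 4.
Proof.
move=> B0 BT m0 mB d0 dn; pose r := Num.sqrt B; rewrite -/r.
have r0 : 0 < r by rewrite sqrtr_gt0.
have r2 : r ^+ 2 = B by rewrite sqr_sqrtr// ltW.
have mr : m < r by move: mB; rewrite -r2; nra.
have n0 : 0 < n%:R :> R.
  rewrite ltr0n lt0n; apply/negP => /eqP n0; move: dn.
  by rewrite n0 mul0r; lra.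
have T0 : 0 < T by lra.
rewrite mulrC ltr_pdivrMr; last by rewrite !mulr_gt0// exprn_gt0.
have h1 : d <= n%:R * ((r - m) * (2 * r)).
  apply: (le_trans dn); rewrite ler_wpM2l ?ler0n// -r2 subr_sqr ler_wpM2l//; lra.
have h2 : d ^+ 2 <= (n%:R * ((r - m) * (2 * r))) ^+ 2.
  by nra.
have h3 : (n%:R * ((r - m) * (2 * r))) ^+ 2 = 4 * (n%:R ^+ 2 * (r - m) ^+ 2 * B).
  by rewrite -r2; ring.
have h4 : n%:R ^+ 2 * (r - m) ^+ 2 * B <= n%:R ^+ 2 * (r - m) ^+ 2 * T.
  by rewrite ler_wpM2l// mulr_ge0 ?sqr_ge0.
have -> : ((r - m) / 2) ^+ 2 / 4 * (256 * n%:R ^+ 2 * T) = 16 * (n%:R ^+ 2 * (r - m) ^+ 2 * T) by field.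
have d20 : 0 < d ^+ 2 by rewrite exprn_gt0.
move: h4; rewrite h3 in h2; set X := n%:R ^+ 2 * _ * B in h2 *; set Y := _ * T; lra.
Qed.

Lemma add_rebase {V : zmodType} (A B t E : V) : A + (t + E) = (B + t) + ((A - B) + E).
Proof. by rewrite [RHS]addrACA [B + _]addrCA subrr addr0. Qed.

Lemma half_quarter_lt (x y r : R) : 0 < r -> x < r / 2 -> y <= r / 4 -> x + y < r.
Proof. lra. Qed.

Lemma two_quarters_le (x y r : R) : x <= r / 4 -> y <= r / 4 -> 2 * x + 2 * y <= r.
Proof. lra. Qed.

Lemma quarter_of_sum_le (x y t V : R) : t * (V / 2) <= x + y ->
  t / 4 * V <= x \/ t / 4 * V <= y.
Proof. by have [h|h] := leP (t / 4 * V) x => h'; [left|right; lra]. Qed.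

Lemma wave_frequency (tau eps kap C : R) : 0 < tau -> 0 < eps -> 0 < kap -> 0 <= C ->
  exists N : R, [/\ 0 < N, tau / N <= eps & (tau / N) ^+ 2 * C <= kap].
Proof.
move=> t0 e0 k0 C0.
(* q is the desired value of tau / N; the bound q <= 1 turns q^2 C into at most q C, and C + 1
   avoids dividing by 0. *)
pose q := Num.min eps (Num.min 1 (kap / (C + 1))).
have C1 : 0 < C + 1 by lra.
have q0 : 0 < q by rewrite !lt_min e0 ltr01 divr_gt0.
have q1 : q <= 1 by rewrite /q !ge_min lexx !orbT.
have qe : q <= eps by rewrite /q ge_min lexx.
have : q <= kap / (C + 1) by rewrite /q !ge_min lexx !orbT.
rewrite ler_pdivlMr// => qC.
exists (tau / q); rewrite divr_gt0// invf_div mulrCA divff ?mulr1 ?gt_eqF//.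
by split=> //; clearbody q; nra.
Qed.

End perturbation_constants.

Section tfield_support.
Context {R : realType} {n : nat}.
Local Notation Rn := 'rV[R]_n.
Local Opaque jacobian.

Lemma cvg_fsq_sub {T : Type} (F : set_system T) {FF : Filter F} p q
  (f : T -> 'M[R]_(p, q)) (A : 'M[R]_(p, q)) :
  f x @[x --> F] --> A -> fsq (f x - A) @[x --> F] --> (0 : R).
Proof.
move=> fA; rewrite -(@fsq0 R p q) -(subrr A).
have h : f x - A @[x --> F] --> A - A.
  apply: cvg_mx => i j; rewrite !mxE; under eq_cvg do rewrite !mxE.
  by apply: cvgB; [exact: cvg_entry|exact: cvg_cst].
exact: (cvg_mdot h h).
Qed.

Lemma tfield_jacobian_out (U : set Rn) w : tfield U w ->
  exists K, [/\ compact K, K `<=` U & forall x, ~ K x -> w x = 0 /\ jacobian w x = 0].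
Proof.
move=> tw; have [_ [K [cK KU K0]]] := tw; exists K; split=> // x Kx.
split; first exact: K0.
apply/matrixP => i a; rewrite (tfield_jacobianE x i a tw) mxE.
by apply: (supp_in_pderiv i cK) => // y /K0 ->; rewrite mxE.
Qed.

Lemma tfield_fsq_continuous (U : set Rn) w : tfield U w ->
  continuous (fun x => fsq (jacobian w x)).
Proof.
move=> tw x; have h := tfield_continuous_jacobian tw (x := x).
exact: (@cvg_mdot R _ (nbhs x) _ n n _ _ _ _ h h).
Qed.

Lemma jacobian_tfield0 (x : Rn) : jacobian (cst 0 : Rn -> Rn) x = 0.
Proof. exact: jacobian_cst. Qed.

End tfield_support.

Section bump_gradient.
Context {R : realType} {n : nat}.
Local Notation Rn := 'rV[R]_n.

Lemma grad_bump_continuous (a b : Rn) k : continuous (grad (bump a b k)).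
Proof.
move=> x; apply: (@cvg_mx _ _ (nbhs x)) => i j.
rewrite (_ : (fun y => _) = pderiv j (bump a b k)); last first.
  by apply/funext => y; rewrite /grad mxE.
rewrite /grad mxE; have [_ /(_ j) h] := @bump_smooth R n a b k 1; exact: h.
Qed.

Lemma bump_grad_bounded (a b : Rn) k :
  exists2 C : R, 0 <= C & forall x, fsq (grad (bump a b k) x) <= C.
Proof.
have cg : continuous (fun x => fsq (grad (bump a b k) x)).
  move=> x; have h := @grad_bump_continuous a b k x.
  exact: (@cvg_mdot R _ (nbhs x) _ 1 n _ _ _ _ h h).
have cc : compact (cbox a b) by exact: cbox_compact.
have s0 : supp_in (cbox a b) (fun x => fsq (grad (bump a b k) x)).
  move=> x xab; rewrite (_ : grad _ _ = 0) ?fsq0//; apply/rowP => i.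
  by rewrite !mxE bump_pderiv_out// => /obox_cbox.
have [C C0 HC] := supp_in_bounded cc cg s0.
by exists C => // x; apply: le_trans (HC x); exact: ler_norm.
Qed.

Lemma wave_slope_le (a b x : Rn) k (tau y : R) s : 0 < tau ->
  `|tau * bump a b k x * dosc s y| <= tau.
Proof.
move=> t0; rewrite 2!normrM (gtr0_norm t0) -mulrA ler_piMr//; first exact: ltW.
by rewrite ger0_norm ?bump_ge0// mulr_ile1 ?bump_ge0 ?bump_le1 ?dosc_le1.
Qed.

Lemma wave_error_le (g f : Rn) (q y C : R) s : fsq f = 1 -> fsq g <= C ->
  fsq ((q * osc s y) *: (g^T *m f)) <= q ^+ 2 * C.
Proof.
move=> f1 gC; rewrite fsqZ fsq_rank1 f1 mulr1 exprMn -mulrA ler_wpM2l ?sqr_ge0//.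
apply: le_trans gC; rewrite ler_piMl ?fsq_ge0// -real_normK ?num_real//.
by rewrite expr_le1 ?osc_le1.
Qed.

End bump_gradient.

Section local_perturbation.
Context {R : realType} {n : nat}.
Local Notation Rn := 'rV[R]_n.
Local Notation mu := (lebesgue_row R n).
Local Opaque jacobian.
Variables (U : set Rn) (J0 : Rn -> 'M[R]_n) (beta : Rn -> Rn -> R).

(* Strict subsolutions: all singular values of the gradient are < sqrt beta. *)
Definition admissible (psi : Rn -> Rn) x :=
  exists2 c, c < beta x (psi x) & opsq_le (J0 x + jacobian psi x) c.

(* Sum over the singular values s of beta - s^2. *)
Definition defect (psi : Rn -> Rn) x :=
  n%:R * beta x (psi x) - fsq (J0 x + jacobian psi x).

Lemma defect_gt0 psi x : (0 < n)%N -> admissible psi x -> 0 < defect psi x.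
Proof.
move=> n0 [c cb Mc]; rewrite subr_gt0; apply: le_lt_trans (fsq_le_opsq Mc) _.
by rewrite ltr_pM2l// ltr0n.
Qed.

Lemma admissible_eq psi w x : w x = 0 -> jacobian w x = 0 ->
  differentiable psi x -> differentiable w x ->
  admissible psi x -> admissible (fun y => psi y + w y) x.
Proof.
move=> w0 jw0 dp dw [c cb Mc]; exists c; first by rewrite w0 addr0.
by rewrite jacobianD// jw0 addr0.
Qed.

Lemma cvg_beta psi x : {for (x, psi x), continuous (fun p : Rn * Rn => beta p.1 p.2)} ->
  {for x, continuous psi} -> beta y (psi y) @[y --> x] --> beta x (psi x).
Proof.
move=> cb cp.
apply: (@cvg_comp _ _ _ (fun y => (y, psi y)) (fun p : Rn * Rn => beta p.1 p.2) _ _ _ _ cb).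
exact: (cvg_pair (@cvg_id _ (nbhs x)) cp).
Qed.

Lemma defect_continuous psi x : {for x, continuous J0} ->
  {for (x, psi x), continuous (fun p : Rn * Rn => beta p.1 p.2)} ->
  tfield U psi -> {for x, continuous (defect psi)}.
Proof.
move=> cJ cb tp.
have cp : {for x, continuous psi} by exact: tfield_continuous tp x.
have hb : n%:R * beta y (psi y) @[y --> x] --> n%:R * beta x (psi x).
  exact: cvgMr (cvg_beta cb cp).
have h : J0 y + jacobian psi y @[y --> x] --> J0 x + jacobian psi x.
  exact: cvgD cJ (tfield_continuous_jacobian tp (x := x)).
exact: cvgB hb (@cvg_mdot R _ (nbhs x) _ n n _ _ _ _ h h).
Qed.

(* A wave in the direction of a least singular vector raises the least singular value. Of its
   sine and cosine phases, one carries at least half of the sum of the two energies. *)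
Lemma local_gain psi (xb : Rn) (T eps : R) : (0 < n)%N -> open U -> U xb ->
  tfield U psi -> 0 < eps -> {for xb, continuous J0} ->
  {for (xb, psi xb), continuous (fun p : Rn * Rn => beta p.1 p.2)} ->
  0 < beta xb (psi xb) -> beta xb (psi xb) <= T ->
  (forall x, U x -> admissible psi x) ->
  exists delta g : R, 0 < delta /\ forall a b : Rn, (forall i, a ord0 i < b ord0 i) ->
  cbox a b `<=` ball xb delta ->
  (forall x, cbox a b x -> (256 * n%:R ^+ 2 * T)^-1 * defect psi x ^+ 2 <= g) /\
  exists w, [/\ tfield U w,
    forall x, ~ box a b x -> w x = 0 /\ jacobian w x = 0,
    forall x, `|w x| <= eps,
    forall x, U x -> admissible (fun y => psi y + w y) x &
    g * fine (mu (box a b)) <= \int[mu]_(x in box a b) fsq (jacobian w x)].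
Proof.
move=> n0 oU Uxb tp eps0 cJ cb B0 BT adm.
pose M x := J0 x + jacobian psi x; pose B := beta xb (psi xb).
have [c cB Mc] := adm _ Uxb; rewrite -/(M xb) in Mc.
have [e [f [m [[e1 f1] m0 eM Mf mmin]]]] := least_singular_vector (M xb) n0.
have mc : m ^+ 2 <= c.
  by have := le_trans (mmin e) (Mc e); rewrite e1 !mulr1.
have [] := rank1_amplitude B0 m0 mc cB; set tau := _ / 2 => tau0 mtau mt.
(* [c1] bounds the squared singular values of the gradient frozen at [xb] after the wave is added.
   The gap from c1 to [c2] absorbs the variation of the gradient and the cutoff error; the gap from
   c2 to B absorbs the variation of [beta]. *)
pose c1 := Num.max c ((m + tau) ^+ 2).
have c1B : c1 < B by rewrite gt_max cB.
have c10 : 0 <= c1 by rewrite le_max sqr_ge0 orbT.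
pose c2 := (c1 + B) / 2.
have c12 : c1 < c2 by rewrite /c2; lra.
have c2B : c2 < B by rewrite /c2; lra.
have [kap kap0 pert] := @opsq_le_perturb R n c1 c2 c10 c12.
have d0 : 0 < defect psi xb by exact: defect_gt0 (adm _ Uxb).
have dle : defect psi xb <= n%:R * (B - m ^+ 2).
  rewrite /defect -/(M xb) -/B mulrBr lerD2l lerN2 fsq_row.
  rewrite mulr_natl -[in leLHS](card_ord n) -sumr_const.
  by apply: ler_sum => i _; rewrite rowE; apply: le_trans (mmin _); rewrite fsq_delta mulr1.
have gain := defect_amplitude B0 BT m0 (le_lt_trans mc cB) d0 dle.
rewrite -/tau in gain.
have near_d : \forall x \near xb, (256 * n%:R ^+ 2 * T)^-1 * defect psi x ^+ 2 < tau ^+ 2 / 4.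
  have h := defect_continuous cJ cb tp.
  have h2 : (256 * n%:R ^+ 2 * T)^-1 * defect psi x ^+ 2 @[x --> xb] -->
      (256 * n%:R ^+ 2 * T)^-1 * defect psi xb ^+ 2.
    exact: cvgMr (cvgM h h).
  by apply: (cvgr_lt _ h2); exact: gain.
clear gain dle d0 BT; set c0 := (256 * n%:R ^+ 2 * T)^-1 in near_d *.
move: c0 near_d => {T} c0 near_d.
(* The radius r limits both the point and the value of the field: half of it is spent on the
   variation of [psi], a quarter on the wave. *)
have [r r0 near_b] : exists2 r : R, 0 < r & forall x y, ball xb r x -> ball (psi xb) r y -> c2 < beta x y.
  have : nbhs (xb, psi xb) [set p : Rn * Rn | c2 < beta p.1 p.2].
    by apply: (cb [set z | c2 < z]); apply: open_nbhs_nbhs; split=> //; exact: open_gt.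
  move=> /nbhs_ballP[r /= r0 h]; exists r => // x y hx hy.
  by apply: (h (x, y)).
have cM : M x @[x --> xb] --> M xb.
  exact: cvgD cJ (tfield_continuous_jacobian tp (x := xb)).
have r20 : 0 < r / 2 by rewrite divr_gt0.
have near_M : \forall x \near xb, fsq (M x - M xb) < kap / 4.
  have h : fsq (M x - M xb) @[x --> xb] --> (0 : R).
    exact: cvg_fsq_sub cM.
  by apply: (cvgr_lt (0 : R) h); rewrite divr_gt0.
have near_psi : \forall x \near xb, ball (psi xb) (r / 2) (psi x).
  have cp : {for xb, continuous psi} by exact: tfield_continuous tp _.
  by apply: cp; exact: nbhsx_ballx.
have near_U : \forall x \near xb, U x by exact: open_nbhs_nbhs.
have near_r : \forall x \near xb, ball xb r x by exact: nbhsx_ballx.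
have /nbhs_ballP[delta /= delta0 Hd] : nbhs xb [set x | [/\ fsq (M x - M xb) < kap / 4,
    ball (psi xb) (r / 2) (psi x), c0 * defect psi x ^+ 2 < tau ^+ 2 / 4, U x & ball xb r x]].
  near=> x; split; near: x; assumption.
(* [delta] and the gain are fixed before the box is known; only the cutoff and the frequency depend
   on the box. This order permits the compactness argument that makes the radius uniform. *)
exists delta, (tau ^+ 2 / 4); split; first exact: delta0.
move=> a b ab abd.
have abH x : cbox a b x -> [/\ fsq (M x - M xb) < kap / 4,
    ball (psi xb) (r / 2) (psi x), c0 * defect psi x ^+ 2 < tau ^+ 2 / 4, U x & ball xb r x].
  by move=> /abd /Hd.
split; first by move=> x /abH[_ _ /ltW].
have abU : cbox a b `<=` U by move=> x /abH[].
have [k hk] := bump_sqr_integral ab.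
have [C C0 HC] := bump_grad_bounded a b k.
have r40 : 0 < r / 4 by rewrite divr_gt0.
have m0' : 0 < Num.min eps (r / 4) by rewrite lt_min eps0.
have k40 : 0 < kap / 4 by rewrite divr_gt0.
have [N [N0 N1 N2]] := wave_frequency tau0 m0' k40 C0.
have N0' : N != 0 by rewrite gt_eqF.
have tN0 : 0 <= tau / N by rewrite divr_ge0 ?ltW.
pose w s := wave a b k e f tau N s.
have tw s : tfield U (w s) by exact: wave_tfield.
have wle s x : `|w s x| <= Num.min eps (r / 4).
  by apply: le_trans N1; exact: wave_le.
have wout s x : ~ obox a b x -> w s x = 0 /\ jacobian (w s) x = 0 by exact: wave_out.
have wout' s x : ~ box a b x -> w s x = 0 /\ jacobian (w s) x = 0.
  move=> xab; apply: wout => oab; apply: xab => i.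
  by have /andP[/ltW h1 h2] := oab i; rewrite in_itv/= h1.
have wadm s x : U x -> admissible (fun y => psi y + w s y) x.
  move=> Ux; have dpsi : differentiable psi x by exact: tfield_differentiable tp.
  have dw : differentiable (w s) x by exact: tfield_differentiable (tw s).
  have [xab|xab] := pselect (obox a b x); last first.
    by have [w0 jw0] := wout s x xab; apply: admissible_eq => //; exact: adm.
  have [hM hpsi _ _ hr] := abH x (obox_cbox xab).
  exists c2.
    apply: near_b => //.
    rewrite -ball_normE /ball_/= opprD addrA.
    move: hpsi; rewrite -ball_normE /ball_/= => hpsi.
    apply: (le_lt_trans (ler_normB _ _)).
    by have := wle s x; rewrite le_min => /andP[_]; exact: half_quarter_lt.
  rewrite jacobianD// addrA -/(M x) jacobian_wave//.
  set t := tau * _ * _; set E := (_ * _) *: _.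
  (* Regroup as (frozen gradient + wave slope) + (variation of the gradient + cutoff error), the
     form expected by [pert]. *)
  rewrite (add_rebase (M x) (M xb)).
  apply: pert.
    apply: (opsq_le_rank1 e1 f1 eM Mf (c := c)) => //.
      apply: (@le_trans _ _ ((m + tau) ^+ 2)); last by rewrite /c1 le_max lexx orbT.
      by apply: mt; exact: wave_slope_le.
    by rewrite /c1 le_max lexx.
  apply: le_trans (fsqD_le2 _ _) _.
  have hE : fsq E <= kap / 4.
    by apply: le_trans N2; apply: wave_error_le.
  exact: two_quarters_le (ltW hM) hE.
have wint s : mu.-integrable (box a b) (EFin \o (fun x => fsq (jacobian (w s) x))).
  by apply: box_integrable; exact: tfield_fsq_continuous (tw s).
have sum_ge : tau ^+ 2 * (fine (mu (box a b)) / 2) <=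
   \int[mu]_(x in box a b) fsq (jacobian (w true) x) +
   \int[mu]_(x in box a b) fsq (jacobian (w false) x).
  have mb := @box_measurable R n a b.
  have ib : mu.-integrable (box a b) (EFin \o (fun x => bump a b k x ^+ 2)).
    apply: box_integrable => x; rewrite (_ : (fun x => _) = (bump a b k) \* (bump a b k)).
      by apply: (@smooth_continuous _ _ 0); apply: smoothM; exact: bump_smooth.
    by apply/funext => y; rewrite expr2.
  apply: (@le_trans _ _ (tau ^+ 2 * \int[mu]_(x in box a b) bump a b k x ^+ 2)).
    by rewrite ler_wpM2l ?sqr_ge0.
  rewrite -RintegralZl// -RintegralD//; apply: le_Rintegral => //.
  - by have := integrableZl mb (tau ^+ 2) ib.
  - by have := integrableD mb (wint true) (wint false).
  - by move=> x _; exact: wave_jacobian_sum.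
have [s hs] : exists s, tau ^+ 2 / 4 * fine (mu (box a b)) <= \int[mu]_(x in box a b) fsq (jacobian (w s) x).
  by have [h|h] := quarter_of_sum_le sum_ge; [exists true|exists false].
exists (w s); split.
- exact: tw.
- exact: wout'.
- by move=> x; have := wle s x; rewrite le_min => /andP[].
- exact: wadm.
- exact: hs.
Unshelve. all: by end_near. Qed.

End local_perturbation.

(** * Corrections of a strict subsolution *)

Section box_splitting.
Context {R : realType} {n : nat}.
Local Notation Rn := 'rV[R]_n.

Definition upd (v : Rn) (i : 'I_n) (c : R) : Rn :=
  \row_j (if j == i then c else v ord0 j).

Lemma box_split (a b : Rn) i c : a ord0 i <= c -> c <= b ord0 i ->
  box a b = box a (upd b i c) `|` box (upd a i c) b.
Proof.
move=> ac cb; apply/seteqP; split=> [x xab|x].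
  have [xc|xc] := ltP (x ord0 i) c; [left|right] => j; have := xab j; rewrite !in_itv/= mxE;
  by case: eqP => [->|//] /andP[h1 h2]; apply/andP.
case=> h j; have := h j; rewrite !in_itv/= mxE; case: eqP => [->|//] /andP[h1 h2]; apply/andP; split=> //.
- exact: lt_le_trans cb.
- exact: le_trans h1.
Qed.

Lemma box_split_disjoint (a b : Rn) i c :
  [disjoint box a (upd b i c) & box (upd a i c) b].
Proof.
apply/disj_setPS => x [/(_ i) + /(_ i)].
by rewrite !in_itv/= !mxE eqxx => /andP[_ h1] /andP[h2 _]; move: (lt_le_trans h1 h2); rewrite ltxx.
Qed.

End box_splitting.

Section correction.
Context {R : realType} {n : nat}.
Local Notation Rn := 'rV[R]_n.
Local Notation mu := (lebesgue_row R n).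
Local Opaque jacobian.
Variables (U : set Rn) (J0 : Rn -> 'M[R]_n) (beta : Rn -> Rn -> R).
Implicit Types (psi w : Rn -> Rn) (theta : Rn -> R).

(** The target density theta is a parameter: it will be d^2 restricted to a compact set, so that
    boxes away from this set, possibly outside U, need no correction. Vanishing off the half-open
    box keeps corrections of disjoint boxes independent. *)
Definition improvable psi theta (eps c0 : R) (a b : Rn) := exists w,
  [/\ tfield U w,
    forall x, ~ box a b x -> w x = 0 /\ jacobian w x = 0,
    forall x, `|w x| <= eps,
    forall x, U x -> admissible J0 beta (fun y => psi y + w y) x &
    c0 * \int[mu]_(x in box a b) theta x <=
    \int[mu]_(x in box a b) fsq (jacobian w x)].

Lemma admissible_congr psi psi' x : psi x = psi' x ->
  jacobian psi x = jacobian psi' x ->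
  admissible J0 beta psi x -> admissible J0 beta psi' x.
Proof. by move=> e1 e2 [c cb Mc]; exists c; rewrite -?e1 -?e2. Qed.

(** At every point at most one of the two corrections and its Jacobian are nonzero, so admissibility
    is inherited pointwise and the energies add. *)
Lemma improvable_split psi theta eps c0 (a b : Rn) i c :
  tfield U psi -> mu.-integrable setT (EFin \o theta) ->
  a ord0 i <= c -> c <= b ord0 i ->
  improvable psi theta eps c0 a (upd b i c) ->
  improvable psi theta eps c0 (upd a i c) b ->
  improvable psi theta eps c0 a b.
Proof.
move=> tp ith ac cb [w1 [t1 o1 l1 a1 g1]] [w2 [t2 o2 l2 a2 g2]].
have dis x : box a (upd b i c) x -> ~ box (upd a i c) b x.
  move=> x1 x2; have /disj_setPS := @box_split_disjoint R n a b i c.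
  by move=> /(_ x); apply.
have jD x := @tfield_jacobianD _ _ U w1 w2 x t1 t2.
exists (fun x => w1 x + w2 x); split.
- exact: tfieldD.
- rewrite (box_split ac cb) => x /not_orP[x1 x2]; rewrite jD.
  have [-> ->] := o1 x x1; have [-> ->] := o2 x x2.
  by rewrite !addr0.
- move=> x; have [x2|x2] := pselect (box (upd a i c) b x).
    have [|-> _] := o1 x; last by rewrite add0r.
    by move=> x1; exact: dis x2.
  by have [-> _] := o2 x x2; rewrite addr0.
- move=> x Ux; have dpsi : differentiable psi x by exact: tfield_differentiable tp.
  have d1 : differentiable w1 x by exact: tfield_differentiable t1.
  have d2 : differentiable w2 x by exact: tfield_differentiable t2.
  have d12 : differentiable (fun y => w1 y + w2 y) x by exact: differentiableD.
  have e12 : jacobian (fun y => psi y + (w1 y + w2 y)) x =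
      jacobian psi x + (jacobian w1 x + jacobian w2 x).
    exact: etrans (jacobianD dpsi d12) (congr1 _ (jD x)).
  have e1 : jacobian (fun y => psi y + w1 y) x = jacobian psi x + jacobian w1 x.
    exact: jacobianD.
  have e2 : jacobian (fun y => psi y + w2 y) x = jacobian psi x + jacobian w2 x.
    exact: jacobianD.
  have [x2|x2] := pselect (box (upd a i c) b x).
    have [|w0 jw0] := o1 x; first by move=> x1; exact: dis x2.
    apply: (@admissible_congr (fun y => psi y + w2 y) _ x _ _ (a2 x Ux)).
      by rewrite w0 add0r.
    by apply: etrans e2 (etrans _ (esym e12)); congr (_ + _); rewrite jw0 add0r.
  have [w0 jw0] := o2 x x2.
  apply: (@admissible_congr (fun y => psi y + w1 y) _ x _ _ (a1 x Ux)).
    by rewrite w0 addr0.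
  by apply: etrans e1 (etrans _ (esym e12)); congr (_ + _); rewrite jw0 addr0.
have mb := @box_measurable R n.
have cw : continuous (fun x => fsq (jacobian (fun y => w1 y + w2 y) x)).
  exact: tfield_fsq_continuous (tfieldD t1 t2).
have djs := @box_split_disjoint R n a b i c.
rewrite (box_split ac cb) !Rintegral_setU//; last 2 first.
- by rewrite -(box_split ac cb); exact: box_integrable.
- by apply: integrableS ith => //; exact: measurableU.
rewrite mulrDr; apply: lerD.
  apply: (le_trans g1); rewrite le_eqVlt; apply/orP; left; apply/eqP.
  apply: eq_Rintegral => x /set_mem x1; rewrite jD.
  by have [_ ->] := o2 x (dis x x1); rewrite addr0.
apply: (le_trans g2); rewrite le_eqVlt; apply/orP; left; apply/eqP.
apply: eq_Rintegral => x /set_mem x2; rewrite jD.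
have [|_ ->] := o1 x; last by rewrite add0r.
by move=> x1; exact: dis x2.
Qed.

Lemma improvable_trivial psi theta eps c0 a b : tfield U psi -> 0 <= eps ->
  (forall x, U x -> admissible J0 beta psi x) ->
  (forall x, box a b x -> theta x = 0) -> improvable psi theta eps c0 a b.
Proof.
move=> tp eps0 adm th0; exists (cst 0); split.
- exact: tfield0.
- by move=> x _; rewrite jacobian_tfield0.
- by move=> x; rewrite normr0.
- by move=> x /adm; rewrite (_ : (fun y => _) = psi)//; apply/funext => y; rewrite addr0.
- rewrite (@eq_Rintegral _ _ _ _ _ (cst 0)); last by move=> x /set_mem /th0.
  rewrite (@eq_Rintegral _ _ _ _ _ (cst 0) (fun x => fsq (jacobian _ x))); last first.
    by move=> x _; rewrite jacobian_tfield0 fsq0.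
  by rewrite !Rintegral_cst; try exact: box_measurable; rewrite !mul0r mulr0.
Qed.

(** Compactness of the cube turns the local radii into one uniform d. Boxes are then bisected: [k i]
    bounds the halvings that edge i still needs to become shorter than d, and the induction is on
    their sum. *)
Lemma improvable_cube psi theta eps c0 (M : R) : 0 < M -> tfield U psi ->
  mu.-integrable setT (EFin \o theta) ->
  (forall x, exists2 delta : R, 0 < delta &
    forall a b, cbox a b `<=` ball x delta -> improvable psi theta eps c0 a b) ->
  improvable psi theta eps c0 (const_mx (- M)) (const_mx M).
Proof.
move=> M0 tp ith loc.
pose P (d : R) (x : Rn) := forall a b, cbox a b `<=` ball x d -> improvable psi theta eps c0 a b.
have [d d0 Hd] : exists2 d : R, 0 < d & cube M `<=` P d.
  have /compact_near_coveringP nc := @cube_compact R n M.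
  have loc2 (x : Rn) : \forall x' \near x & i \near (0 : R)^'+, P i x'.
    have [dl dl0 H] := loc x.
    have dl2 : 0 < dl / 2 by rewrite divr_gt0.
    near=> x' i => a b abi.
    have il : i <= dl / 2 by near: i; exact: nbhs_right_le.
    apply: H => y /abi yi.
    rewrite (splitr dl); apply: (@ball_triangle _ _ x').
      by near: x'; exact: nbhsx_ballx.
    exact: le_ball il _ yi.
  have : \forall d \near (0 : R)^'+, cube M `<=` P d.
    by apply: nc => x _; exact: loc2.
  move=> nd; near (0 : R)^'+ => d; exists d => //.
  by near: d.
suff H m (k : 'I_n -> nat) (a b : Rn) : (\sum_i k i)%N = m ->
    (forall i, - M <= a ord0 i) -> (forall i, b ord0 i <= M) ->
    (forall i, a ord0 i <= b ord0 i) ->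
    (forall i, b ord0 i - a ord0 i < d * 2 ^+ k i) -> improvable psi theta eps c0 a b.
  have [q Hq] : exists q : nat, 2 * M < d * 2 ^+ q.
    have h0 : 0 <= 2 * M / d by rewrite divr_ge0 ?mulr_ge0 ?(ltW M0) ?(ltW d0).
    exists (Num.bound (2 * M / d)); rewrite -ltr_pdivrMl// mulrC.
    apply: lt_le_trans (archi_boundP h0) _.
    by rewrite -natrX ler_nat ltnW// ltn_expl.
  apply: (@H (\sum_(i < n) q)%N (fun=> q)) => // i; rewrite !mxE ?lexx//; first lra.
  by rewrite opprK (_ : M + M = 2 * M) //; ring.
elim: m k a b => [|m IH] k a b km aM bM ab abk.
  apply: (Hd a) => [i|y yab].
    by rewrite in_itv/= aM (le_trans (ab i) (bM i)).
  rewrite -ball_normE /ball_/=; apply: (@le_lt_trans _ _ (\big[Num.max/0]_i (b ord0 i - a ord0 i))).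
    apply: mx_norm_le; first exact: bigmax_ge_id.
    move=> i j; rewrite (ord1 i) !mxE; apply: le_trans (le_bigmax _ _ j).
    by have /andP[h1 h2] := yab j; rewrite distrC ger0_norm ?subr_ge0// lerD2r.
  apply/bigmax_ltP; split=> // i _; have := abk i.
  by move: km => /eqP; rewrite sum_nat_eq0 => /forallP/(_ i)/eqP ->; rewrite expr0 mulr1.
have [i ki] : exists i, (0 < k i)%N.
  apply: contrapT => nk; move: km; rewrite big1// => i _; apply/eqP; rewrite -leqn0 leqNgt.
  by apply/negP => ki; apply: nk; exists i.
pose k' j := if j == i then (k i).-1 else k j.
have k'm : (\sum_j k' j)%N = m.
  rewrite (bigD1 i)//= {1}/k' eqxx (eq_bigr k); last by move=> j /negbTE ji; rewrite /k' ji.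
  by move: km; rewrite (bigD1 i)//= -{1}(prednK ki) addSn => -[].
pose c := (a ord0 i + b ord0 i) / 2.
have ac : a ord0 i <= c by rewrite /c; have := ab i; lra.
have cb : c <= b ord0 i by rewrite /c; have := ab i; lra.
have half : (b ord0 i - a ord0 i) / 2 < d * 2 ^+ (k i).-1.
  by rewrite ltr_pdivrMr// -mulrA -exprSr prednK.
apply: (@improvable_split _ _ _ _ _ _ i c) => //; apply: (IH k') => // j.
- by rewrite mxE; case: eqP => // _; apply: le_trans cb (bM i).
- by rewrite mxE; case: eqP => [->|].
- rewrite mxE /k'; case: eqP => [->|] //; apply: le_lt_trans half; rewrite /c; lra.
- by rewrite mxE; case: eqP => // _; apply: le_trans (aM i) ac.
- by rewrite mxE; case: eqP => [->|].
- rewrite mxE /k'; case: eqP => [->|] //; apply: le_lt_trans half; rewrite /c; lra.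
Unshelve. all: by end_near. Qed.

End correction.

Section exists_correction.
Context {R : realType} {n : nat}.
Local Notation Rn := 'rV[R]_n.
Local Notation mu := (lebesgue_row R n).
Local Opaque jacobian.
Variables (U : set Rn) (J0 : Rn -> 'M[R]_n) (beta : Rn -> Rn -> R) (T : R).
Hypothesis n_gt0 : (0 < n)%N.
Hypothesis U_open : open U.
Hypothesis U_bounded : bounded_set U.
Hypothesis J0_continuous : forall x, U x -> {for x, continuous J0}.
Hypothesis beta_continuous : forall x y, U x ->
  {for (x, y), continuous (fun p : Rn * Rn => beta p.1 p.2)}.
Hypothesis beta_range : forall x y, U x -> 0 < beta x y <= T.

(** The unknown is the correction alone: the datum enters through [J0] and through the values
    already absorbed in [beta]. *)
Definition subsolution (psi : Rn -> Rn) :=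
  tfield U psi /\ forall x, U x -> admissible J0 beta psi x.

Let mU : measurable U. Proof. exact: open_mx_measurable. Qed.

Lemma open_bounded_measure_fin : (mu U < +oo)%E.
Proof. exact: bounded_measure_fin. Qed.

Lemma subsolution_defect psi : subsolution psi ->
  [/\ measurable_fun U (defect J0 beta psi) &
      forall x, U x -> 0 < defect J0 beta psi x <= n%:R * T].
Proof.
move=> [tp adm]; split.
  apply: open_continuous_measurable => // x Ux.
  apply: (@defect_continuous _ _ U) => //; [exact: J0_continuous|exact: beta_continuous].
move=> x Ux; rewrite defect_gt0//=; last exact: adm.
have /andP[_ bT] := beta_range (psi x) Ux.
rewrite /defect lerBlDr; apply: ler_wpDr; first exact: fsq_ge0.
by rewrite ler_wpM2l.
Qed.

Lemma defect_sqr_integrable psi : subsolution psi ->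
  mu.-integrable U (EFin \o (fun x => defect J0 beta psi x ^+ 2)).
Proof.
move=> sp; have [md dT] := subsolution_defect sp.
apply: (@bounded_integrable _ _ _ _ _ _ ((n%:R * T) ^+ 2)) => //.
- exact: open_bounded_measure_fin.
- exact: measurable_funX.
- move=> x Ux; have /andP[d0 d1] := dT x Ux.
  rewrite ger0_norm ?sqr_ge0// lerXn2r ?nnegrE//; first exact: ltW.
  exact: le_trans (ltW d0) d1.
Qed.

Lemma improvable_near psi K eps x : subsolution psi -> 0 < eps ->
  compact K -> K `<=` U ->
  exists2 delta : R, 0 < delta & forall a b, cbox a b `<=` ball x delta ->
    improvable U J0 beta psi ((fun x => defect J0 beta psi x ^+ 2) \_ K)
      eps (256 * n%:R ^+ 2 * T)^-1 a b.
Proof.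
move=> [tp adm] eps0 cK KU.
set theta := _ \_ K; set c0 := _^-1.
have triv a b : (forall y, box a b y -> ~ K y) -> improvable U J0 beta psi theta eps c0 a b.
  move=> h; apply: improvable_trivial => //; first exact: ltW.
  by move=> y /h Ky; rewrite /theta patchE ifN//; apply/negP => /set_mem.
have [Kx|Kx] := pselect (K x); last first.
  have /nbhs_ballP[d /= d0 Hd] := compact_near_out cK Kx.
  exists d => // a b abd; apply: triv => y /box_sub_cbox /abd; exact: Hd.
have Ux := KU _ Kx; have /andP[b0 bT] := beta_range (psi x) Ux.
have c00 : 0 <= c0.
  by rewrite invr_ge0 !mulr_ge0// ?sqr_ge0//; exact: le_trans (ltW b0) bT.
have [d [g [d0 H]]] := local_gain n_gt0 U_open Ux tp eps0 (@J0_continuous x Ux)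
  (@beta_continuous x (psi x) Ux) b0 bT adm.
exists d => // a b abd.
(* A degenerate half-open box is empty, and the zero correction suffices. *)
have [ab|nab] := pselect (forall i, a ord0 i < b ord0 i); last first.
  apply: triv => y yab; exfalso; apply: nab => i; have := yab i.
  by rewrite in_itv/= => /andP[]; exact: le_lt_trans.
have [dg [w [tw wout weps wadm gain]]] := H a b ab abd.
exists w; split=> //; apply: le_trans gain.
have mb := @box_measurable R n a b.
have thg y : box a b y -> c0 * theta y <= g.
  move=> /box_sub_cbox /dg h; apply: le_trans h; rewrite ler_wpM2l// /theta patchE.
  by case: ifP => // _; exact: sqr_ge0.
have mK := compact_mx_measurable cK.
have sp : subsolution psi by [].
have ith : mu.-integrable (box a b) (EFin \o theta).
  apply: (@integrableS _ _ _ mu setT) => //.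
  rewrite /theta -restrict_EFin; apply/(integrable_mkcond _ mK).
  exact: integrableS (defect_sqr_integrable sp).
rewrite -RintegralZl// -Rintegral_cst//; apply: le_Rintegral => //.
- by have := integrableZl mb c0 ith.
- by apply: (@bounded_integrable _ _ _ _ _ _ `|g|) => //; exact: box_measure_fin.
Qed.

(** The defect is continuous only inside U, so the boxes exploit it on a compact K; since d <= n T,
    the part of the integral over U \ K is small with its measure, and [err] pays for it. *)
Lemma exists_correction psi eps err : subsolution psi -> 0 < eps -> 0 < err ->
  exists w, [/\ tfield U w, forall x, `|w x| <= eps,
    subsolution (fun x => psi x + w x) &
    (256 * n%:R ^+ 2 * T)^-1 * \int[mu]_(x in U) defect J0 beta psi x ^+ 2 <=
    \int[mu]_(x in U) fsq (jacobian w x) + err].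
Proof.
move=> sp eps0 err0; set c0 := (_)^-1.
have [md dT] := subsolution_defect sp.
pose C := (n%:R * T) ^+ 2; pose e1 := err / (`|c0| * C + 1).
have C0 : 0 <= C by exact: sqr_ge0.
have D0 : 0 < `|c0| * C + 1 by rewrite ltr_wpDl// mulr_ge0.
have e10 : 0 < e1 by rewrite divr_gt0.
have [K [cK KU muK]] := inner_compact U_open U_bounded e10.
have mK := compact_mx_measurable cK.
pose theta := (fun x => defect J0 beta psi x ^+ 2) \_ K.
have id2 := defect_sqr_integrable sp.
have ith : mu.-integrable setT (EFin \o theta).
  rewrite /theta -restrict_EFin; apply/(integrable_mkcond _ mK).
  exact: integrableS id2.
have [M M0 UM] := bounded_sub_cube U_bounded.
(* The enlargement lets the half-open box contain the closed cube around U. *)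
have M1 : 0 < M + 1 by rewrite ltr_wpDl// ltW.
have Ubox : U `<=` box (const_mx (- (M + 1))) (const_mx (M + 1)).
  move=> x /UM xM i; have := xM i; rewrite !in_itv/= !mxE => /andP[h1 h2].
  apply/andP; split.
    by apply: le_trans h1; rewrite lerN2 lerDl.
  by apply: (le_lt_trans h2); rewrite ltrDl.
have [tp _] := sp.
have [w [tw _ weps wadm gain]] := improvable_cube M1 tp ith (fun x => improvable_near x sp eps0 cK KU).
exists w; split; [exact: tw|exact: weps|split; [exact: tfieldD|exact: wadm]|].
have [K' [cK' K'U K'0]] := tfield_jacobian_out tw.
have s1 : supp_in K' (fun x => fsq (jacobian w x)).
  by move=> x /K'0[_ ->]; rewrite fsq0.
have s2 : supp_in K theta.
  by move=> x Kx; rewrite /theta patchE ifN//; apply/negP => /set_mem.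
move: gain; rewrite -/theta.
rewrite (supp_in_Rintegral (subset_trans K'U Ubox) s1).
rewrite (supp_in_Rintegral (subset_trans KU Ubox) s2).
rewrite (supp_in_Rintegral K'U s1) -/c0 => gain.
have eK : \int[mu]_x theta x = \int[mu]_(x in K) defect J0 beta psi x ^+ 2.
  by rewrite [RHS]Rintegral_mkcond.
rewrite eK in gain.
have mUK : measurable (U `\` K) by exact: measurableD.
have -> : \int[mu]_(x in U) defect J0 beta psi x ^+ 2 =
    \int[mu]_(x in K) defect J0 beta psi x ^+ 2 +
    \int[mu]_(x in U `\` K) defect J0 beta psi x ^+ 2.
  rewrite -Rintegral_setU//; first by rewrite setDUK.
    by rewrite setDUK.
  by apply/disj_setPS => x [Kx []].
have small : \int[mu]_(x in U `\` K) defect J0 beta psi x ^+ 2 <= C * e1.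
  have muf : mu (U `\` K) \is a fin_num.
    by rewrite ge0_fin_numE// (lt_trans muK)// ltry.
  apply: (@le_trans _ _ (\int[mu]_(x in U `\` K) C)).
    apply: le_Rintegral => //.
    - by apply: integrableS id2 => // x [].
    - apply: (@bounded_integrable _ _ _ _ _ _ `|C|) => //.
      by rewrite (lt_trans muK)// ltry.
    - move=> x [Ux _]; have /andP[d0 d1] := dT x Ux.
      by rewrite lerXn2r ?nnegrE//; [exact: ltW|exact: le_trans (ltW d0) d1].
  rewrite Rintegral_cst// ler_wpM2l// -lee_fin fineK//; exact: ltW.
rewrite mulrDr; apply: lerD => //.
apply: (@le_trans _ _ (`|c0| * (C * e1))).
  apply: le_trans (ler_norm _) _; rewrite normrM ler_wpM2l// ger0_norm//.
  by apply: Rintegral_ge0 => x _; exact: sqr_ge0.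
rewrite mulrA /e1 mulrCA; apply: ler_piMr; first exact: ltW.
by rewrite ler_pdivrMr// mul1r lerDl ler01.
Qed.

End exists_correction.

(** * Iteration *)

Section Rintegral_sum.
Context d {T : measurableType d} {R : realType} (mu : {measure set T -> \bar R}).

Lemma Rintegral_sum (D : set T) (I : Type) (r : seq I) (f : I -> T -> R) :
  measurable D -> (forall i, mu.-integrable D (EFin \o f i)) ->
  mu.-integrable D (EFin \o (fun x => \sum_(i <- r) f i x)) /\
  \int[mu]_(x in D) (\sum_(i <- r) f i x) = \sum_(i <- r) \int[mu]_(x in D) f i x.
Proof.
move=> mD intf; elim: r => [|i r [IH1 IH2]].
  rewrite big_nil (_ : (fun x => _) = cst 0); last by apply/funext => x; rewrite big_nil.
  rewrite Rintegral_cst// mul0r; split=> //.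
  by rewrite (_ : EFin \o cst 0 = cst 0%E)//; exact: integrable0.
have e : (fun x => \sum_(j <- i :: r) f j x) = (fun x => f i x + \sum_(j <- r) f j x).
  by apply/funext => x; rewrite big_cons.
rewrite e big_cons RintegralD// IH2; split=> //.
by have := integrableD mD (intf i) IH1.
Qed.

End Rintegral_sum.

Section tfield_difference.
Context {R : realType} {n : nat}.
Local Notation Rn := 'rV[R]_n.
Local Opaque jacobian.
Implicit Types (U : set Rn) (u w : Rn -> Rn).

Lemma tfieldN U w : tfield U w -> tfield U (fun x => - w x).
Proof.
move=> [s [K [cK KU K0]]]; split=> [k a|].
  rewrite (_ : (fun x => _) = fun x => -1 * w x ord0 a); first exact: smoothZ.
  by apply/funext => x; rewrite mxE mulN1r.
by exists K; split=> // x /K0 ->; rewrite oppr0.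
Qed.

Lemma tfieldB U u w : tfield U u -> tfield U w -> tfield U (fun x => u x - w x).
Proof. by move=> tu tw; apply: tfieldD => //; exact: tfieldN. Qed.

Lemma tfield_jacobianB U u w x : tfield U u -> tfield U w ->
  jacobian (fun y => u y - w y) x = jacobian u x - jacobian w x.
Proof.
move=> tu tw; have tuw := tfieldB tu tw.
have := tfield_jacobianD x tuw tw.
have -> : (fun y => (u y - w y) + w y) = u by apply/funext => y; rewrite subrK.
by move=> ->; rewrite addrK.
Qed.

End tfield_difference.

(** * Near orthogonality of small corrections *)

Section pairing.
Context {R : realType} {n : nat}.
Local Notation Rn := 'rV[R]_n.
Local Notation mu := (lebesgue_row R n).
Local Opaque jacobian.
Variable U : set Rn.

(** Moving the derivative from f to g leaves f against the second derivative of g. The constant is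
    the L^1 norm of that derivative, hence independent of f. *)
Lemma pairing_entry_bound (g : Rn -> R) i : (forall k, smooth k g) ->
  (exists K, compact K /\ supp_in K g) ->
  exists2 C : R, 0 <= C & forall (f : Rn -> R) (e : R), (forall k, smooth k f) ->
    (exists K, [/\ compact K, K `<=` U & supp_in K f]) ->
    0 <= e -> (forall x, `|f x| <= e) ->
    mu.-integrable setT (EFin \o (fun x => pderiv i g x * pderiv i f x)) /\
    `|\int[mu]_x (pderiv i g x * pderiv i f x)| <= C * e.
Proof.
move=> sg [K [cK Kg]].
pose u := pderiv i g.
have su k : smooth k u by have [_] := sg k.+1; exact.
have Ku : supp_in K u by exact: supp_in_pderiv.
have Kdu : supp_in K (pderiv i u) by exact: supp_in_pderiv.
have cdu : continuous (pderiv i u) by have [_ /(_ i)] := su 1%N.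
have idu := supp_in_integrable cK cdu Kdu.
exists (\int[mu]_x `|pderiv i u x|); first by apply: Rintegral_ge0.
move=> f e sf [K' [cK' K'U Kf]] e0 fe.
have [||||||i1 i2 ->] := @integral_by_parts R n setT K' u f i cK' (@subsetT _ _) _ _ _ _ _ _ Kf.
- by move=> x _; exact: (smooth_continuous (su 0%N)).
- by move=> x _; exact: (@smooth_derivable _ _ u i x (su 1%N)).
- by move=> x _; exact: cdu.
- exact: (smooth_continuous (sf 0%N)).
- by move=> x; exact: (@smooth_derivable _ _ f i x (sf 1%N)).
- by have [_ /(_ i) h] := sf 1%N; exact: h.
split=> //; rewrite normrN.
apply: le_trans (le_normr_Rintegral _ i2) _ => //.
have iabs : mu.-integrable setT (EFin \o (fun x => `|pderiv i u x|)).
  by have := integrable_abse idu.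
rewrite -RintegralZr//; apply: le_Rintegral => //.
- by have := integrable_abse i2.
- by have := integrableZr measurableT e iabs.
- by move=> x _; rewrite normrM ler_wpM2l.
Qed.

Lemma pairing_bound psi : tfield U psi -> exists2 C : R, 0 <= C &
  forall w (e : R), tfield U w -> 0 <= e -> (forall x, `|w x| <= e) ->
  `|\int[mu]_(x in U) mdot (jacobian psi x) (jacobian w x)| <= C * e.
Proof.
move=> tp; have [sp [K [cK KU Kp]]] := tp.
have Kpa a : exists K, compact K /\ supp_in K (fun x => psi x ord0 a).
  by exists K; split=> // x /Kp ->; rewrite mxE.
pose Cp i a := sval (cid2 (pairing_entry_bound i (fun k => sp k a) (Kpa a))).
have Cp0 i a : 0 <= Cp i a by rewrite /Cp; case: cid2.
have Cpb i a := s2valP' (cid2 (pairing_entry_bound i (fun k => sp k a) (Kpa a))).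
exists (\sum_i \sum_a Cp i a); first by do 2!apply: sumr_ge0 => ? _.
move=> w e tw e0 we; have [sw [K' [cK' K'U Kw]]] := tw.
have Kwa a : exists K, [/\ compact K, K `<=` U & supp_in K (fun x => w x ord0 a)].
  by exists K'; split=> // x /Kw ->; rewrite mxE.
have H i a := Cpb i a (fun x => w x ord0 a) e (fun k => sw k a) (Kwa a) e0
  (fun x => le_trans (entry_norm_le _ _ _) (we x)).
have Es : (fun x => mdot (jacobian psi x) (jacobian w x)) =
   (fun x => \sum_i \sum_a pderiv i (fun y => psi y ord0 a) x * pderiv i (fun y => w y ord0 a) x).
  apply/funext => x; rewrite mdotE; apply: eq_bigr => i _; apply: eq_bigr => a _.
  exact: (congr2 *%R (tfield_jacobianE x i a tp) (tfield_jacobianE x i a tw)).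
have [KJ [cKJ KJU KJ0]] := tfield_jacobian_out tw.
rewrite (@supp_in_Rintegral _ _ U KJ)//; last first.
  by move=> x /KJ0[_ ->]; rewrite mdotC mdot0l.
rewrite Es.
have S1 i := Rintegral_sum (index_enum 'I_n) (@measurableT _ Rn) (fun a => (H i a).1).
have [_ ->] := Rintegral_sum (index_enum 'I_n) (@measurableT _ Rn) (fun i => (S1 i).1).
apply: le_trans (ler_norm_sum _ _ _) _; rewrite mulr_suml; apply: ler_sum => i _.
rewrite (S1 i).2; apply: le_trans (ler_norm_sum _ _ _) _; rewrite mulr_suml.
by apply: ler_sum => a _; exact: (H i a).2.
Qed.

End pairing.

Section iteration.
Context {R : realType} {n : nat}.
Local Notation Rn := 'rV[R]_n.
Local Notation mu := (lebesgue_row R n).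
Local Opaque jacobian.
Variables (U : set Rn) (J0 : Rn -> 'M[R]_n) (beta : Rn -> Rn -> R) (T : R).
Hypothesis n_gt0 : (0 < n)%N.
Hypothesis U_open : open U.
Hypothesis U_bounded : bounded_set U.
Hypothesis J0_continuous : forall x, U x -> {for x, continuous J0}.
Hypothesis beta_continuous : forall x y, U x ->
  {for (x, y), continuous (fun p : Rn * Rn => beta p.1 p.2)}.
Hypothesis beta_range : forall x y, U x -> 0 < beta x y <= T.
Local Notation subsol := (subsolution U J0 beta).
Let c0 : R := (256 * n%:R ^+ 2 * T)^-1.

Lemma open_bounded_integrable (f : Rn -> R) : continuous f ->
  mu.-integrable U (EFin \o f).
Proof.
move=> cf; have [M M0 UM] := bounded_sub_cube U_bounded.
have cM : compact (cube M : set Rn) by exact: cube_compact.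
apply: integrableS (compact_integrable cM cf) => //.
  exact: cube_measurable.
exact: open_mx_measurable.
Qed.

(** The last conclusion quantifies over all fields close to [psi], since later iterates are not
    known yet. They stay within 2 e' because the budgets at least halve at each step. *)
Lemma refine_step psi (e : R) : subsol psi -> 0 < e -> exists psi' e',
  [/\ subsol psi', 0 < e' /\ e' <= e / 2, forall x, `|psi' x - psi x| <= e',
    c0 * \int[mu]_(x in U) defect J0 beta psi x ^+ 2 <=
      \int[mu]_(x in U) fsq (jacobian psi' x - jacobian psi x) + e' &
    forall psi'', tfield U psi'' -> (forall x, `|psi'' x - psi x| <= 2 * e') ->
      `|\int[mu]_(x in U) mdot (jacobian psi x) (jacobian psi'' x - jacobian psi x)| <= e].
Proof.
move=> sp e0; have [tp _] := sp.
have [C C0 HC] := pairing_bound tp.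
(* C is the pairing constant of [psi]: a field within 2 e' of it pairs with an error of at most 2 C
   e' <= e. *)
pose e' := e / (2 * (C + 1)).
have D0 : 0 < 2 * (C + 1) by rewrite mulr_gt0// ltr_wpDl.
have e'0 : 0 < e' by rewrite divr_gt0.
have [w [tw we sw gain]] := exists_correction n_gt0 U_open U_bounded J0_continuous
  beta_continuous beta_range sp e'0 e'0.
exists (fun x => psi x + w x), e'; split.
- exact: sw.
- split=> //; rewrite /e' ler_wpM2l ?(ltW e0)// lef_pV2 ?posrE//; lra.
- by move=> x; rewrite addrC addKr.
- apply: le_trans gain _; rewrite lerD2r le_eqVlt; apply/orP; left; apply/eqP.
  apply: eq_Rintegral => x _; congr fsq; apply/esym.
  by apply: etrans (congr1 (fun A => A - _) (tfield_jacobianD x tp tw)) _; rewrite addrC addKr.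
- move=> p tp' pe.
  have h : 0 <= 2 * e' by rewrite mulr_ge0// ltW.
  have := HC _ (2 * e') (tfieldB tp' tp) h pe.
  rewrite (@eq_Rintegral _ _ _ _ _ (fun x => mdot (jacobian psi x) (jacobian p x - jacobian psi x))); last first.
    by move=> x _; congr mdot; exact: tfield_jacobianB tp' tp.
  move/le_trans; apply.
  rewrite /e' (_ : C * _ = e * (C / (C + 1))); last first.
    by field; rewrite gt_eqF// ltr_wpDl.
  rewrite ler_piMr ?(ltW e0)// ler_pdivrMr ?ltr_wpDl// mul1r lerDl; exact: ler01.
Qed.

Lemma refinement_sequence psi0 (eps : R) : subsol psi0 -> 0 < eps ->
  exists (psi : nat -> Rn -> Rn) (e : nat -> R),
  [/\ psi 0%N = psi0 /\ e 0%N = eps, forall k, subsol (psi k) /\ 0 < e k,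
    forall k, e k.+1 <= e k / 2 /\ forall x, `|psi k.+1 x - psi k x| <= e k.+1,
    forall k, c0 * \int[mu]_(x in U) defect J0 beta (psi k) x ^+ 2 <=
      \int[mu]_(x in U) fsq (jacobian (psi k.+1) x - jacobian (psi k) x) + e k.+1 &
    forall k psi'', tfield U psi'' -> (forall x, `|psi'' x - psi k x| <= 2 * e k.+1) ->
      `|\int[mu]_(x in U) mdot (jacobian (psi k) x) (jacobian psi'' x - jacobian (psi k) x)| <= e k].
Proof.
move=> s0 eps0.
pose X := {p : (Rn -> Rn) * R | subsol p.1 /\ 0 < p.2}.
pose rel (p q : X) :=
  [/\ (sval q).2 <= (sval p).2 / 2, forall x, `|(sval q).1 x - (sval p).1 x| <= (sval q).2,
    c0 * \int[mu]_(x in U) defect J0 beta (sval p).1 x ^+ 2 <=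
      \int[mu]_(x in U) fsq (jacobian (sval q).1 x - jacobian (sval p).1 x) + (sval q).2 &
    forall psi'', tfield U psi'' -> (forall x, `|psi'' x - (sval p).1 x| <= 2 * (sval q).2) ->
      `|\int[mu]_(x in U) mdot (jacobian (sval p).1 x) (jacobian psi'' x - jacobian (sval p).1 x)| <= (sval p).2].
have [f Hf] : exists f : X -> X, forall p, rel p (f p).
  have h (p : X) : exists q, rel p q.
    case: p => -[psi e] [sp e0].
    have [psi' [e' [sp' [e'0 e'e] h1 h2 h3]]] := refine_step sp e0.
    by exists (exist _ (psi', e') (conj sp' e'0)).
  by exists (fun p => sval (cid (h p))) => p; exact: svalP (cid (h p)).
pose s k : X := iter k f (exist _ (psi0, eps) (conj s0 eps0)).
have Hs k : rel (s k) (s k.+1) by exact: Hf.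
exists (fun k => (sval (s k)).1), (fun k => (sval (s k)).2); split.
- exact: (conj erefl erefl).
- by move=> k; exact: svalP (s k).
- by move=> k; have [h1 h2 _ _] := Hs k; exact: (conj h1 h2).
- by move=> k; have [_ _ h _] := Hs k; exact: h.
- by move=> k; have [_ _ _ h] := Hs k; exact: h.
Qed.

End iteration.

Section real_sequences.
Context {R : realType}.

Lemma le_double_sum (a b c : R) : a <= c -> b <= c -> 2 * a + 2 * b <= 4 * c.
Proof. lra. Qed.

Lemma halving_small (e : nat -> R) rho : (forall k, 0 < e k) ->
  (forall k, e k.+1 <= e k / 2) -> 0 < rho ->
  exists K, forall k, (K <= k)%N -> e k <= rho.
Proof.
move=> e0 eh rho0.
have eb k : e k * 2 ^+ k <= e 0%N.
  elim: k => [|k IH]; first by rewrite expr0 mulr1.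
  apply: le_trans IH; rewrite exprS mulrA ler_wpM2r ?exprn_ge0//.
  by have := eh k; lra.
have h0 : 0 <= e 0%N / rho by rewrite divr_ge0 ?ltW.
exists (Num.bound (e 0%N / rho)) => k Kk.
have h1 : e 0%N / rho < 2 ^+ k.
  apply: lt_le_trans (archi_boundP h0) _.
  by rewrite -natrX ler_nat ltnW// (leq_ltn_trans Kk)// ltn_expl.
have p0 : (0 : R) < 2 ^+ k by rewrite exprn_gt0.
rewrite -(ler_pM2r p0); apply: le_trans (eb k) _.
by rewrite mulrC -ler_pdivrMr// ltW.
Qed.

(* The shifted energies s k - 4 e k increase, so their increments, which control D, tend to 0. *)
Lemma almost_monotone_gaps (s e : nat -> R) (D : nat -> nat -> R) S rho :
  (forall k, 0 < e k) -> (forall k, e k.+1 <= e k / 2) -> (forall k, s k <= S) ->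
  (forall k l, 0 <= D k l) ->
  (forall k l, (k <= l)%N -> s k - 2 * e k + D k l <= s l) -> 0 < rho ->
  exists K, forall k l, (K <= k)%N -> (k <= l)%N -> D k l <= rho.
Proof.
move=> e0 eh sS D0 sD rho0.
(* Passing from k to k + 1 may lose 2 e k, and 4 e (k + 1) <= 2 e k; the drop from 4 e k to 4 e (k +
   1) covers this loss. *)
pose t k := s k - 4 * e k.
have tS k : t k <= S by rewrite /t; have := sS k; have := e0 k; lra.
have t1 k : t k <= t k.+1.
  rewrite /t; have := sD k k.+1 (leqnSn k); have := D0 k k.+1; have := eh k.
  move: (s k) (s k.+1) (e k) (e k.+1) (D k k.+1) => a b c d f; lra.
have tmono k l : (k <= l)%N -> t k <= t l.
  by move=> kl; apply: (homo_leq (@lexx _ R) (@le_trans _ R) t1).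
have emono k l : (k <= l)%N -> e l <= e k.
  move=> kl; rewrite -lerN2; apply: (@homo_leq _ (fun k => - e k) (fun x y => x <= y)) => //.
    by move=> y x z; exact: le_trans.
  by move=> j; rewrite lerN2; have := eh j; have := e0 j; lra.
have hs : has_sup (range t).
  by split; [exists (t 0%N), 0%N|exists S => _ [k _ <-]].
have r2 : 0 < rho / 2 by rewrite divr_gt0.
have [_ [K1 _ <-] HK1] := sup_adherent r2 hs.
have r8 : 0 < rho / 8 by rewrite divr_gt0.
have [K2 HK2] := halving_small e0 eh r8.
exists (maxn K1 K2) => k l; rewrite geq_max => /andP[k1 k2] kl.
have h1 := sD k l kl; have h2 := tmono _ _ k1; have h3 := HK2 _ k2.
have h4 : t l <= sup (range t) by apply: sup_upper_bound => //; exists l.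
have h5 := emono _ _ kl; rewrite /t in h2 h4 HK1.
move: (sup _) (s K1) (e K1) (s k) (e k) (s l) (e l) (D k l) HK1 h1 h2 h3 h4 h5 (e0 k).
by move=> u a b c d f g h; lra.
Qed.

End real_sequences.

(** * Bounded energies and a fast subsequence *)

Section energy.
Context {R : realType} {n : nat}.
Local Notation Rn := 'rV[R]_n.
Local Notation mu := (lebesgue_row R n).
Local Opaque jacobian.
Variables (U : set Rn) (J0 : Rn -> 'M[R]_n) (beta : Rn -> Rn -> R) (T : R).
Hypothesis n_gt0 : (0 < n)%N.
Hypothesis U_open : open U.
Hypothesis U_neq0 : U !=set0.
Hypothesis U_bounded : bounded_set U.
Hypothesis J0_continuous : forall x, U x -> {for x, continuous J0}.
Hypothesis beta_continuous : forall x y, U x ->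
  {for (x, y), continuous (fun p : Rn * Rn => beta p.1 p.2)}.
Hypothesis beta_range : forall x y, U x -> 0 < beta x y <= T.
Local Notation subsol := (subsolution U J0 beta).
Let c0 : R := (256 * n%:R ^+ 2 * T)^-1.

Lemma subsolution_fsq_le psi x : subsol psi -> U x ->
  fsq (J0 x + jacobian psi x) <= n%:R * T.
Proof.
move=> [tp adm] Ux; have := defect_gt0 n_gt0 (adm x Ux).
rewrite subr_gt0 => /ltW h; apply: (le_trans h); rewrite ler_wpM2l//.
by have /andP[] := beta_range (psi x) Ux.
Qed.

(** The zero correction is itself a subsolution, so [J0] obeys the same bound as [J0] plus the
    Jacobian; subtract the two. This is the uniform bound behind the boundedness of the energies. *)
Lemma subsolution_jacobian_le psi x : subsol (cst 0) -> subsol psi -> U x ->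
  fsq (jacobian psi x) <= 4 * (n%:R * T).
Proof.
move=> s0 sp Ux.
have h1 := subsolution_fsq_le sp Ux; have h2 := subsolution_fsq_le s0 Ux.
have h3 := fsqD_le2 (J0 x + jacobian psi x) ((-1) *: (J0 x + jacobian (cst 0 : Rn -> Rn) x)).
rewrite fsqZ sqrrN expr1n mul1r in h3.
have -> : jacobian psi x = J0 x + jacobian psi x + (-1) *: (J0 x + jacobian (cst 0 : Rn -> Rn) x).
  by rewrite jacobian_tfield0 addr0 scaleN1r addrAC subrr add0r.
apply: (le_trans h3).
exact: le_double_sum h1 h2.
Qed.

Lemma tfield_mdot_continuous p q r s : tfield U p -> tfield U q -> tfield U r -> tfield U s ->
  continuous (fun x => mdot (jacobian p x - jacobian q x) (jacobian r x - jacobian s x)).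
Proof.
move=> tp tq tr ts x.
have h1 : jacobian (fun y => p y - q y) y @[y --> x] --> jacobian (fun y => p y - q y) x.
  exact: (tfield_continuous_jacobian (tfieldB tp tq) (x := x)).
have h2 : jacobian (fun y => r y - s y) y @[y --> x] --> jacobian (fun y => r y - s y) x.
  exact: (tfield_continuous_jacobian (tfieldB tr ts) (x := x)).
pose F y := mdot (jacobian (fun y => p y - q y) y) (jacobian (fun y => r y - s y) y).
have h3 : F y @[y --> x] --> F x by exact: (@cvg_mdot R _ (nbhs x) _ n n _ _ _ _ h1 h2).
have FE y : mdot (jacobian p y - jacobian q y) (jacobian r y - jacobian s y) = F y.
  exact/esym/(congr2 _ (tfield_jacobianB y tp tq) (tfield_jacobianB y tr ts)).
exact: (eq_ind_r (fun f : Rn -> R => continuous_at x f) h3 (funext FE)).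
Qed.

Lemma tfield_mdot_integrable p q r s : tfield U p -> tfield U q -> tfield U r -> tfield U s ->
  mu.-integrable U (EFin \o (fun x => mdot (jacobian p x - jacobian q x) (jacobian r x - jacobian s x))).
Proof.
by move=> tp tq tr ts; apply: open_bounded_integrable => //; exact: tfield_mdot_continuous.
Qed.

Lemma energy_increment p q : tfield U p -> tfield U q ->
  \int[mu]_(x in U) fsq (jacobian q x) =
  \int[mu]_(x in U) fsq (jacobian p x) +
  2 * \int[mu]_(x in U) mdot (jacobian p x) (jacobian q x - jacobian p x) +
  \int[mu]_(x in U) fsq (jacobian q x - jacobian p x).
Proof.
move=> tp tq; have t0 := @tfield0 R n U.
have mU := open_mx_measurable U_open.
have z (A : 'M[R]_n) x : A - jacobian (cst 0 : Rn -> Rn) x = A by rewrite jacobian_tfield0 subr0.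
have i1 : mu.-integrable U (EFin \o (fun x => fsq (jacobian p x))).
  by apply: open_bounded_integrable => //; exact: tfield_fsq_continuous tp.
have i2 : mu.-integrable U (EFin \o (fun x => mdot (jacobian p x) (jacobian q x - jacobian p x))).
  apply: eq_integrable (tfield_mdot_integrable tp t0 tq tp) => // x _.
  by congr EFin; exact: (congr2 _ (z _ x) (erefl _)).
have i3 := tfield_mdot_integrable tq tp tq tp.
have i22 : mu.-integrable U (EFin \o (fun x => 2 * mdot (jacobian p x) (jacobian q x - jacobian p x))).
  by have := integrableZl mU 2 i2.
rewrite -RintegralZl// -RintegralD// -RintegralD//; last first.
  by have := integrableD mU i1 i22.
apply: eq_Rintegral => x _; rewrite -fsqD; congr fsq.
by rewrite addrC subrK.
Qed.

Lemma refinement_distance (psi : nat -> Rn -> Rn) (e : nat -> R) k l x :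
  (forall k, 0 < e k) ->
  (forall k, e k.+1 <= e k / 2 /\ forall x, `|psi k.+1 x - psi k x| <= e k.+1) ->
  (k <= l)%N -> `|psi l x - psi k x| <= 2 * e k.+1.
Proof.
move=> e0 eh; rewrite leq_eqVlt => /predU1P[->|kl].
  by rewrite subrr normr0 mulr_ge0// ltW.
(* Subtracting the current budget closes the induction, as each budget is at least twice the next
   one. *)
suff H m : `|psi (k.+1 + m)%N x - psi k x| <= 2 * e k.+1 - e (k.+1 + m)%N.
  have := H (l - k.+1)%N; rewrite subnKC// => h; apply: (le_trans h).
  by rewrite gerBl ltW.
elim: m => [|m IH]; first by rewrite addn0; apply: le_trans ((eh k).2 x) _; lra.
rewrite addnS; have [h1 /(_ x) h2] := eh (k.+1 + m)%N.
rewrite -(subrKA (psi (k.+1 + m)%N x)); apply: le_trans (ler_normD _ _) _.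
move: IH h1 h2; set a := `|_|; set b := `|_|; move: (e k.+1) (e _) (e _) => c d f; lra.
Qed.

(** The rate 16^-j leaves room for weights 4^j in a summable series, which later gives almost
    everywhere convergence of the whole sequence. *)
Lemma fast_refinement (eps : R) : subsol (cst 0) -> 0 < eps ->
  exists phi : nat -> Rn -> Rn,
  [/\ forall j, subsol (phi j), forall j x, `|phi j x| <= eps,
    forall i j x, (i <= j)%N -> `|phi j x - phi i x| <= eps * 2 ^- i,
    forall j, \int[mu]_(x in U) fsq (jacobian (phi j.+1) x - jacobian (phi j) x) <= 16 ^- j &
    forall j, \int[mu]_(x in U) defect J0 beta (phi j) x ^+ 2 <= 16 ^- j].
Proof.
move=> s0 eps0.
have [psi [e [[psi0 ee] spe eh gain pair]]] := refinement_sequence n_gt0 U_open U_bounded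
  J0_continuous beta_continuous beta_range s0 eps0.
have sp k : subsol (psi k) by have [] := spe k.
have e0 k : 0 < e k by have [] := spe k.
have tp k : tfield U (psi k) by have [] := sp k.
have eh1 k : e k.+1 <= e k / 2 by have [] := eh k.
have mU := open_mx_measurable U_open.
have ek k : e k <= eps * 2 ^- k.
  elim: k => [|k IH]; first by rewrite ee expr0 invr1 mulr1.
  apply: le_trans (eh1 k) _; rewrite exprS invfM mulrCA mulrC ler_wpM2l//.
pose D k l := \int[mu]_(x in U) fsq (jacobian (psi l) x - jacobian (psi k) x).
have D0 k l : 0 <= D k l by apply: Rintegral_ge0 => x _; exact: fsq_ge0.
pose s k := \int[mu]_(x in U) fsq (jacobian (psi k) x).
have sS k : s k <= 4 * (n%:R * T) * fine (mu U).
  rewrite -Rintegral_cst//; apply: le_Rintegral => //.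
  - by apply: open_bounded_integrable => //; exact: tfield_fsq_continuous (tp k).
  - by apply: open_bounded_integrable => //; exact: cst_continuous.
  - by move=> x Ux; exact: (subsolution_jacobian_le s0 (sp k) Ux).
have sD k l : (k <= l)%N -> s k - 2 * e k + D k l <= s l.
  move=> kl; rewrite [s l](energy_increment (tp k) (tp l)) lerD2r lerD2l.
  have := pair k (psi l) (tp l) (fun x => refinement_distance x e0 eh kl).
  rewrite ler_norml => /andP[h _]; rewrite -mulrN ler_wpM2l//.
have T0 : 0 < T by have [x Ux] := U_neq0; have /andP[b0 bT] := beta_range 0 Ux; exact: lt_le_trans bT.
have nn0 : (0 : R) < n%:R ^+ 2 by rewrite exprn_gt0// ltr0n.
have c00 : 0 < c0 by rewrite invr_gt0; exact: mulr_gt0 (mulr_gt0 _ nn0) T0.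
have HK (j : nat) : exists K, forall k l, (K <= k)%N -> (k <= l)%N ->
    D k l <= 16 ^- j /\ \int[mu]_(x in U) defect J0 beta (psi k) x ^+ 2 <= 16 ^- j.
  have p0 : (0 : R) < 16 ^- j by rewrite invr_gt0 exprn_gt0.
  (* The defect is controlled by 1 / c0 times the sum of an energy gap and a budget; each of the two
     is made at most c0 16^-j / 2. *)
  have q0 : 0 < Num.min (16 ^- j) (c0 * 16 ^- j / 2) by rewrite lt_min p0 divr_gt0// mulr_gt0.
  have [K1 HK1] := almost_monotone_gaps e0 eh1 sS D0 sD q0.
  have [K2 HK2] := halving_small e0 eh1 q0.
  exists (maxn K1 K2) => k l; rewrite geq_max => /andP[k1 k2] kl; split.
    by apply: le_trans (HK1 k l k1 kl) _; rewrite ge_min lexx.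
  rewrite -(ler_pM2l c00); apply: le_trans (gain k) _.
  have h1 := HK1 k k.+1 k1 (leqnSn k); have h2 := HK2 k.+1 (leq_trans k2 (leqnSn k)).
  have h3 : Num.min (16 ^- j) (c0 * 16 ^- j / 2) <= c0 * 16 ^- j / 2 by rewrite ge_min lexx orbT.
  by rewrite [leRHS]splitr; apply: lerD; [exact: le_trans h1 h3|exact: le_trans h2 h3].
pose K j := sval (cid (HK j)).
have HKK j : forall k l, (K j <= k)%N -> (k <= l)%N -> D k l <= 16 ^- j /\
  \int[mu]_(x in U) defect J0 beta (psi k) x ^+ 2 <= 16 ^- j := svalP (cid (HK j)).
(* The indices are made nondecreasing, beyond [K j] for the rates, and at least j so that the sup
   distances keep the rate 2^-j. *)
pose kk := fix kk j := if j is j'.+1 then maxn (kk j') (maxn (K j) j) else K 0%N.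
have kkK j : (K j <= kk j)%N by case: j => //= j; rewrite !leq_max leqnn orbT.
have kkj j : (j <= kk j)%N by case: j => //= j; rewrite !leq_max leqnn !orbT.
have kkS j : (kk j <= kk j.+1)%N by rewrite /= leq_max leqnn.
have kkmono i j : (i <= j)%N -> (kk i <= kk j)%N.
  by apply: (homo_leq leqnn (fun y x z => @leq_trans y x z) kkS).
have dist k l x : (k <= l)%N -> `|psi l x - psi k x| <= eps * 2 ^- k.
  move=> kl; apply: le_trans (refinement_distance x e0 eh kl) _.
  by apply: le_trans (ek k); have := eh1 k; lra.
exists (fun j => psi (kk j)); split.
- by move=> j; exact: sp.
- move=> j x; have := dist 0%N (kk j) x (leq0n _).
  by rewrite psi0 subr0 expr0 invr1 mulr1.
- move=> i j x ij; apply: le_trans (dist _ _ x (kkmono _ _ ij)) _.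
  rewrite ler_wpM2l ?(ltW eps0)// lef_pV2 ?posrE ?exprn_gt0//.
  by rewrite ler_weXn2l// ler1n.
- by move=> j; exact: (HKK j (kk j) (kk j.+1) (kkK j) (kkS j)).1.
- by move=> j; exact: (HKK j (kk j) (kk j) (kkK j) (leqnn _)).2.
Qed.

End energy.

(** * Almost everywhere convergence *)

Section almost_everywhere_rates.
Context {d : measure_display} {T : measurableType d} {R : realType}.
Variable mu : {measure set T -> \bar R}.

Lemma geometric_ereal_sum (c : nat -> R) : (forall j, 0 <= c j <= 4 ^- j) ->
  (\sum_(j <oo) (c j)%:E < +oo)%E.
Proof.
move=> hc; have c0 j : 0 <= c j by case/andP: (hc j).
have h k : \sum_(0 <= j < k) c j <= 2 - 2 * 4 ^- k.
  elim: k => [|k IH]; first by rewrite big_nil expr0 invr1; lra.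
  rewrite big_nat_recr//=; apply: le_trans (lerD IH (andP (hc k)).2) _.
  rewrite exprS invfM; have : (0 : R) < 4 ^- k by rewrite invr_gt0 exprn_gt0.
  by move: (_ ^- _) => a; lra.
apply: (@le_lt_trans _ _ (2 : R)%:E); last exact: ltry.
apply: lime_le; first by apply: is_cvg_nneseries => n _ _; rewrite lee_fin.
near=> k; rewrite sumEFin lee_fin; apply: le_trans (h k) _.
by rewrite gerBl mulr_ge0// invr_ge0 exprn_ge0.
Unshelve. all: by end_near. Qed.

(* Beppo Levi applied to the series of the 4 ^ j f_j. *)
Lemma geometric_rate_ae D (f : nat -> T -> R) : measurable D ->
  (forall j, mu.-integrable D (EFin \o f j)) ->
  (forall j x, D x -> 0 <= f j x) ->
  (forall j, \int[mu]_(x in D) f j x <= 16 ^- j) ->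
  \forall x \ae mu, D x -> exists S, forall j, f j x <= S * 4 ^- j.
Proof.
move=> mD If f0 If16.
have p4 j : (0 : R) < 4 ^+ j by rewrite exprn_gt0.
pose g j x : \bar R := (4 ^+ j * f j x)%:E.
have Ig j : mu.-integrable D (g j) by have := integrableZl mD (4 ^+ j) (If j).
have mg j : measurable_fun D (g j) := measurable_int mu (Ig j).
have g0 j x : D x -> (0 <= g j x)%E by move=> Dx; rewrite lee_fin mulr_ge0 ?(ltW (p4 j))// f0.
have gint j : (\int[mu]_(x in D) g j x = (4 ^+ j * \int[mu]_(x in D) f j x)%:E)%E.
  by rewrite -RintegralZl//; exact/esym/fineK/(integrable_fin_num mD (Ig j)).
have mS : measurable_fun D (fun x => \sum_(j <oo) g j x)%E.
  by apply: ge0_emeasurable_sum => // j x Dx _; exact: g0.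
have Sfin : mu.-integrable D (fun x => \sum_(j <oo) g j x)%E.
  apply/integrableP; split=> //.
  rewrite (@eq_integral _ _ _ mu D (fun x => \sum_(j <oo) g j x)%E); last first.
    move=> x /set_mem Dx; rewrite gee0_abs//.
    by apply: nneseries_ge0 => j _ _; exact: g0.
  rewrite integral_nneseries//.
  rewrite (eq_eseriesr (fun j _ => gint j)); apply: geometric_ereal_sum => j.
  rewrite mulr_ge0 ?(ltW (p4 j))//=; last by apply: Rintegral_ge0 => x Dx; exact: f0.
  rewrite -(ler_pM2l (p4 j)) mulfV ?(gt_eqF (p4 j))// mulrA -exprMn.
  have -> : (4 * 4 : R) = 16 by rewrite -natrM.
  have p16 : (0 : R) < 16 ^+ j by rewrite exprn_gt0.
  apply: le_trans (ler_wpM2l (ltW p16) (If16 j)) _.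
  by rewrite mulfV ?gt_eqF.
apply: filterS (integrable_ae mD Sfin) => x hx Dx; have {}hx := hx Dx.
exists (fine (\sum_(j <oo) g j x)%E) => j.
rewrite -(ler_pM2r (p4 j)) -mulrA mulVf ?(gt_eqF (p4 j))// mulr1 mulrC -lee_fin fineK//.
apply: le_trans (nneseries_lim_ge j.+1 (fun i _ _ => g0 i x Dx)).
rewrite big_nat_recr//=.
by apply: leeDr; apply: sume_ge0 => i _; exact: g0.
Qed.

End almost_everywhere_rates.

Section geometric_limits.
Context {R : realType}.

(** The increments are at most sqrt S 2^-j, hence absolutely summable. *)
Lemma geometric_cvg (a : nat -> R) S : (forall j, (a j.+1 - a j) ^+ 2 <= S * 4 ^- j) ->
  cvgn a.
Proof.
move=> ha.
have hb j : `|telescope a j| <= geometric (Num.sqrt S) (2^-1) j.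
  have h4 : (0 : R) <= 4 ^- j by rewrite invr_ge0 exprn_ge0.
  have S0 : 0 <= S.
    by have := le_trans (sqr_ge0 _) (ha 0%N); rewrite expr0 invr1 mulr1.
  rewrite /telescope /= -sqrtr_sqr; apply: le_trans (ler_wsqrtr (ha j)) _.
  rewrite sqrtrM//.
  have -> : (4 ^- j : R) = (2^-1 ^+ j) ^+ 2.
    by rewrite exprAC -exprVn; congr (_ ^+ j); rewrite exprVn expr2 -natrM.
  by rewrite sqrtr_sqr ger0_norm// exprn_ge0// invr_ge0.
have : cvgn (series (telescope a)).
  apply: normed_cvg; apply: series_le_cvg hb _ => //.
    by move=> j; apply: mulr_ge0; rewrite ?sqrtr_ge0// exprn_ge0// invr_ge0.
  by apply: is_cvg_geometric_series; rewrite ger0_norm ?invr_ge0// invf_lt1// ltr1n.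
move=> h.
rewrite (_ : a = (fun j => a 0%N + series (telescope a) j)).
  by apply: is_cvgD => //; exact: is_cvg_cst.
by apply/funext => j; exact: eq_sum_telescope.
Qed.

Lemma geometric_cvg0 (a : nat -> R) S : (forall j, 0 <= a j) ->
  (forall j, a j ^+ 2 <= S * 4 ^- j) -> a @ \oo --> (0 : R).
Proof.
move=> a0 ha.
have h : a j ^+ 2 @[j --> \oo] --> (0 : R).
  apply: (@squeeze_cvgr _ _ _ _ (cst 0) (geometric S (4^-1))).
  - by near=> j; rewrite sqr_ge0/= exprVn.
  - exact: cvg_cst.
  - by apply: cvg_geometric; rewrite ger0_norm ?invr_ge0// invf_lt1// ltr1n.
have h1 : Num.sqrt (a j ^+ 2) @[j --> \oo] --> Num.sqrt (0 : R).
  by apply: (cvg_comp _ _ h); exact: sqrt_continuous.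
rewrite -[X in _ --> X]sqrtr0 (_ : a = fun j => Num.sqrt (a j ^+ 2))//.
by apply/funext => j; rewrite sqrtr_sqr ger0_norm.
Unshelve. all: by end_near. Qed.

Lemma uniform_limit_row n (p : nat -> 'rV[R]_n -> 'rV[R]_n) (eps : R) : 0 < eps ->
  (forall j, continuous (p j)) ->
  (forall i j x, (i <= j)%N -> `|p j x - p i x| <= eps * 2 ^- i) ->
  exists v : 'rV[R]_n -> 'rV[R]_n, [/\ continuous v, forall i x, `|v x - p i x| <= eps * 2 ^- i &
    forall x, p j x @[j --> \oo] --> v x].
Proof.
move=> eps0 pc pd.
have pe x i : cvgn (fun j => p j x ord0 i).
  apply: (@geometric_cvg _ (eps ^+ 2)) => j.
  have h := pd j j.+1 x (leqnSn j).
  have := le_trans (entry_norm_le (p j.+1 x - p j x) ord0 i) h; rewrite mxE [X in _ + X]mxE.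
  rewrite -ler_sqr ?nnegrE ?mulr_ge0 ?invr_ge0 ?exprn_ge0 ?(ltW eps0)// real_normK ?num_real//.
  move=> /le_trans; apply; rewrite exprMn ler_pM2l ?exprn_gt0//.
  by rewrite exprVn exprAC expr2 -natrM.
pose v x : 'rV[R]_n := \row_i limn (fun j => p j x ord0 i).
have pv x : p j x @[j --> \oo] --> v x.
  apply: cvg_mx => a i; rewrite (ord1 a) mxE; exact: pe.
have vd i x : `|v x - p i x| <= eps * 2 ^- i.
  have h : `|p j x - p i x| @[j --> \oo] --> `|v x - p i x|.
    by apply: cvg_norm; apply: cvgB; [exact: pv|exact: cvg_cst].
  apply: (cvgr_to_le h); near=> j; apply: pd; near: j; exact: nbhs_infty_ge.
exists v; split=> // x; apply/(@cvgrPdist_le _ _ _ (nbhs x)) => e e0.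
have [i hi] : exists i, eps * 2 ^- i <= e / 3.
  have e3 : 0 < e / 3 by rewrite divr_gt0.
  have h1 k : 0 < eps * 2 ^- k by rewrite mulr_gt0// invr_gt0 exprn_gt0.
  have h2 k : eps * 2 ^- k.+1 <= eps * 2 ^- k / 2 by rewrite exprS invfM mulrCA mulrC.
  have [K HK] := halving_small h1 h2 e3.
  by exists K; exact: HK (leqnn K).
near=> y.
have -> : v x - v y = (v x - p i x) + (p i x - p i y) + (p i y - v y).
  by rewrite subrKA subrKA.
apply: le_trans (ler_normD _ _) _; apply: le_trans (lerD (ler_normD _ _) (lexx _)) _.
have h1 := vd i x; have h2 := vd i y; rewrite distrC in h2.
have h3 : `|p i x - p i y| <= e / 3.
  near: y; apply: (@cvgr_dist_le _ _ _ (nbhs x) _ _ _ (pc i x)); by rewrite divr_gt0.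
have := lerD (lerD (le_trans h1 hi) h3) (le_trans h2 hi).
by move=> /le_trans; apply; lra.
Unshelve. all: by end_near. Qed.

End geometric_limits.

Section bounded_pointwise_limit.
Context {R : realType} {n : nat}.
Local Notation Rn := 'rV[R]_n.

Definition clip (C t : R) : R := Num.max (- C) (Num.min C t).

Lemma clip_bound (C t : R) : 0 <= C -> `|clip C t| <= C.
Proof.
move=> C0; rewrite ler_norml /clip le_max lexx/= ge_max ge_min lexx andbT.
by apply: (@le_trans _ _ 0) => //; rewrite oppr_le0.
Qed.

Lemma clip_id (C t : R) : `|t| <= C -> clip C t = t.
Proof. by rewrite ler_norml /clip => /andP[h1 h2]; rewrite (min_idPr h2) (max_idPr h1). Qed.

(** The upper limit is measurable without any convergence and equals the limit where it exists;
    clipping makes the bound hold at every point, including those of divergence. *)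
Lemma bounded_pointwise_limit D (f : nat -> Rn -> R) (C : R) : measurable D -> 0 <= C ->
  (forall j, measurable_fun D (f j)) -> (forall j x, `|f j x| <= C) ->
  exists g : Rn -> R, [/\ measurable_fun D g, forall x, `|g x| <= C &
    forall x, cvgn (f ^~ x) -> f j x @[j --> \oo] --> g x].
Proof.
move=> mD C0 mf fC; exists (fun x => clip C (limn_sup (f ^~ x))); split.
- apply: measurable_maxr; first exact: measurable_cst.
  apply: measurable_minr; first exact: measurable_cst.
  apply: measurable_fun_limn_sup => // x Dx.
    by exists C => _ [j _ <-]; apply: le_trans (fC j x); exact: ler_norm.
  by exists (- C) => _ [j _ <-]; have := fC j x; rewrite ler_norml => /andP[].
- by move=> x; exact: clip_bound.
- move=> x cf; have [_ ->] := cvg_limn_inf_sup cf.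
  rewrite clip_id//; have h : `|f j x| @[j --> \oo] --> `|limn (f ^~ x)| by exact: cvg_norm.
  by apply: (cvgr_to_le h); near=> j; exact: fC.
Unshelve. all: by end_near. Qed.

End bounded_pointwise_limit.

Section limit_solution.
Context {R : realType} {n : nat}.
Local Notation Rn := 'rV[R]_n.
Local Notation mu := (lebesgue_row R n).
Local Opaque jacobian.
Variables (U : set Rn) (J0 : Rn -> 'M[R]_n) (beta : Rn -> Rn -> R) (T : R).
Hypothesis n_gt0 : (0 < n)%N.
Hypothesis U_open : open U.
Hypothesis U_neq0 : U !=set0.
Hypothesis U_bounded : bounded_set U.
Hypothesis J0_continuous : forall x, U x -> {for x, continuous J0}.
Hypothesis beta_continuous : forall x y, U x ->
  {for (x, y), continuous (fun p : Rn * Rn => beta p.1 p.2)}.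
Hypothesis beta_range : forall x y, U x -> 0 < beta x y <= T.
Local Notation subsol := (subsolution U J0 beta).

(** Strict bounds on the singular values become weak ones in the limit, and a vanishing defect is
    equality of the traces: the two hypotheses of [conformal_of_opsq_le]. *)
Lemma conformal_limit (p : nat -> Rn -> Rn) x (y : Rn) (A : 'M[R]_n) : U x ->
  (forall j, subsol (p j)) -> p j x @[j --> \oo] --> y ->
  jacobian (p j) x @[j --> \oo] --> A ->
  defect J0 beta (p j) x @[j --> \oo] --> (0 : R) ->
  (J0 x + A) *m (J0 x + A)^T = (beta x y)%:M.
Proof.
move=> Ux sp py pA pd.
have hJ : J0 x + jacobian (p j) x @[j --> \oo] --> J0 x + A.
  by apply: cvgD; [exact: cvg_cst|exact: pA].
have hb : beta x (p j x) @[j --> \oo] --> beta x y.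
  have h := @beta_continuous x y Ux.
  apply: (@cvg_comp _ _ _ (fun j => (x, p j x)) (fun p : Rn * Rn => beta p.1 p.2) _ _ _ _ h).
  exact: (cvg_pair (cvg_cst x) py).
apply: conformal_of_opsq_le => [v|].
  have h1 : fsq (v *m (J0 x + jacobian (p j) x)) @[j --> \oo] --> fsq (v *m (J0 x + A)).
    have h : v *m (J0 x + jacobian (p j) x) @[j --> \oo] --> v *m (J0 x + A).
      by apply: cvg_mulmx hJ; exact: cvg_cst.
    exact: (cvg_mdot h h).
  have h2 : beta x (p j x) * fsq v @[j --> \oo] --> beta x y * fsq v.
    by apply: cvgM hb _; exact: cvg_cst.
  apply: ler_cvg_to h1 h2 _; near=> j.
  have [_ /(_ x Ux)[c cb hc]] := sp j.
  by apply: le_trans (hc v) _; rewrite ler_wpM2r ?fsq_ge0//; exact: ltW.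
have h3 : fsq (J0 x + jacobian (p j) x) @[j --> \oo] --> fsq (J0 x + A) by exact: (cvg_mdot hJ hJ).
have h4 : n%:R * beta x (p j x) - defect J0 beta (p j) x @[j --> \oo] --> n%:R * beta x y - 0.
  by apply: cvgB pd; apply: cvgM hb; exact: cvg_cst.
rewrite subr0 in h4; apply: (cvg_unique _ _ h4) => //.
rewrite (_ : (fun j => _ - _) = (fun j => fsq (J0 x + jacobian (p j) x)))//.
by apply/funext => j; rewrite /defect opprB addrC subrK.
Unshelve. all: by end_near. Qed.

Lemma limit_solution (eps : R) : subsol (cst 0) -> 0 < eps ->
  exists (p : nat -> Rn -> Rn) (v : Rn -> Rn) (A : Rn -> 'M[R]_n) (C : R),
  [/\ (forall j, tfield U (p j)) /\ forall j x a b, `|jacobian (p j) x a b| <= C,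
    [/\ continuous v, forall x, ~ U x -> v x = 0, forall x, `|v x| <= eps &
      forall x, (forall j, `|p j x| <= eps) /\ p j x @[j --> \oo] --> v x],
    (forall a b, measurable_fun U (fun x => A x a b)) /\ forall x a b, `|A x a b| <= C &
    \forall x \ae mu, U x -> jacobian (p j) x @[j --> \oo] --> A x /\
      (J0 x + A x) *m (J0 x + A x)^T = (beta x (v x))%:M].
Proof.
move=> s0 eps0.
have mU := open_mx_measurable U_open.
have [p [sp pe pd pf pg]] := fast_refinement n_gt0 U_open U_neq0 U_bounded
  J0_continuous beta_continuous beta_range s0 eps0.
have tp j : tfield U (p j) by have [] := sp j.
have [v [vc vp pv]] := uniform_limit_row eps0 (fun j => tfield_continuous (tp j)) pd.
have T0 : 0 < T by have [x Ux] := U_neq0; have /andP[b0 bT] := beta_range 0 Ux; exact: lt_le_trans bT.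
have nT0 : 0 <= n%:R * T := mulr_ge0 (ler0n _ _) (ltW T0).
have nT4 : 0 <= 4 * (n%:R * T) := mulr_ge0 (ler0n _ 4) nT0.
pose C := Num.sqrt (4 * (n%:R * T)).
have pC j x a b : `|jacobian (p j) x a b| <= C.
  rewrite -sqrtr_sqr; apply: ler_wsqrtr; apply: le_trans (entry_fsq_le _ _ _) _.
  have [Ux|nUx] := pselect (U x).
    exact: (subsolution_jacobian_le n_gt0 beta_range s0 (sp j) Ux).
  have [K [_ KU /(_ x (fun Kx => nUx (KU x Kx)))[_ Jx]]] := tfield_jacobian_out (tp j).
  by apply: le_trans nT4; rewrite Jx fsq0.
have mJ j a b : measurable_fun U (fun x => jacobian (p j) x a b).
  apply: continuous_mx_measurable => // x.
  exact: (@cvg_entry _ _ (nbhs x) _ _ _ _ _ _ _ (tfield_continuous_jacobian (tp j) (x := x))).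
have gE a b : {g : Rn -> R | [/\ measurable_fun U g, forall x, `|g x| <= C &
    forall x, cvgn (fun j => jacobian (p j) x a b) -> jacobian (p j) x a b @[j --> \oo] --> g x]}.
  apply/cid; apply: (bounded_pointwise_limit (f := fun j x => jacobian (p j) x a b)) => //.
  exact: sqrtr_ge0.
pose A x : 'M[R]_n := \matrix_(a, b) sval (gE a b) x.
exists p, v, A, C; split; [by []|split=> //|split|].
- move=> x nUx; have h := pv x.
  have p0 j : p j x = 0.
    by have [K [_ KU /(_ x (fun Kx => nUx (KU x Kx)))[]]] := tfield_jacobian_out (tp j).
  have h0 : p j x @[j --> \oo] --> (0 : Rn).
    by rewrite (_ : (fun j => p j x) = cst 0); [exact: cvg_cst|apply/funext].
  exact: (cvg_unique _ h h0).
- move=> x; have h : `|p j x| @[j --> \oo] --> `|v x| by apply: cvg_norm; exact: pv.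
  by apply: (cvgr_to_le h); near=> j; exact: pe.
- move=> a b; rewrite (_ : (fun x => _) = sval (gE a b)).
    by have [] := svalP (gE a b).
  by apply/funext => x; rewrite mxE.
- by move=> x a b; rewrite mxE; have [] := svalP (gE a b).
have I1 j : mu.-integrable U (EFin \o (fun x => fsq (jacobian (p j.+1) x - jacobian (p j) x))).
  exact: (tfield_mdot_integrable U_open U_bounded (tp j.+1) (tp j) (tp j.+1) (tp j)).
have I2 j := defect_sqr_integrable n_gt0 U_open U_bounded J0_continuous beta_continuous beta_range (sp j).
have a1 := geometric_rate_ae mU I1 (fun j x _ => fsq_ge0 _) pf.
have a2 := geometric_rate_ae mU I2 (fun j x _ => sqr_ge0 _) pg.
apply: filterS2 a1 a2 => x h1 h2 Ux; have [S1 hS1] := h1 Ux; have [S2 hS2] := h2 Ux.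
have cJ : jacobian (p j) x @[j --> \oo] --> A x.
  apply: cvg_mx => a b; rewrite mxE; have [_ _] := svalP (gE a b); apply.
  apply: (@geometric_cvg _ _ S1) => j; apply: le_trans (hS1 j).
  by have := entry_fsq_le (jacobian (p j.+1) x - jacobian (p j) x) a b; rewrite mxE [X in _ + X]mxE.
split=> //; apply: (conformal_limit Ux sp (pv x) cJ).
apply: (@geometric_cvg0 _ _ S2) => // j; have [_ adm] := sp j.
exact: ltW (defect_gt0 n_gt0 (adm x Ux)).
Unshelve. all: by end_near. Qed.

End limit_solution.

(** * Weak gradients *)

Section weak_gradients.
Context {R : realType} {n : nat}.
Local Notation Rn := 'rV[R]_n.
Local Notation mu := (lebesgue_row R n).
Variables (Omega : set Rn).
Hypothesis Omega_open : open Omega.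
Hypothesis Omega_bounded : bounded_set Omega.
Implicit Types (f g : Rn -> R) (u v : Rn -> Rn) (G : Rn -> 'M[R]_n).

Let mO : measurable Omega. Proof. exact: open_mx_measurable. Qed.

Lemma test_product_integrable g f : loc_integrable Omega g -> test_function Omega f ->
  mu.-integrable Omega (EFin \o (fun x => g x * f x)).
Proof.
move=> lg tf; have [cf _ _ [K [cK KO f0]]] := test_function_C1 tf.
have [C C0 fC] := supp_in_bounded cK cf f0.
have mK := compact_mx_measurable cK.
apply/(integrable_mkcond _ mO).
rewrite (_ : _ \_ _ = (EFin \o (fun x => g x * f x)) \_ K).
  apply/(integrable_mkcond _ mK).
  apply: (integrableMl mK (lg K cK KO)).
    exact: continuous_mx_measurable.
  by exists C; split; [exact: num_real|move=> z Cz x _; exact: le_trans (fC x) (ltW Cz)].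
apply/funext => x; rewrite /patch.
case: ifPn => [/set_mem Ox|/negP nOx]; case: ifPn => [/set_mem Kx|/negP nKx] //=.
- by rewrite f0 ?mulr0// => Kx; apply: nKx; rewrite inE.
- by exfalso; apply: nOx; rewrite inE; exact: KO.
Qed.

Lemma test_function_pderiv f i : test_function Omega f -> test_function Omega (pderiv i f).
Proof.
move=> [sf [K [cK KO f0]]]; split; last by exists K; split=> //; exact: (supp_in_pderiv i cK f0).
by move=> k; have [_ /(_ i)[]] := sf k.+1.
Qed.

Lemma is_weak_gradientD u v G1 G2 : is_weak_gradient Omega u G1 ->
  is_weak_gradient Omega v G2 ->
  is_weak_gradient Omega (fun x => u x + v x) (fun x => G1 x + G2 x).
Proof.
move=> [lu lG1 e1] [lv lG2 e2]; split.
- move=> a K cK KO; rewrite (_ : _ \o _ = (EFin \o (fun x => u x ord0 a)) \+ (EFin \o (fun x => v x ord0 a))).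
    by apply: integrableD; [exact: compact_mx_measurable|exact: lu|exact: lv].
  by apply/funext => x /=; rewrite mxE EFinD.
- move=> a i K cK KO; rewrite (_ : _ \o _ = (EFin \o (fun x => G1 x a i)) \+ (EFin \o (fun x => G2 x a i))).
    by apply: integrableD; [exact: compact_mx_measurable|exact: lG1|exact: lG2].
  by apply/funext => x /=; rewrite mxE EFinD.
- move=> a i f tf; have td := test_function_pderiv i tf.
  under eq_Rintegral do rewrite mxE mulrDl.
  under [in RHS]eq_Rintegral do rewrite mxE mulrDl.
  rewrite !RintegralD ?e1 ?e2 ?opprD//; exact: test_product_integrable.
Qed.

Lemma is_weak_gradientN u G : is_weak_gradient Omega u G ->
  is_weak_gradient Omega (fun x => - u x) (fun x => - G x).
Proof.
move=> [lu lG e]; split.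
- move=> a K cK KO; rewrite (_ : _ \o _ = -%E \o (EFin \o (fun x => u x ord0 a))).
    by apply: integrableN; exact: lu.
  by apply/funext => x /=; rewrite mxE EFinN.
- move=> a i K cK KO; rewrite (_ : _ \o _ = -%E \o (EFin \o (fun x => G x a i))).
    by apply: integrableN; exact: lG.
  by apply/funext => x /=; rewrite mxE EFinN.
- move=> a i f tf; have td := test_function_pderiv i tf.
  under eq_Rintegral do rewrite mxE mulNr -mulN1r.
  under [in RHS]eq_Rintegral do rewrite mxE mulNr -mulN1r.
  by rewrite !RintegralZl ?e ?mulrN ?mulN1r//; exact: test_product_integrable.
Qed.

Lemma is_weak_gradient_sub (O : set Rn) u G : open O -> O `<=` Omega ->
  is_weak_gradient Omega u G -> is_weak_gradient O u G.
Proof.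
move=> oO OO [lu lG e]; split.
- by move=> a K cK KO; apply: lu => //; exact: subset_trans OO.
- by move=> a i K cK KO; apply: lG => //; exact: subset_trans OO.
move=> a i f tf; have [sf [K [cK KO f0]]] := tf.
have tfO : test_function Omega f by split=> //; exists K; split=> //; exact: subset_trans OO.
have OE g : (forall x, ~ K x -> g x = 0) ->
    \int[mu]_(x in O) g x = \int[mu]_(x in Omega) g x.
  by move=> g0; rewrite (supp_in_Rintegral KO)// (supp_in_Rintegral (subset_trans KO OO)).
rewrite OE ?e// => [|x Kx]; last by rewrite (supp_in_pderiv i cK f0)// mulr0.
by congr (- _); apply/esym/OE => x Kx; rewrite f0// mulr0.
Qed.

(** Fundamental lemma for each entry of G1 - G2, a weak gradient of u - v. Allowing u and v to
    differ on a null set lets the datum be compared with its C^1 representatives on the pieces. *)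
Lemma weak_gradient_ae_unique u v G1 G2 :
  is_weak_gradient Omega u G1 -> is_weak_gradient Omega v G2 ->
  (\forall x \ae mu, Omega x -> u x = v x) ->
  \forall x \ae mu, Omega x -> G1 x = G2 x.
Proof.
move=> w1 w2 uv; have [lw lG ew] := is_weak_gradientD w1 (is_weak_gradientN w2).
have H a i : \forall x \ae mu, Omega x -> (G1 x - G2 x) a i = 0.
  apply: fundamental_lemma => // f tf.
  have := ew a i f tf => /esym/eqP; rewrite eqr_oppLR => /eqP ->.
  have I := test_product_integrable (lw a) (test_function_pderiv i tf).
  rewrite /Rintegral (@ae_eq_integral _ _ _ mu Omega (cst 0%E)) ?integral0 ?oppr0//.
    exact: measurable_int I.
  by apply: filterS uv => x h /h /= ->; rewrite subrr mxE mul0r.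
have {}H : \forall x \ae mu, forall a i, Omega x -> (G1 x - G2 x) a i = 0.
  by apply: filter_forall => a; exact: filter_forall.
apply: filterS H => x h Ox; apply/eqP; rewrite -subr_eq0; apply/eqP/matrixP => a i.
by rewrite [RHS]mxE; exact: h.
Qed.

Lemma weak_gradientP u : weakly_differentiable Omega u ->
  is_weak_gradient Omega u (weak_gradient Omega u).
Proof. exact: xgetPex. Qed.

Lemma loc_integrable_measurable g : loc_integrable Omega g -> measurable_fun Omega g.
Proof.
move=> lg; have [K [cK KO _ OE]] := compact_exhaustion Omega_open Omega_bounded.
rewrite OE; apply/measurable_fun_bigcup => [i|i]; first exact: compact_mx_measurable.
by apply/measurable_EFinP; exact: measurable_int (lg _ (cK i) (KO i)).
Qed.

Lemma bounded_loc_integrable g C : measurable_fun Omega g ->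
  (forall x, Omega x -> `|g x| <= C) -> loc_integrable Omega g.
Proof.
move=> mg gC K cK KO; have mK := compact_mx_measurable cK.
apply: (bounded_integrable (C := C)) => //; first exact: compact_measure_fin.
  exact: measurable_funS KO mg.
by move=> x /KO; exact: gC.
Qed.

End weak_gradients.

Section matrix_measurability.
Context d {T : measurableType d} {R : realType} {p q : nat}.
Implicit Types f : T -> 'M[R]_(p, q).

Lemma measurable_vec_mx : measurable_fun setT (@vec_mx R p q).
Proof.
apply: (measurability (@open 'M[R]_(p, q))) => // _ [U oU <-].
rewrite setTI; apply: sub_sigma_algebra.
apply: open_comp => // x _; apply: (@cvg_mx R _ (nbhs x)) => i j; rewrite mxE.
rewrite (_ : (fun y => _) = (fun y : 'rV[R]_(p * q) => y ord0 (mxvec_index i j))).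
  exact: coord_continuous.
by apply/funext => y; rewrite mxE.
Qed.

(** Flatten the matrix to a row, where measurability by coordinates is known; [vec_mx] is continuous
    and brings the result back. *)
Lemma measurable_fun_mx D f : measurable D ->
  (forall i j, measurable_fun D (fun x => f x i j)) -> measurable_fun D f.
Proof.
move=> mD mf; apply/(measurable_restrictT _ mD).
rewrite (_ : f \_ D = vec_mx \o (fun x => mxvec ((f \_ D) x))); last first.
  by apply/funext => x /=; rewrite mxvecK.
apply: measurableT_comp; first exact: measurable_vec_mx.
apply: measurable_fun_row => k; have [i j] := mxvec_indexP k.
rewrite (_ : (fun x => _) = (fun x => f x i j) \_ D).
  by apply/(measurable_restrictT _ mD); exact: mf.
by apply/funext => x; rewrite mxvecE /patch; case: ifPn => // _; rewrite mxE.
Qed.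

Lemma measurable_frobenius D f : measurable_fun D f ->
  measurable_fun D (fun x => frobenius (f x)).
Proof.
move=> mf; apply: measurableT_comp mf.
apply: continuous_mx_measurable => // A.
rewrite (_ : @frobenius R p q = fun B => Num.sqrt (fsq B)); last exact/funext/frobeniusE.
apply: (@cvg_comp _ _ _ (fun B : 'M[R]_(p, q) => fsq B) (@Num.sqrt R) (nbhs A) (nbhs (fsq A))).
  exact: continuous_fsq.
exact: sqrt_continuous.
Qed.

End matrix_measurability.

Section weak_derivatives.
Context {R : realType} {n : nat}.
Local Notation Rn := 'rV[R]_n.
Local Notation mu := (lebesgue_row R n).
Local Opaque jacobian.

Lemma frobenius_ge0 p q (A : 'M[R]_(p, q)) : 0 <= frobenius A.
Proof. exact: sqrtr_ge0. Qed.

Lemma frobenius_le p q (A : 'M[R]_(p, q)) (c : R) : 0 <= c ->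
  (forall i j, `|A i j| <= c) -> frobenius A <= Num.sqrt ((p * q)%:R * c ^+ 2).
Proof.
move=> c0 h; rewrite frobeniusE; apply: ler_wsqrtr; apply: le_trans (fsq_le_norm A) _.
rewrite ler_wpM2l// lerXn2r// ?nnegrE//; exact: mx_norm_le.
Qed.

Lemma cvg_frobenius {T : Type} (F : set_system T) {FF : Filter F} p q
  (f : T -> 'M[R]_(p, q)) (A : 'M[R]_(p, q)) :
  f x @[x --> F] --> A -> frobenius (A - f x) @[x --> F] --> (0 : R).
Proof.
move=> fA; have h : fsq (f x - A) @[x --> F] --> (0 : R) by exact: cvg_fsq_sub.
have h1 : Num.sqrt (fsq (f x - A)) @[x --> F] --> Num.sqrt (0 : R).
  by apply: (cvg_comp _ _ h); exact: sqrt_continuous.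
rewrite -[X in _ --> X]sqrtr0 (_ : (fun x => frobenius _) = fun x => Num.sqrt (fsq (f x - A)))//.
by apply/funext => x; rewrite frobeniusE -opprB -scaleN1r fsqZ sqrrN expr1n mul1r.
Qed.

Lemma differentiable_is_weak_gradient (O : set Rn) (u : Rn -> Rn) (G : Rn -> 'M[R]_n) :
  open O -> (forall x, O x -> differentiable u x) -> (forall x, O x -> gradient u x = G x) ->
  (forall x, O x -> {for x, continuous G}) -> is_weak_gradient O u G.
Proof.
move=> oO du uG cG.
have cu x a : O x -> {for x, continuous (fun y => u y ord0 a)}.
  move=> Ox; apply: (@cvg_entry _ _ (nbhs x) _ _ _ _ _ _ _ _).
  exact: differentiable_continuous (du x Ox).
have cGe x a i : O x -> {for x, continuous (fun y => G y a i)}.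
  by move=> Ox; exact: (@cvg_entry _ _ (nbhs x) _ _ _ _ _ _ _ (cG x Ox)).
have GE x a i : O x -> pderiv i (fun y => u y ord0 a) x = G x a i.
  move=> Ox; have trE (M : 'M[R]_n) : M^T a i = M i a by rewrite mxE.
  exact: (etrans (esym (jacobianE i a (du x Ox))) (etrans (esym (trE _)) (congr1 (fun M : 'M[R]_n => M a i) (uG x Ox)))).
have li (g : Rn -> R) : (forall x, O x -> {for x, continuous g}) -> loc_integrable O g.
  move=> cg K cK KO.
  have /compact_bounded[M [_ HM]] : compact (g @` K).
    by apply: continuous_compact => //; apply: continuous_in_subspaceT => x /set_mem /KO; exact: cg.
  apply: (bounded_integrable (C := M + 1)); first exact: compact_mx_measurable.
  - exact: compact_measure_fin.
  - exact: measurable_funS (open_mx_measurable oO) KO (open_continuous_measurable oO cg).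
  - by move=> x Kx; apply: HM; [rewrite ltrDl|exists x].
split=> [a|a i|a i f tf]; [by apply: li => x; exact: cu|by apply: li => x; exact: cGe|].
have [cf df cdf [K [cK KO f0]]] := test_function_C1 tf.
have cp x : O x -> {for x, continuous (pderiv i (fun y => u y ord0 a))}.
  move=> Ox; rewrite /prop_for /continuous_at GE//.
  apply: cvg_trans (cGe x a i Ox); apply: (@near_eq_cvg _ _ (nbhs x)).
  have : \forall y \near x, O y by exact: open_nbhs_nbhs.
  by apply: filterS => y Oy; rewrite GE.
have du1 x : O x -> derivable (fun y => u y ord0 a) x (delta_mx ord0 i).
  by move=> Ox; apply: diff_derivable; exact: differentiable_entry (du x Ox).
have [_ _ E] := integral_by_parts cK KO (fun x => cu x a) du1 cp cf (df i) (cdf i) f0.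
rewrite (supp_in_Rintegral KO) => [|x Kx]; last by rewrite (supp_in_pderiv i cK f0)// mulr0.
rewrite E; congr (- _); rewrite -(supp_in_Rintegral KO) => [|x Kx]; last by rewrite f0// mulr0.
by apply: eq_Rintegral => x /set_mem Ox; rewrite GE.
Qed.

Variable Omega : set Rn.
Hypothesis Omega_open : open Omega.
Hypothesis Omega_bounded : bounded_set Omega.
Let mO : measurable Omega. Proof. exact: open_mx_measurable. Qed.
Let Ofin : (mu Omega < +oo)%E. Proof. exact: bounded_measure_fin. Qed.

Lemma Linfty_L1 p q (f : Rn -> 'M[R]_(p, q)) : Linfty Omega f -> L1 Omega f.
Proof.
move=> [mf [M fM]]; split=> //.
have mfr := measurable_frobenius mf.
apply: (@le_lt_trans _ _ (\int[mu]_(x in Omega) (cst `|M|%:E x)))%E; last first.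
  by rewrite integral_cst// lte_mul_pinfty// lee_fin.
apply: ae_ge0_le_integral => //.
- by move=> x _; rewrite lee_fin frobenius_ge0.
- exact/measurable_EFinP.
- by move=> x _; rewrite lee_fin.
- by apply: filterS fM => x h /h; rewrite lee_fin => /le_trans; apply; exact: ler_norm.
Qed.

Lemma weak_gradient_measurable u : weakly_differentiable Omega u ->
  measurable_fun Omega (weak_gradient Omega u).
Proof.
move=> /weak_gradientP[_ lG _]; apply: measurable_fun_mx => // a i.
exact: loc_integrable_measurable.
Qed.

(* Entrywise bounds allow every limit below to be taken by bounded convergence. *)
Lemma limit_W1oo_0 (p : nat -> Rn -> Rn) (v : Rn -> Rn) (G : Rn -> 'M[R]_n) (c C : R) :
  0 <= c -> 0 <= C ->
  (forall j, tfield Omega (p j)) -> (forall j x a b, `|jacobian (p j) x a b| <= C) ->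
  (forall j x, `|p j x| <= c) -> (forall x, `|v x| <= c) -> continuous v ->
  (forall x, p j x @[j --> \oo] --> v x) ->
  (forall a i, measurable_fun Omega (fun x => G x a i)) -> (forall x a i, `|G x a i| <= C) ->
  (\forall x \ae mu, Omega x -> gradient (p j) x @[j --> \oo] --> G x) ->
  W1oo_0 Omega v /\ is_weak_gradient Omega v G.
Proof.
move=> c0 C0 tp pC pc vc cv pv mG GC pG.
have gC j x a i : `|gradient (p j) x a i| <= C by rewrite mxE.
have cJ j : continuous (gradient (p j)).
  by move=> x; apply: (@cvg_trmx _ _ (nbhs x)); exact: (tfield_continuous_jacobian (tp j) (x := x)).
have centry (w : Rn -> Rn) a : continuous w -> continuous (fun x => w x ord0 a).
  by move=> cw x; exact: (@cvg_entry _ _ (nbhs x) _ _ _ _ _ _ _ (cw x)).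
have mv : measurable_fun Omega v.
  by apply: measurable_fun_mx => // i a; rewrite (ord1 i); apply: continuous_mx_measurable => //; exact: centry.
have mGm : measurable_fun Omega G by exact: measurable_fun_mx.
have mgrad j a i : measurable_fun Omega (fun x => gradient (p j) x a i).
  apply: continuous_mx_measurable => // x; exact: (@cvg_entry _ _ (nbhs x) _ _ _ _ _ _ _ (cJ j x)).
have wp j : is_weak_gradient Omega (p j) (gradient (p j)).
  apply: differentiable_is_weak_gradient; [exact: Omega_open| |move=> x _; exact: erefl|move=> x _; exact: cJ].
  by move=> x _; exact: (tfield_differentiable x (tp j)).
have wG : is_weak_gradient Omega v G.
  split=> [a|a i|a i f tf].
  - apply: (@bounded_loc_integrable _ _ _ Omega_open _ c); first by apply: continuous_mx_measurable => //; exact: centry.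
    by move=> x _; apply: le_trans (vc x); exact: entry_norm_le.
  - by apply: (@bounded_loc_integrable _ _ _ Omega_open _ C) => // x _.
  - have [cf df cdf [K [cK KO f0]]] := test_function_C1 tf.
    have [Cf Cf0 fC] := supp_in_bounded cK cf f0.
    have [Cd Cd0 dC] := supp_in_bounded cK (cdf i) (supp_in_pderiv i cK f0).
    have [_ _ h1] : [/\ mu.-integrable Omega (EFin \o (fun x => v x ord0 a * pderiv i f x)),
      \int[mu]_(x in Omega) `|p j x ord0 a * pderiv i f x - v x ord0 a * pderiv i f x| @[j --> \oo] --> (0 : R) &
      \int[mu]_(x in Omega) (p j x ord0 a * pderiv i f x) @[j --> \oo] --> \int[mu]_(x in Omega) (v x ord0 a * pderiv i f x)].
      apply: (@Rbounded_convergence _ _ _ mu Omega _ _ (c * Cd)) => //.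
      + move=> j; apply: continuous_mx_measurable => // x; apply: continuousM; last exact: cdf.
        exact: (centry _ a (tfield_continuous (tp j))).
      + apply: continuous_mx_measurable => // x; apply: continuousM; last exact: cdf.
        exact: (centry _ a cv).
      + apply: aeW => x _; apply: cvgM; last exact: cvg_cst.
        by apply: cvg_entry; exact: pv.
      + move=> j x _; rewrite normrM; apply: ler_pM => //.
        by apply: le_trans (pc j x); exact: entry_norm_le.
    have [_ _ h2] : [/\ mu.-integrable Omega (EFin \o (fun x => G x a i * f x)),
      \int[mu]_(x in Omega) `|gradient (p j) x a i * f x - G x a i * f x| @[j --> \oo] --> (0 : R) &
      \int[mu]_(x in Omega) (gradient (p j) x a i * f x) @[j --> \oo] --> \int[mu]_(x in Omega) (G x a i * f x)].
      apply: (@Rbounded_convergence _ _ _ mu Omega _ _ (C * Cf)) => //.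
      + by move=> j; apply: measurable_funM => //; exact: continuous_mx_measurable.
      + by apply: measurable_funM => //; exact: continuous_mx_measurable.
      + apply: filterS pG => x h Ox; apply: cvgM; last exact: cvg_cst.
        by apply: cvg_entry; exact: h.
      + by move=> j x _; rewrite normrM; apply: ler_pM.
    apply: (cvg_unique _ h1) => //.
    rewrite (_ : (fun j => _) = (fun j => - \int[mu]_(x in Omega) (gradient (p j) x a i * f x))).
      exact: cvgN.
    by apply/funext => j; have [_ _ ->] := wp j.
split=> //; have wd : weakly_differentiable Omega v by exists G.
(* [weak_gradient] is a chosen representative, equal to G only almost everywhere. *)
have aeG := weak_gradient_ae_unique Omega_open (weak_gradientP wd) wG (aeW _ (fun x _ => erefl)).
have mW := weak_gradient_measurable wd.
have Lv : Linfty Omega v.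
  split=> //; exists (Num.sqrt ((1 * n)%:R * c ^+ 2)); apply: aeW => x _.
  by apply: frobenius_le => // i j; apply: le_trans (entry_norm_le _ _ _) (vc x).
have LG : Linfty Omega (weak_gradient Omega v).
  split=> //; exists (Num.sqrt ((n * n)%:R * C ^+ 2)); apply: filterS aeG => x h /h ->.
  exact: frobenius_le.
split; split=> //; first by split; [exact: Linfty_L1|by []|exact: Linfty_L1].
exists p; split; first by move=> j; exact: tfield_test_field (tp j).
have mpv (w : Rn -> Rn) a : continuous w -> measurable_fun Omega (fun x => w x ord0 a).
  by move=> cw; apply: continuous_mx_measurable => //; exact: centry.
have mfr j (W : Rn -> 'M[R]_n) : (forall a i, measurable_fun Omega (fun x => W x a i)) ->
    measurable_fun Omega (fun x => frobenius (v x - p j x) + frobenius (W x - gradient (p j) x)).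
  move=> mWe; apply: measurable_funD; apply: measurable_frobenius; apply: measurable_fun_mx => // i a.
    rewrite (ord1 i) (_ : (fun x => _) = (fun x => v x ord0 a - p j x ord0 a)).
      by apply: measurable_funB; [exact: mpv|exact: (mpv _ _ (tfield_continuous (tp j)))].
    by apply/funext => x; rewrite mxE [X in _ + X]mxE.
  rewrite (_ : (fun x => _) = (fun x => W x i a - gradient (p j) x i a)); first exact: measurable_funB.
  by apply/funext => x; rewrite mxE [X in _ + X]mxE.
(* Convergence is first proved with G, which is bounded at every point; the chosen representative
   replaces it under the integral at the end. *)
pose h j x := frobenius (v x - p j x) + frobenius (G x - gradient (p j) x).
have mh j : measurable_fun Omega (h j) by exact: mfr.
pose B := Num.sqrt ((1 * n)%:R * (c + c) ^+ 2) + Num.sqrt ((n * n)%:R * (C + C) ^+ 2).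
have subB p' q' (M N : 'M[R]_(p', q')) (r : R) : 0 <= r -> (forall i a, `|M i a| <= r) ->
    (forall i a, `|N i a| <= r) -> frobenius (M - N) <= Num.sqrt ((p' * q')%:R * (r + r) ^+ 2).
  move=> r0 Mr Nr; apply: frobenius_le => [|i a]; first exact: addr_ge0.
  rewrite mxE [X in _ + X]mxE; apply: le_trans (ler_normB _ _) _; exact: lerD.
have hB j x : `|h j x| <= B.
  rewrite ger0_norm ?addr_ge0 ?frobenius_ge0//; apply: lerD; last exact: subB.
  by apply: subB => // i a; [apply: le_trans (vc x)|apply: le_trans (pc j x)]; exact: entry_norm_le.
have [_ _ h0] : [/\ mu.-integrable Omega (EFin \o (fun x => 0 : R)),
    \int[mu]_(x in Omega) `|h j x - 0| @[j --> \oo] --> (0 : R) &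
    \int[mu]_(x in Omega) h j x @[j --> \oo] --> \int[mu]_(x in Omega) (0 : R)].
  apply: (@Rbounded_convergence _ _ _ mu Omega _ _ B) => //.
  apply: filterS pG => x hx Ox; rewrite -[X in _ --> X](addr0 (0 : R)).
  by apply: cvgD; apply: cvg_frobenius; [exact: pv|exact: hx].
have hI j : mu.-integrable Omega (EFin \o h j) by apply: (bounded_integrable (C := B)).
rewrite (_ : (fun j => _) = (fun j => (\int[mu]_(x in Omega) h j x)%:E)).
  rewrite (_ : 0%E = (\int[mu]_(x in Omega) (0 : R))%:E); last by rewrite Rintegral_cst// mul0r.
  by apply: cvg_EFin; [near=> j|exact: h0].
apply/funext => j; rewrite /Rintegral fineK; last exact: (integrable_fin_num mO (hI j)).
apply: ae_eq_integral => //.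
- apply/measurable_EFinP; apply: mfr => a i; apply: loc_integrable_measurable => //.
  by have [] := weak_gradientP wd.
- exact/measurable_EFinP.
- by apply: filterS aeG => x hx /hx ->.
Unshelve. all: by end_near. Qed.

End weak_derivatives.

Section perturbation.
Context {R : realType} {n : nat}.
Local Notation Rn := 'rV[R]_n.
Local Notation mu := (lebesgue_row R n).
Local Opaque jacobian.
Variables (Omega U : set Rn) (J0 : Rn -> 'M[R]_n) (beta : Rn -> Rn -> R) (T : R).
Hypothesis n_gt0 : (0 < n)%N.
Hypothesis Omega_open : open Omega.
Hypothesis Omega_bounded : bounded_set Omega.
Hypothesis U_open : open U.
Hypothesis U_neq0 : U !=set0.
Hypothesis U_sub : U `<=` Omega.
Hypothesis U_full : mu.-negligible (Omega `\` U).
Hypothesis J0_continuous : forall x, U x -> {for x, continuous J0}.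
Hypothesis beta_continuous : forall x y, U x ->
  {for (x, y), continuous (fun p : Rn * Rn => beta p.1 p.2)}.
Hypothesis beta_range : forall x y, U x -> 0 < beta x y <= T.

Lemma tfield_sub w : tfield U w -> tfield Omega w.
Proof.
by move=> [sw [K [cK KU w0]]]; split=> //; exists K; split=> //; exact: subset_trans U_sub.
Qed.

Lemma ae_full : \forall x \ae mu, Omega x -> U x.
Proof.
by apply: negligibleS U_full => x /= /not_implyP[Ox nUx].
Qed.

Lemma exists_perturbation (eps : R) : subsolution U J0 beta (cst 0) -> 0 < eps ->
  exists v G, [/\ W1oo_0 Omega v, is_weak_gradient Omega v G, forall x, `|v x| <= eps,
    continuous v & \forall x \ae mu, Omega x ->
      (J0 x + (G x)^T) *m (J0 x + (G x)^T)^T = (beta x (v x))%:M].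
Proof.
move=> s0 eps0.
have U_bounded : bounded_set U.
  by case: Omega_bounded => M [Mr HM]; exists M; split=> // y /HM h x /U_sub; exact: h.
have [p [v [A [C [[tp pC] [cv v0 ve pv] [mA AC] aeA]]]]] :=
  limit_solution n_gt0 U_open U_neq0 U_bounded J0_continuous beta_continuous beta_range s0 eps0.
have C0 : 0 <= C.
  by have [x Ux] := U_neq0; have i0 := Ordinal n_gt0; apply: le_trans (AC x i0 i0).
(* Extension by zero off U, a null part of [Omega], keeps G measurable and bounded everywhere. *)
pose G x : 'M[R]_n := \matrix_(a, i) ((fun x => A x i a) \_ U) x.
have mU := open_mx_measurable U_open.
have GC x a i : `|G x a i| <= C.
  by rewrite mxE /patch; case: ifPn => // _; rewrite normr0.
have mG a i : measurable_fun Omega (fun x => G x a i).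
  apply: (measurable_funS (@measurableT _ _)) => //.
  rewrite (_ : (fun x => _) = (fun x => A x i a) \_ U); first by apply/(measurable_restrictT _ mU); exact: mA.
  by apply/funext => x; rewrite mxE.
have GA x : U x -> (G x)^T = A x.
  by move=> Ux; apply/matrixP => i a; rewrite !mxE /patch mem_set.
have cG : \forall x \ae mu, Omega x -> gradient (p j) x @[j --> \oo] --> G x.
  apply: filterS2 ae_full aeA => x hU hA Ox; have [cA _] := hA (hU Ox).
  by rewrite -[G x]trmxK (GA x (hU Ox)); exact: cvg_trmx cA.
have [Wv wG] := limit_W1oo_0 Omega_open Omega_bounded (ltW eps0) C0
  (fun j => tfield_sub (tp j)) pC (fun j x => (pv x).1 j) ve cv (fun x => (pv x).2) mG GC cG.
exists v, G; split=> //; apply: filterS2 ae_full aeA => x hU hA Ox.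
by rewrite (GA x (hU Ox)); have [_ ->] := hA (hU Ox).
Qed.

End perturbation.

(** * The scalar equation h(x, X, t I) = Lambda *)

Lemma cvg_to_pair {T : Type} {A B : topologicalType} (F : set_system T) {FF : Filter F}
  (f : T -> A) (g : T -> B) (a : A) (b : B) :
  f x @[x --> F] --> a -> g x @[x --> F] --> b -> (f x, g x) @[x --> F] --> (a, b).
Proof. by move=> fa gb; exact: (cvg_pair fa gb). Qed.

Section scalar_equation.
Context {R : realType} {n : nat}.
Local Notation Rn := 'rV[R]_n.
Variables (Omega : set Rn) (h : Rn -> Rn -> 'M[R]_n -> R).
Hypothesis Omega_open : open Omega.
Hypothesis h_cont : {within
  [set p : 'rV[R]_n * 'rV[R]_n * 'M[R]_n | Omega p.1.1 /\ p.2^T = p.2],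
  continuous (fun p => h p.1.1 p.1.2 p.2)}.
Hypothesis h_mono : forall x X, Omega x ->
  forall s t : R, 0 <= s -> s < t -> h x X s%:M < h x X t%:M.

(** h is continuous only relative to symmetric matrices. Scalar matrices are symmetric and [Omega]
    is open, so the restriction to them is continuous in the ordinary sense. *)
Lemma scalar_continuous x (X : Rn) (t : R) : Omega x ->
  {for (x, X, t), continuous (fun q : Rn * Rn * R => h q.1.1 q.1.2 q.2%:M)}.
Proof.
move=> Ox; pose S := [set p : Rn * Rn * 'M[R]_n | Omega p.1.1 /\ p.2^T = p.2].
have Sx : S (x, X, t%:M) by split=> //=; rewrite tr_scalar_mx.
have H : (fun p : Rn * Rn * 'M[R]_n => h p.1.1 p.1.2 p.2) p @[p --> within S (nbhs (x, X, t%:M))]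
    --> h x X t%:M.
  by have /subspace_continuousP/(_ _ Sx) := h_cont.
have cM : (t' : R)%:M @[t' --> t] --> (t%:M : 'M[R]_n).
  apply: cvg_mx => i j; rewrite mxE (_ : (fun t' => _) = (fun t' : R => t' *+ (i == j))).
    by case: (i == j); [exact: cvg_id|exact: cvg_cst].
  by apply/funext => t'; rewrite mxE.
move=> V /H; rewrite /= nbhs_simpl /within /= => hV.
have cm : (q.1, q.2%:M : 'M[R]_n) @[q --> (x, X, t)] --> (x, X, t%:M : 'M[R]_n).
  apply: (@cvg_to_pair _ _ _ (nbhs (x, X, t))); first exact: cvg_fst.
  by apply: (cvg_comp _ _ (@cvg_snd _ _ (nbhs (x, X)) (nbhs t) _)); exact: cM.
have hO : \forall q \near (x, X, t), Omega q.1.1.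
  have h1 : q.1.1 @[q --> (x, X, t)] --> x.
    by apply: (cvg_comp _ _ (@cvg_fst _ _ (nbhs (x, X)) (nbhs t) _)); exact: cvg_fst.
  by apply: h1; exact: open_nbhs_nbhs.
by apply: filterS2 hO (cm _ hV) => q Oq /= hq; apply: hq; split=> //=; rewrite tr_scalar_mx.
Qed.

Lemma scalar_cvg {T : Type} (F : set_system T) {FF : Filter F} (f g : T -> Rn) (k : T -> R)
  (x X : Rn) (t : R) : Omega x -> f y @[y --> F] --> x -> g y @[y --> F] --> X -> k y @[y --> F] --> t ->
  h (f y) (g y) (k y)%:M @[y --> F] --> h x X t%:M.
Proof.
move=> Ox fx gX kt.
have c : (f y, g y, k y) @[y --> F] --> (x, X, t).
  exact: cvg_to_pair (cvg_to_pair fx gX) kt.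
have hc : h q.1.1 q.1.2 q.2%:M @[q --> (x, X, t)] --> h x X t%:M.
  exact: (@scalar_continuous x X t Ox).
move=> V hV; exact: (c _ (hc V hV)).
Qed.

Lemma scalar_lt x X (s t : R) : Omega x -> 0 <= s -> 0 <= t -> h x X s%:M < h x X t%:M -> s < t.
Proof.
move=> Ox s0 t0 hst; rewrite ltNge; apply/negP; rewrite le_eqVlt => /predU1P[ts|ts].
  by move: hst; rewrite ts ltxx.
by move: hst; apply/negP; rewrite -leNgt; apply: ltW; exact: h_mono.
Qed.

Variables (Lambda alpha0 T : R).
Hypothesis alpha0_gt0 : 0 < alpha0.
Hypothesis alpha0_lt : alpha0 < T.
Hypothesis h_alpha0 : forall x X, Omega x -> h x X alpha0%:M < Lambda.
Hypothesis h_T : forall x X, Omega x -> Lambda < h x X T%:M.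

(** The intermediate value theorem between [alpha0] and T gives a positive root. For continuity, h
    at b + e and at b - e stays on its side of [Lambda] for nearby points, and monotonicity traps
    the nearby roots in between. *)
Lemma scalar_solution : exists b : Rn -> Rn -> R,
  [/\ forall x X, Omega x -> 0 < b x X <= T,
    forall x X, Omega x -> h x X (b x X)%:M = Lambda,
    forall x X s, Omega x -> 0 <= s -> h x X s%:M < Lambda -> s < b x X &
    forall x X, Omega x -> {for (x, X), continuous (fun p : Rn * Rn => b p.1 p.2)}].
Proof.
have H (p : Rn * Rn) : exists t, Omega p.1 -> 0 < t <= T /\ h p.1 p.2 t%:M = Lambda.
  have [Op|Op] := pselect (Omega p.1); last by exists 0.
  have [||t] := @IVT R (fun t => h p.1 p.2 t%:M) alpha0 T Lambda (ltW alpha0_lt).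
  - apply: continuous_subspaceT => t.
    exact: (@scalar_cvg _ (nbhs t) _ (cst p.1) (cst p.2) id p.1 p.2 t Op
      (cvg_cst _) (cvg_cst _) cvg_id).
  - have h1 := h_alpha0 p.2 Op; have h2 := h_T p.2 Op.
    by rewrite ge_min le_max (ltW h1) (ltW h2) orbT.
  rewrite in_itv/= => /andP[at_ tT] ht; exists t => _; split=> //.
  by rewrite tT andbT; exact: lt_le_trans at_.
pose b x X := sval (cid (H (x, X))).
have bP x X : Omega x -> 0 < b x X <= T /\ h x X (b x X)%:M = Lambda := svalP (cid (H (x, X))).
have bgt x X s : Omega x -> 0 <= s -> h x X s%:M < Lambda -> s < b x X.
  move=> Ox s0 hs; have [/andP[/ltW b0 _] hb] := bP x X Ox.
  by apply: (@scalar_lt x X) => //; rewrite hb.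
exists b; split=> //; [by move=> x X /(bP x X)[]|by move=> x X /(bP x X)[]|].
move=> x X Ox; have [/andP[b0 _] hb] := bP x X Ox.
have hO : \forall q \near (x, X), Omega q.1.
  by apply: (@cvg_fst _ _ (nbhs x) (nbhs X)); exact: open_nbhs_nbhs.
have slice s : h q.1 q.2 s%:M @[q --> (x, X)] --> h x X s%:M.
  exact: (@scalar_cvg _ (nbhs (x, X)) _ fst snd (cst s) x X s Ox cvg_fst cvg_snd (cvg_cst _)).
apply/(@cvgrPdist_lt _ _ _ (nbhs (x, X))) => e e0.
have up : \forall q \near (x, X), b q.1 q.2 < b x X + e.
  have h1 : Lambda < h x X (b x X + e)%:M by rewrite -hb; apply: h_mono => //; [exact: ltW|rewrite ltrDl].
  have hn : \forall q \near (x, X), Lambda < h q.1 q.2 (b x X + e)%:M.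
    by apply: (cvgr_gt _ (slice (b x X + e))); exact: h1.
  apply: filterS2 hO hn => q Oq hq; have [/andP[/ltW bq0 _] hbq] := bP q.1 q.2 Oq.
  by apply: (@scalar_lt q.1 q.2) => //; [rewrite addr_ge0 ?ltW|rewrite hbq].
have dn : \forall q \near (x, X), b x X - e < b q.1 q.2.
  (* Monotonicity is available on [0, oo) only; if b - e < 0, the bound follows from positivity of
     the roots. *)
  have [s0|s0] := leP 0 (b x X - e); last first.
    by apply: filterS hO => q Oq; have [/andP[bq0 _] _] := bP q.1 q.2 Oq; exact: lt_trans bq0.
  have h1 : h x X (b x X - e)%:M < Lambda by rewrite -hb; apply: h_mono => //; rewrite gtrBl.
  have hn : \forall q \near (x, X), h q.1 q.2 (b x X - e)%:M < Lambda.
    by apply: (cvgr_lt _ (slice (b x X - e))); exact: h1.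
  by apply: filterS2 hO hn => q Oq hq; exact: bgt.
by apply: filterS2 up dn => q /= h1 h2; rewrite ltr_distlC h2.
Qed.

End scalar_equation.

(** * Piecewise C^1 boundary data and existence *)

Section gluing.
Context {R : realType} {n : nat}.
Local Notation Rn := 'rV[R]_n.
Local Notation mu := (lebesgue_row R n).
Local Opaque jacobian.

Lemma within_closure_continuous {A : topologicalType} (D : set Rn) (f : Rn -> A) x :
  open D -> {within closure D, continuous f} -> D x -> {for x, continuous f}.
Proof.
move=> oD /subspace_continuousP cf Dx V hV.
have Dn : \forall y \near x, D y by exact: open_nbhs_nbhs.
have := cf x (subset_closure Dx) V hV; rewrite /= nbhs_simpl /within /=.
by apply: filterS2 Dn => y Dy; apply; exact: subset_closure.
Qed.

(** By continuity the points of violation form an open set, and a nonempty open set has positive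
    measure. *)
Lemma ae_le_everywhere (U : set Rn) (f : Rn -> R) c : open U ->
  (forall x, U x -> {for x, continuous f}) -> (\forall x \ae mu, U x -> f x <= c) ->
  forall x, U x -> f x <= c.
Proof.
move=> oU cf fc x Ux; rewrite leNgt; apply/negP => cfx.
pose V := [set y | U y /\ c < f y].
have oV : open V.
  rewrite openE => y [Uy cy]; rewrite /interior.
  have h1 : \forall z \near y, U z by exact: open_nbhs_nbhs.
  have h2 : \forall z \near y, c < f z.
    by apply: (@cvgr_gt _ _ (nbhs y) _ f (f y) (cf y Uy)); exact: cy.
  by apply: filterS2 h1 h2 => z Uz cz; split.
have V0 : V !=set0 by exists x.
have fV : \forall y \ae mu, V y -> f y <= c by apply: filterS fc => y h [/h].
by have [y [Uy cy]] := ae_open_exists oV V0 fV; rewrite leNgt cy.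
Qed.

Variable Omega : set Rn.
Hypothesis Omega_open : open Omega.
Hypothesis Omega_bounded : bounded_set Omega.

(** The C^1 representatives of the pieces are glued by the index of the piece. Disjoint open pieces
    make this index locally constant on their union, so no matching across interfaces is
    involved. *)
Lemma piecewise_representative phi : C1_pw Omega phi ->
  exists (U : set Rn) (g : Rn -> Rn) (J : Rn -> 'M[R]_n),
  [/\ open U /\ U `<=` Omega, mu.-negligible (Omega `\` U),
    forall x, U x -> {for x, continuous g}, forall x, U x -> {for x, continuous J} &
    \forall x \ae mu, U x -> phi x = g x /\ weak_gradient Omega phi x = (J x)^T].
Proof.
move=> [[_ wd _] [ O [oO tO nO gO]]].
have H i : {q : (Rn -> Rn) * (Rn -> 'M[R]_n) |
    [/\ forall x, O i x -> {for x, continuous q.1}, forall x, O i x -> {for x, continuous q.2} &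
      \forall x \ae mu, O i x -> phi x = q.1 x /\ weak_gradient Omega phi x = q.2 x]}.
  apply/cid; have [g [[cg dg [Dg [cDg gDg]]] phig]] := gO i; have [oi Oi] := oO i.
  have cDg' x : O i x -> {for x, continuous Dg} by exact: within_closure_continuous.
  exists (g, Dg); split=> //= [x|]; first exact: within_closure_continuous.
  have w1 := is_weak_gradient_sub oi Oi (weak_gradientP wd).
  have w2 := differentiable_is_weak_gradient oi dg gDg cDg'.
  by apply: filterS2 phig (weak_gradient_ae_unique oi w1 w2 phig) => x h1 h2 Ox; split; auto.
pose idx x := xget 0%N [set i | O i x].
have idxE i x : O i x -> idx x = i.
  move=> Ox; apply/(tO (idx x) i Logic.I Logic.I); exists x; split=> //.
  exact: (@xgetI _ 0%N [set i | O i x] i Ox).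
pose q i := sval (H i).
have qP i := svalP (H i).
pose g x := (q (idx x)).1 x; pose J x := ((q (idx x)).2 x)^T.
have near_idx i x : O i x -> \forall y \near x, idx y = i.
  move=> Ox; have h : \forall y \near x, O i y by apply: open_nbhs_nbhs; split=> //; exact: (oO i).1.
  by apply: filterS h => y; exact: idxE.
exists (\bigcup_i O i), g, J; split.
- split; first by apply: bigcup_open => i _; exact: (oO i).1.
  by move=> x [i _]; exact: (oO i).2.
- exact: nO.
- move=> x [i _ Ox]; have [cq _ _] := qP i.
  rewrite /prop_for /continuous_at /g (idxE i x Ox).
  apply: cvg_trans (cq x Ox); apply: (@near_eq_cvg _ _ (nbhs x)).
  by apply: filterS (near_idx i x Ox) => y ->.
- move=> x [i _ Ox]; have [_ cq _] := qP i.
  rewrite /prop_for /continuous_at /J (idxE i x Ox).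
  have h : ((q i).2 y)^T @[y --> x] --> ((q i).2 x)^T by apply: (@cvg_trmx _ _ (nbhs x)); exact: cq.
  apply: cvg_trans h; apply: (@near_eq_cvg _ _ (nbhs x)).
  by apply: filterS (near_idx i x Ox) => y ->.
- have : \forall x \ae mu, forall i, O i x -> phi x = (q i).1 x /\ weak_gradient Omega phi x = (q i).2 x.
    by apply/ae_foralln => i; have [_ _] := qP i.
  apply: filterS => x h [i _ Ox]; have [h1 h2] := h i Ox.
  by rewrite /g /J (idxE i x Ox) trmxK.
Qed.

Lemma ess_sup_on_ge (f : Rn -> \bar R) :
  \forall x \ae mu, Omega x -> (f x <= ess_sup_on Omega f)%E.
Proof.
have := ess_sup_ge mu (fun x => if x \in Omega then f x else -oo%E).
by apply: filterS => x hx Ox; rewrite mem_set in hx.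
Qed.

(** The intermediate e matters: a weak bound by e < c extends by continuity from almost every point
    to all points and remains strict with respect to c. *)
Lemma ess_sup_on_lt (f : Rn -> R) (c : R) : (ess_sup_on Omega (EFin \o f) < c%:E)%E ->
  exists2 e, e < c & \forall x \ae mu, Omega x -> f x <= e.
Proof.
set E := ess_sup_on _ _ => Ec.
have h : \forall x \ae mu, Omega x -> ((f x)%:E <= E)%E.
  exact: ess_sup_on_ge.
case: E h Ec => [e| |] h Ec.
- by exists e; rewrite -?lte_fin//; apply: filterS h => x h /h; rewrite lee_fin.
- by [].
- by exists (c - 1); [rewrite gtrBl|apply: filterS h => x h /h; rewrite leeNy_eq].
Qed.

Lemma Linfty_norm_ge (G : Rn -> 'M[R]_n) : Linfty Omega G ->
  \forall x \ae mu, Omega x -> frobenius (G x) <= Linfty_norm Omega G.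
Proof.
move=> [_ [M GM]]; rewrite /Linfty_norm; set E := ess_sup_on _ _.
have h : \forall x \ae mu, Omega x -> ((frobenius (G x))%:E <= E)%E.
  exact: ess_sup_on_ge.
have EM : (E <= M%:E)%E.
  apply/ess_supP; apply: filterS GM => x hx; case: ifPn => [/set_mem Ox|_]; last exact: leNye.
  by rewrite lee_fin; exact: hx.
apply: filterS h => x hx Ox; have := hx Ox; move: EM; case: E {hx} => [e| |]//=.
Qed.

End gluing.

Section existence.
Context {R : realType} {n : nat}.
Local Notation Rn := 'rV[R]_n.
Local Notation mu := (lebesgue_row R n).
Local Opaque jacobian.
Variables (Omega : set Rn) (phi : Rn -> Rn) (H h : Rn -> Rn -> 'M[R]_n -> R).
Variables (alpha0 Lambda : R).
Hypothesis n_gt0 : (0 < n)%N.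
Hypothesis Omega_open : open Omega.
Hypothesis Omega_bounded : bounded_set Omega.
Hypothesis Omega_neq0 : Omega !=set0.
Hypothesis phi_C1pw : C1_pw Omega phi.
Hypothesis H_def : forall x X (M : 'M[R]_n), Omega x -> H x X M = h x X (M^T *m M).
Hypothesis h_cont : {within
  [set p : 'rV[R]_n * 'rV[R]_n * 'M[R]_n | Omega p.1.1 /\ p.2^T = p.2],
  continuous (fun p => h p.1.1 p.1.2 p.2)}.
Hypothesis h_mono : forall x X, Omega x ->
  forall s t : R, 0 <= s -> s < t -> h x X s%:M < h x X t%:M.
Hypothesis alpha0_gt0 : 0 < alpha0.
Hypothesis h_lim : inf_scalar Omega h t @[t --> +oo%R] --> +oo%E.
Hypothesis Lambda_gt : (Lambda_star Omega phi h alpha0 < Lambda%:E)%E.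

Lemma scalar_solution_exists : exists (b : Rn -> Rn -> R) (T : R),
  [/\ forall x X, Omega x -> 0 < b x X <= T,
    forall x X, Omega x -> h x X (b x X)%:M = Lambda,
    forall x X s, Omega x -> 0 <= s -> h x X s%:M < Lambda -> s < b x X &
    forall x X, Omega x -> {for (x, X), continuous (fun p : Rn * Rn => b p.1 p.2)}].
Proof.
have hn : \forall t \near +oo%R, (Lambda%:E < inf_scalar Omega h t)%E.
  by have /cvgeyPgt := h_lim; exact.
(* T is a level at which h exceeds [Lambda] uniformly; it bounds every root. *)
have [T [hT aT]] := filter_ex (filterI hn (nbhs_pinfty_gt (num_real alpha0))).
have h1 x X : Omega x -> h x X alpha0%:M < Lambda.
  move=> Ox; move: Lambda_gt; rewrite /Lambda_star gt_max => /andP[_].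
  rewrite -lte_fin; apply: le_lt_trans.
  by apply: ereal_sup_ubound; exists (x, X).
have h2 x X : Omega x -> Lambda < h x X T%:M.
  move=> Ox; rewrite -lte_fin; apply: lt_le_trans hT _.
  by apply: ereal_inf_lbound; exists (x, X).
by have [b hb] := scalar_solution Omega_open h_cont h_mono alpha0_gt0 aT h1 h2; exists b, T.
Qed.

Lemma opsq_le_scalar_lt (M : 'M[R]_n) c c' : opsq_le M c -> M *m M^T = c'%:M -> c' <= c.
Proof.
move=> Mc MM; have := Mc (delta_mx ord0 (Ordinal n_gt0)).
by rewrite [X in X <= _]/fsq mdot_mulmx -mulmxA MM mul_mx_scalar mdotZr -/(fsq _) fsq_delta !mulr1.
Qed.

Lemma exists_small_solution (eps : R) : 0 < eps -> exists v : Rn -> Rn,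
  [/\ continuous v, forall x, `|v x| <= eps, exists2 x, Omega x & v x <> 0 &
    strong_solution Omega phi H (fun x => phi x + v x) Lambda].
Proof.
move=> eps0; have [b [T [bT hb b_gt cb]]] := scalar_solution_exists.
have [U [g [J [[oU UO] nU cg cJ aeU]]]] := piecewise_representative phi_C1pw.
have fullU := ae_full nU.
have U0 : U !=set0.
  by have [x _ Ux] := ae_open_exists Omega_open Omega_neq0 fullU; exists x.
have [[_ wphi Lphi] _] := phi_C1pw.
pose L := Linfty_norm Omega (weak_gradient Omega phi).
have L0 : 0 <= L ^+ 2 by exact: sqr_ge0.
have JL x : U x -> fsq (J x) <= L ^+ 2.
  apply: (ae_le_everywhere (f := fun x => fsq (J x)) oU) => [y Uy|].
    exact: (@cvg_mdot R _ (nbhs y) _ n n _ _ _ _ (cJ y Uy) (cJ y Uy)).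
  apply: filterS2 aeU (Linfty_norm_ge Lphi) => y hy hL Uy; have [_ Jy] := hy Uy.
  have := hL (UO _ Uy); rewrite Jy frobeniusE fsq_tr => hLy.
  rewrite -(sqr_sqrtr (fsq_ge0 (J y))) lerXn2r// ?nnegrE ?sqrtr_ge0//.
  by apply: le_trans hLy; exact: sqrtr_ge0.
(* Here [Lambda] above [Lambda_star] becomes strictness of the datum, at every point of U by
   continuity of h and g. *)
have bL x : U x -> L ^+ 2 < b x (g x).
  move=> Ux; apply: b_gt => //; first exact: UO.
  have [e eL he] : exists2 e, e < Lambda &
      \forall x \ae mu, Omega x -> h x (phi x) (L ^+ 2)%:M <= e.
    apply: (@ess_sup_on_lt R n Omega (fun x => h x (phi x) (L ^+ 2)%:M)).
    by move: Lambda_gt; rewrite /Lambda_star gt_max => /andP[].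
  apply: le_lt_trans eL.
  apply: (ae_le_everywhere (f := fun x => h x (g x) (L ^+ 2)%:M) oU) Ux => [y Uy|].
    exact: (@scalar_cvg R n Omega h Omega_open h_cont _ (nbhs y) _ id g (cst (L ^+ 2)) y (g y) (L ^+ 2)
      (UO _ Uy) cvg_id (cg y Uy) (cvg_cst _)).
  by apply: filterS2 aeU he => y hy hL Uy; have [<- _] := hy Uy; exact: hL (UO _ Uy).
(* The root is read at datum plus correction, so zero becomes the initial subsolution. *)
pose beta x y := b x (g x + y).
have cbeta x y : U x -> {for (x, y), continuous (fun p : Rn * Rn => beta p.1 p.2)}.
  move=> Ux.
  have hc : (p.1, g p.1 + p.2) @[p --> (x, y)] --> (x, g x + y).
    apply: (@cvg_to_pair _ _ _ (nbhs (x, y))); first exact: cvg_fst.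
    apply: (@cvgD _ _ _ (nbhs (x, y))); last exact: cvg_snd.
    have hf : p.1 @[p --> (x, y)] --> x by exact: cvg_fst.
    by move=> V hV; exact: (hf _ (cg x Ux V hV)).
  have hB : b q.1 q.2 @[q --> (x, g x + y)] --> b x (g x + y) by exact: (@cb x (g x + y) (UO _ Ux)).
  by move=> V hV; exact: (hc _ (hB V hV)).
have beta_range x y : U x -> 0 < beta x y <= T by move=> Ux; exact: bT (UO _ Ux).
have s0 : subsolution U J beta (cst 0).
  split; first exact: tfield0.
  move=> x Ux; exists (L ^+ 2); first by rewrite /beta addr0; exact: bL.
  by rewrite jacobian_tfield0 addr0; apply: opsq_le_fsq; exact: JL.
have [v [G [Wv wG ve cv aeG]]] := exists_perturbation n_gt0 Omega_open Omega_bounded oU U0 UO nU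
  cJ cbeta beta_range s0 eps0.
exists v; split; [exact: cv|exact: ve| |].
(* If v vanished, so would G almost everywhere, and J J^T = b I would hold at some point; but the
   squared singular values of J are at most L^2 < b there. *)
- apply: contrapT => nv.
  have v0 x : Omega x -> v x = 0 by move=> Ox; apply: contrapT => vx; apply: nv; exists x.
  have w0 : is_weak_gradient Omega (cst 0 : Rn -> Rn) (cst 0).
    apply: differentiable_is_weak_gradient => // [x _|x _].
      by rewrite /gradient jacobian_tfield0 trmx0.
    exact: (@cst_continuous _ _ _ x).
  have G0 := weak_gradient_ae_unique Omega_open wG w0 (aeW _ v0).
  have aeJ : \forall x \ae mu, U x -> J x *m (J x)^T = (b x (g x))%:M.
    apply: filterS2 G0 aeG => x hG hx Ux; have := hx (UO _ Ux).
    by rewrite (hG (UO _ Ux)) trmx0 addr0 (v0 _ (UO _ Ux)) /beta addr0.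
  have [x Ux Jx] := ae_open_exists oU U0 aeJ.
  have := opsq_le_scalar_lt (opsq_le_fsq (JL x Ux)) Jx.
  by rewrite leNgt bL.
- split.
    by rewrite /W1oo_bd (_ : (fun x => _) = v)//; apply/funext => x; rewrite addrAC subrr add0r.
  have wu := is_weak_gradientD Omega_open (weak_gradientP wphi) wG.
  have wd : weakly_differentiable Omega (fun x => phi x + v x) by exists (fun x => weak_gradient Omega phi x + G x).
  have aeu := weak_gradient_ae_unique Omega_open (weak_gradientP wd) wu (aeW _ (fun x _ => erefl)).
  have aeUO : \forall x \ae mu, Omega x -> phi x = g x /\ weak_gradient Omega phi x = (J x)^T.
    by apply: filterS2 fullU aeU => x h1 h2 /h1 /h2.
  apply: filterS3 aeu aeUO aeG => x h1 h2 h3 Ox; rewrite (h1 Ox).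
  have [-> ->] := h2 Ox; rewrite H_def//.
  have -> : (J x)^T + G x = (J x + (G x)^T)^T by rewrite linearD/= trmxK.
  by rewrite trmxK (h3 Ox); exact: hb.
Qed.

Lemma exists_solution_sequence : exists v : nat -> Rn -> Rn,
  (forall k, strong_solution Omega phi H (fun x => phi x + v k x) Lambda) /\
  forall j k, (j < k)%N -> ~ ae_eq_on Omega (fun x => phi x + v j x) (fun x => phi x + v k x).
Proof.
pose P (eps : R) v x := [/\ continuous v, forall x, `|v x| <= eps, Omega x /\ v x <> 0 &
  strong_solution Omega phi H (fun x => phi x + v x) Lambda].
have Pex eps : exists q : (Rn -> Rn) * Rn, 0 < eps -> P eps q.1 q.2.
  have [eps0|_] := ltP 0 eps; last by exists (cst 0, 0).
  by have [v [cv ve [x Ox vx] sv]] := exists_small_solution eps0; exists (v, x).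
pose q eps := sval (cid (Pex eps)).
have qP eps : 0 < eps -> P eps (q eps).1 (q eps).2 := svalP (cid (Pex eps)).
(* The next size is half of the value of the current correction at its witness, so every later
   correction is strictly smaller there. *)
pose e := fix e k := if k is k'.+1 then `|(q (e k')).1 (q (e k')).2| / 2 else 1.
have e0 k : 0 < e k.
  elim: k => //= k IH; have [_ _ [_ /eqP vx] _] := qP _ IH.
  by rewrite divr_gt0// normr_gt0.
have eS k : e k.+1 <= e k.
  have [_ vb _ _] := qP _ (e0 k); have v1 := vb (q (e k)).2.
  rewrite /= ler_pdivrMr//; apply: le_trans v1 _.
  by rewrite mulr_natr mulr2n lerDl ltW.
have emono i j : (i <= j)%N -> e j <= e i.
  move=> ij; rewrite -lerN2; apply: (@homo_leq _ (fun k => - e k) (fun x y => x <= y)) => //.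
    by move=> y x z; exact: le_trans.
  by move=> k; rewrite lerN2.
exists (fun k => (q (e k)).1); split=> [k|j k jk hae]; first by have [] := qP _ (e0 k).
have [cj _ [Oxj vxj] _] := qP _ (e0 j); have [ck vk _ _] := qP _ (e0 k).
set vj := (q (e j)).1 in cj vxj hae; set xj := (q (e j)).2 in Oxj vxj.
set w := (q (e k)).1 in ck vk hae.
(* Both corrections are continuous, so almost everywhere equality would hold at the witness too. *)
have d0 x : Omega x -> `|vj x - w x| <= 0.
  apply: (ae_le_everywhere (f := fun x => `|vj x - w x|) Omega_open) => [y _|].
    by apply: (@cvg_norm _ _ _ (nbhs y)); apply: (@cvgB _ _ _ (nbhs y)); [exact: cj|exact: ck].
  by apply: filterS hae => y hy Oy; have /addrI -> := hy Oy; rewrite subrr normr0.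
have := d0 xj Oxj; rewrite normr_le0 subr_eq0 => /eqP vw.
have := le_trans (vk xj) (emono _ _ jk); rewrite -vw /= -/vj -/xj.
have : 0 < `|vj xj| by rewrite normr_gt0; exact/eqP.
by move: `|_| => r r0; rewrite leNgt ltr_pdivrMr// mulr_natr mulr2n ltrDl r0.
Qed.

End existence.

(** Common core of both cases of the theorem: all roots are positive, so monotonicity on [0, oo)
    serves for either. *)
Lemma Lambda_star_solutions (R : realType) (n : nat) (n_gt0 : (0 < n)%N)
  (Omega : set 'rV[R]_n) (Omega_open : open Omega)
  (Omega_bounded : bounded_set Omega) (Omega_neq0 : Omega !=set0)
  (phi : 'rV[R]_n -> 'rV[R]_n) (phi_C1pw : C1_pw Omega phi)
  (H h : 'rV[R]_n -> 'rV[R]_n -> 'M[R]_n -> R)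
  (H_def : forall x X (M : 'M[R]_n), Omega x -> H x X M = h x X (M^T *m M))
  (h_cont : {within
      [set p : 'rV[R]_n * 'rV[R]_n * 'M[R]_n | Omega p.1.1 /\ p.2^T = p.2],
      continuous (fun p => h p.1.1 p.1.2 p.2)})
  (h_mono : forall x X, Omega x ->
      forall s t : R, 0 <= s -> s < t -> h x X s%:M < h x X t%:M)
  (alpha0 : R) (alpha0_gt0 : 0 < alpha0)
  (h_lim : inf_scalar Omega h t @[t --> +oo%R] --> +oo%E) :
  infinitely_many_solutions Omega phi H (Lambda_star Omega phi h alpha0).
Proof.
have main (Lambda : R) : (Lambda_star Omega phi h alpha0 < Lambda%:E)%E ->
    exists s : nat -> 'rV[R]_n -> 'rV[R]_n,
      (forall k, strong_solution Omega phi H (s k) Lambda) /\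
      forall j k, j <> k -> ~ ae_eq_on Omega (s j) (s k).
  move=> hL; have [v [sv dv]] := exists_solution_sequence n_gt0 Omega_open Omega_bounded
    Omega_neq0 phi_C1pw H_def h_cont h_mono alpha0_gt0 h_lim hL.
  exists (fun k x => phi x + v k x); split=> // j k /eqP; rewrite neq_ltn => /orP[jk|kj].
    exact: dv.
  by move=> hae; apply: (dv k j kj); apply: filterS hae => x hx /hx.
split=> [Loo|//].
have [Lambda hL] : exists Lambda : R, (Lambda_star Omega phi h alpha0 < Lambda%:E)%E.
  case: (Lambda_star _ _ _ _) Loo => [r| |] // _; last by exists 0; exact: ltNyr.
  by exists (r + 1); rewrite lte_fin ltrDl.
have [s [sS sD]] := main Lambda hL.
exists (fun k => (s k, Lambda)); split=> [k|j k jk [hae _]]; last exact: (sD j k jk).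
by split; [exact: hL|exact: sS].
Qed.

Theorem proposition2 (R : realType) (n : nat) (n_gt0 : (0 < n)%N)
  (Omega : set 'rV[R]_n) (Omega_open : open Omega)
  (Omega_bounded : bounded_set Omega) (Omega_neq0 : Omega !=set0)
  (phi : 'rV[R]_n -> 'rV[R]_n) (phi_C1pw : C1_pw Omega phi)
  (H h : 'rV[R]_n -> 'rV[R]_n -> 'M[R]_n -> R)
  (H_def : forall x X (M : 'M[R]_n), Omega x -> H x X M = h x X (M^T *m M))
  (h_cont : {within
      [set p : 'rV[R]_n * 'rV[R]_n * 'M[R]_n | Omega p.1.1 /\ p.2^T = p.2],
      continuous (fun p => h p.1.1 p.1.2 p.2)})
  (alpha0 : R) (alpha0_gt0 : 0 < alpha0)
  (h_sup : (sup_scalar Omega h alpha0 < +oo)%E)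
  (h_lim : inf_scalar Omega h t @[t --> +oo%R] --> +oo%E) :
  ((forall x X, Omega x -> forall s t : R, s < t -> h x X s%:M < h x X t%:M) ->
    infinitely_many_solutions Omega phi H (Lambda_star Omega phi h alpha0)) /\
  ((forall x X (S : 'M[R]_n), Omega x -> S^T = S -> 0 <= h x X S) ->
   (forall x X, Omega x ->
      forall s t : R, 0 <= s -> s < t -> h x X s%:M < h x X t%:M) ->
    infinitely_many_solutions Omega phi H (Lambda_star Omega phi h alpha0) /\
    (0 <= Lambda_star Omega phi h alpha0)%E).
Proof.
split=> [h_mono|h_ge0 h_mono].
  apply: Lambda_star_solutions => // x X Ox s t _; exact: h_mono.
split; first exact: Lambda_star_solutions.
have [x Ox] := Omega_neq0.
rewrite /Lambda_star le_max; apply/orP; right.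
apply: (@le_trans _ _ (h x 0 alpha0%:M)%:E); last by apply: ereal_sup_ubound; exists (x, 0).
by rewrite lee_fin; apply: h_ge0 => //; exact: tr_scalar_mx.
Qed.
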